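(* Let $\chi$ be the character of $\Gamma=SL(2,\mathbb{Z})$ with $\chi(T)=e^{2\pi i/12}$, and for an integer $c$ let $\chi^c$ also denote the corresponding $1$-dimensional $\mathbb{C}\Gamma$-module. Let $V$ be a $2$-dimensional indecomposable $\mathbb{C}\Gamma$-module occurring in a short exact sequence $0\to\chi^a\xrightarrow{i}V\xrightarrow{j}\chi^b\to0$ with $0\le a,b\le 11$ and $a-b\equiv\pm2\pmod{12}$, furnishing an upper triangular representation $\rho$ (with respect to a basis whose first vector spans $i(\chi^a)$). Then one of the following holds: (a) there is a split short exact sequence of graded $\mathcal{M}$-modules $0\to\mathcal{H}(\chi^a)\xrightarrow{i_*}\mathcal{H}(V)\xrightarrow{j_*}\mathcal{H}(\chi^b)\to0$; (b) $(a,b)=(10,0)$ or $(11,1)$, and there is an exact sequence of graded $\mathcal{M}$-modules $0\to\mathcal{H}(\chi^a)\xrightarrow{i_*}\mathcal{H}(V)\xrightarrow{j_*}\mathcal{H}(\chi^b)\to\mathbb{C}_b\to0$, where $\mathbb{C}_b$ is the $1$-dimensional graded $\mathcal{M}$-module concentrated in weight $b$.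
   Context: $T=\begin{pmatrix}1&1\\0&1\end{pmatrix}$. For a finite-dimensional $\Gamma$-module $X$ (here all are $T$-unitarizable with $S^2$ acting by $\pm1$) with matrix representation $\rho_X$ in a basis where $\rho_X(T)=\mathrm{diag}(e^{2\pi i m_1},\dots,e^{2\pi i m_n})$, $0\le m_j<1$: a vector-valued modular form of weight $k$ for $X$ is a holomorphic $F=(f_1,\dots,f_n)^t$ on the upper half-plane with $(c\tau+d)^{-k}F(\gamma\tau)=\rho_X(\gamma)F(\tau)$ for all $\gamma=\begin{pmatrix}a&b\\c&d\end{pmatrix}\in\Gamma$ and $f_j=\sum_{n\ge0}a_{jn}q^{m_j+n}$, $q=e^{2\pi i\tau}$. $\mathcal{H}(X)=\bigoplus_k\mathcal{H}(k,X)$ is the graded space of these, a graded module over $\mathcal{M}=\mathbb{C}[E_4,E_6]$ (level one holomorphic modular forms) by multiplication. For a $\Gamma$-map $\alpha:X\to Y$, $\alpha_*F=\alpha\circ F$. *)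

(* Defs.v *)
From HB Require Import structures.
From mathcomp Require Import all_boot all_order all_algebra.
From mathcomp Require Import all_classical all_reals all_analysis.
From mathcomp Require Import complex ring lra.

Set Implicit Arguments.
Unset Strict Implicit.
Unset Printing Implicit Defensive.
Import Order.TTheory GRing.Theory Num.Theory numFieldNormedType.Exports.
Local Open Scope classical_set_scope.
Local Open Scope complex_scope.
Local Open Scope ring_scope.

Definition SL2Z := {g : 'M[int]_2 | \det g == 1}.
HB.instance Definition _ := Choice.on SL2Z.

Fact SL2Z_one_subproof : \det (1%:M : 'M[int]_2) == 1.
Proof. by rewrite det1. Qed.

Fact SL2Z_mul_subproof (g h : SL2Z) : \det (val g *m val h) == 1.
Proof. by rewrite det_mulmx (eqP (valP g)) (eqP (valP h)) mulr1. Qed.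

Fact SL2Z_inv_subproof (g : SL2Z) : \det (\adj (val g)) == 1.
Proof.
have := det_mulmx (val g) (\adj (val g)).
by rewrite mul_mx_adj (eqP (valP g)) det1 mul1r => <-.
Qed.

Definition SL2Z_one : SL2Z := Sub (1%:M : 'M[int]_2) SL2Z_one_subproof.
Definition SL2Z_mul (g h : SL2Z) : SL2Z := Sub (val g *m val h) (SL2Z_mul_subproof g h).
Definition SL2Z_inv (g : SL2Z) : SL2Z := Sub (\adj (val g)) (SL2Z_inv_subproof g).

Fact SL2Z_mulA : associative SL2Z_mul.
Proof. by move=> f g h; apply/val_inj; rewrite /= mulmxA. Qed.
Fact SL2Z_mul1 : left_id SL2Z_one SL2Z_mul.
Proof. by move=> g; apply/val_inj; rewrite /= mul1mx. Qed.
Fact SL2Z_mulr1 : right_id SL2Z_one SL2Z_mul.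
Proof. by move=> g; apply/val_inj; rewrite /= mulmx1. Qed.
Fact SL2Z_mulV : left_inverse SL2Z_one SL2Z_inv SL2Z_mul.
Proof. by move=> g; apply/val_inj; rewrite /= mul_adj_mx (eqP (valP g)). Qed.
Fact SL2Z_mulrV : right_inverse SL2Z_one SL2Z_inv SL2Z_mul.
Proof. by move=> g; apply/val_inj; rewrite /= mul_mx_adj (eqP (valP g)). Qed.

HB.instance Definition _ :=
  isGroup.Build SL2Z SL2Z_mulA SL2Z_mul1 SL2Z_mulr1 SL2Z_mulV SL2Z_mulrV.

Definition SL2Z_T_mx : 'M[int]_2 :=
  \matrix_(i < 2, j < 2) (if (i <= j)%N then 1 else 0).

Fact SL2Z_T_subproof : \det SL2Z_T_mx == 1.
Proof.
rewrite (expand_det_row _ ord0) !big_ord_recl big_ord0 /cofactor.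
by rewrite !det_mx11 !mxE.
Qed.

Definition SL2Z_T : SL2Z :=
  exist (fun g : 'M[int]_2 => \det g == 1) SL2Z_T_mx SL2Z_T_subproof.

Definition cexp (R : realType) (z : R[i]) : R[i] :=
  (expR (complex.Re z))%:C * (cos (complex.Im z) +i* sin (complex.Im z)).

Definition e2pi (R : realType) (z : R[i]) : R[i] :=
  cexp ((pi *+ 2)%:C * 'i * z).

Definition uhp (R : realType) := {z : R[i] | 0 < complex.Im z}.

Section UpperHalfPlane.
Variable R : realType.
Local Notation C := R[i].
Implicit Types (g : SL2Z) (t : uhp R) (f : uhp R -> C).

Definition aut_factor g t : C :=
  (val g 1 0)%:~R * val t + (val g 1 1)%:~R.

Definition moebius g t : C :=
  ((val g 0 0)%:~R * val t + (val g 0 1)%:~R) / aut_factor g t.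

Lemma SL2Z_det g : val g 0 0 * val g 1 1 - val g 0 1 * val g 1 0 = 1.
Proof.
have /eqP := valP g; rewrite (expand_det_row _ ord0) !big_ord_recl big_ord0.
rewrite /cofactor !det_mx11 !mxE /= addr0.
have -> : lift 0 0 = 1 :> 'I_2 by apply/val_inj.
have -> : lift 1 0 = 0 :> 'I_2 by apply/val_inj.
by rewrite expr0 expr1 => h; rewrite -[RHS]h; ring.
Qed.

Lemma intrC (n : int) : n%:~R = (n%:~R)%:C :> C.
Proof. by rewrite rmorph_int. Qed.

Lemma SL2Z_detR g : (val g 0 0)%:~R * (val g 1 1)%:~R
  - (val g 0 1)%:~R * (val g 1 0)%:~R = 1 :> R.
Proof. by rewrite -!intrM -intrB SL2Z_det. Qed.

Lemma aut_factor_neq0 g t : aut_factor g t != 0.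
Proof.
rewrite /aut_factor !intrC; case: t => -[x y] /= y0.
rewrite eq_complex /= !mul0r !subr0 !addr0.
apply/negP => /andP[/eqP h1 /eqP h2].
have c0 : (val g 1 0)%:~R = 0 :> R.
  by move/eqP: h2; rewrite mulf_eq0 (gt_eqF y0) orbF => /eqP.
have := SL2Z_detR g; rewrite c0 mulr0 subr0.
move: h1; rewrite c0 mul0r add0r => ->; rewrite mulr0 => /esym/eqP.
by rewrite oner_eq0.
Qed.

Fact moebius_subproof g t : 0 < complex.Im (moebius g t).
Proof.
have := aut_factor_neq0 g t; rewrite /moebius.
have := SL2Z_detR g; rewrite /aut_factor !intrC.
set a := (val g 0 0)%:~R; set b := (val g 0 1)%:~R.
set c := (val g 1 0)%:~R; set d := (val g 1 1)%:~R.
case: t => -[x y] /= y0 detg.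
rewrite eq_complex /= !mul0r !subr0 !addr0 => n0.
set u := c * x + d; set v := c * y.
have n2 : 0 < u ^+ 2 + v ^+ 2.
  rewrite lt_neqAle addr_ge0 ?sqr_ge0// andbT eq_sym.
  by rewrite paddr_eq0 ?sqr_ge0// !sqrf_eq0.
have -> : (a * x + b) * - (v / (u ^+ 2 + v ^+ 2)) +
          a * y * (u / (u ^+ 2 + v ^+ 2)) = y / (u ^+ 2 + v ^+ 2).
  rewrite -[in RHS](mulr1 y) -detg /u /v; field.
  by rewrite -/u -/v gt_eqF.
exact: divr_gt0.
Qed.

Definition SL2Z_act g t : uhp R := exist _ (moebius g t) (moebius_subproof g t).

(** Functions on the upper half-plane are extended by zero to [C] so that the
    library's notion of derivative applies. *)
Definition extend f (z : C) : C := if insub z is Some t then f t else 0.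

Definition holomorphic f :=
  forall t, @derivable C C^o C^o (extend f) (val t) 1.

Definition has_qexp (m : R) f (a : nat -> C) :=
  forall t, series (fun n => a n * e2pi ((m + n%:R)%:C * val t) : C^o) @ \oo
            --> (f t : C^o).

End UpperHalfPlane.

(** A finite-dimensional [SL2Z]-module on which [T] is unitarizable is given in
    coordinates with respect to a basis of eigenvectors of [T]; the eigenvalues
    are [e^(2 pi i m_j)], where [0 <= m_j < 1] and [m_j = gexp j]. *)
Record gammaMod (R : realType) (n : nat) := GammaMod {
  gmx :> SL2Z -> 'M[R[i]]_n;
  gmx1 : gmx 1%g = 1%:M;
  gmxM : forall g h, gmx (g * h)%g = gmx g *m gmx h;
  gexp : 'I_n -> R;
  gexp_bound : forall j, 0 <= gexp j < 1;
  gmxT : gmx SL2Z_T = diag_mx (\row_j e2pi (gexp j)%:C)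
}.

Record gammaMap (R : realType) n p (X : gammaMod R n) (Y : gammaMod R p) :=
  GammaMap {
  hmx :> 'M[R[i]]_(p, n);
  hmxP : forall g, hmx *m X g = Y g *m hmx
}.

Section GammaMod.
Variable R : realType.
Local Notation C := R[i].

Definition gamma_invariant n (X : gammaMod R n) (U : {vspace 'cV[C]_n}) :=
  forall g v, v \in U -> X g *m v \in U.

Definition gamma_indecomposable n (X : gammaMod R n) :=
  (0 < n)%N /\
  forall U W : {vspace 'cV[C]_n}, gamma_invariant X U -> gamma_invariant X W ->
    (U + W)%VS = fullv -> (U :&: W)%VS = 0%VS -> U = 0%VS \/ W = 0%VS.

Definition gamma_short_exact n p r (X : gammaMod R n) (Y : gammaMod R p)
    (Z : gammaMod R r) (i : gammaMap X Y) (j : gammaMap Y Z) :=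
  [/\ injective (fun x : 'cV[C]_n => i *m x),
      forall y : 'cV[C]_p, j *m y = 0 <-> exists x : 'cV[C]_n, i *m x = y
    & forall z : 'cV[C]_r, exists y : 'cV[C]_p, j *m y = z].

Record is_character (chi : SL2Z -> C) : Prop := IsCharacter {
  character1 : chi 1%g = 1;
  characterM : forall g h, chi (g * h)%g = chi g * chi h
}.

End GammaMod.

Section Closure.
Variable R : realType.
Local Notation C := R[i].
Implicit Types (f g : uhp R -> C) (t : uhp R).

Lemma cexpD (z w : C) : cexp (z + w) = cexp z * cexp w.
Proof.
case: z w => [a b] [c d]; rewrite /cexp /= expRD sinD cosD.
by apply/eqP; rewrite eq_complex /=; apply/andP; split; apply/eqP; ring.
Qed.

Lemma e2piD (z w : C) : e2pi (z + w) = e2pi z * e2pi w.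
Proof. by rewrite /e2pi mulrDr cexpD. Qed.

Lemma e2pi_real (r : R) :
  e2pi r%:C = cos ((pi *+ 2) * r) +i* sin ((pi *+ 2) * r).
Proof.
rewrite /e2pi /cexp.
have -> : (pi *+ 2)%:C * 'i * r%:C = 0 +i* ((pi *+ 2) * r) :> C.
  by apply/eqP; rewrite eq_complex /=; apply/andP; split; apply/eqP; ring.
by rewrite /= expR0 mul1r.
Qed.

Lemma e2pi0 : e2pi (0 : C) = 1.
Proof. by rewrite (e2pi_real 0) mulr0 cos0 sin0. Qed.

Lemma e2pi1 : e2pi (1 : C) = 1.
Proof. by rewrite (e2pi_real 1) mulr1 cos2pi sin2pi. Qed.

Lemma normc_cexp (z : C) : `|cexp z| = (expR (complex.Re z))%:C.
Proof.
rewrite /cexp normrM normc_def /= expr0n addr0 sqrtr_sqr gtr0_norm ?expR_gt0//.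
by rewrite normc_def /= cos2Dsin2 sqrtr1 mulr1.
Qed.

Lemma normc_e2pi (z : C) :
  `|e2pi z| = (expR (- ((pi *+ 2) * complex.Im z)))%:C.
Proof.
rewrite /e2pi normc_cexp; congr ((expR _)%:C).
by case: z => x y /=; ring.
Qed.

Lemma e2pi_neq0 (z : C) : e2pi z != 0.
Proof.
rewrite -normr_eq0 normc_e2pi; apply/eqP => -[] /eqP.
by rewrite gt_eqF ?expR_gt0.
Qed.

Lemma cos_eq1_pi (x : R) : 0 <= x -> x < pi *+ 2 -> cos x = 1 -> x = 0.
Proof.
move=> x0 x2 cx.
have pi0 := pi_gt0 R.
have [xpi|xpi] := leP x pi.
  by apply: (@cos_inj R); rewrite ?in_itv/= ?x0 ?xpi ?lexx ?(ltW pi0)// cos0.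
have : pi *+ 2 - x = 0.
  apply: (@cos_inj R); rewrite ?in_itv/= ?lexx ?(ltW pi0)//.
  - by apply/andP; split; lra.
  - by rewrite cosB cos2pi sin2pi mul0r addr0 mul1r cx cos0.
by lra.
Qed.

Lemma e2pi_inj (r s : R) : 0 <= r < 1 -> 0 <= s < 1 ->
  e2pi r%:C = e2pi s%:C -> r = s.
Proof.
wlog sr : r s / s <= r.
  move=> H hr hs e; case: (leP s r) => [|/ltW] h; first exact: H.
  by apply/esym/H.
move=> /andP[r0 r1] /andP[s0 s1] e.
have e1 : e2pi (r - s)%:C = 1 :> C.
  apply: (mulfI (e2pi_neq0 s%:C)); rewrite -e2piD mulr1 -e; congr e2pi.
  by rewrite -rmorphD /=; congr (_%:C); ring.
have pi0 := pi_gt0 R.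
move: e1; rewrite e2pi_real => -[c1 _].
have : (pi *+ 2) * (r - s) = 0.
  apply: cos_eq1_pi => //.
    by apply: mulr_ge0; lra.
  by rewrite -[ltRHS]mulr1 ltr_pM2l; lra.
by move/eqP; rewrite mulf_eq0 mulrn_eq0/= (gt_eqF pi0)/= subr_eq0 => /eqP.
Qed.

Lemma extend_val f t : extend f (val t) = f t.
Proof. by rewrite /extend valK. Qed.

Lemma holomorphicD f g : holomorphic f -> holomorphic g ->
  holomorphic (fun t => f t + g t).
Proof.
move=> hf hg t.
suff -> : extend (fun t => f t + g t) =
    ((extend f : C^o -> C^o) + (extend g : C^o -> C^o)) :> (C^o -> C^o).
  by apply: derivableD; [exact: hf|exact: hg].
apply/funext => z; rewrite /= /extend.
by rewrite [RHS]/GRing.add /=; case: insub => //; rewrite addr0.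
Qed.

Lemma holomorphicM f g : holomorphic f -> holomorphic g ->
  holomorphic (fun t => f t * g t).
Proof.
move=> hf hg t.
suff -> : extend (fun t => f t * g t) =
    ((extend f : C^o -> C^o) * (extend g : C^o -> C^o)) :> (C^o -> C^o).
  by apply: derivableM; [exact: hf|exact: hg].
apply/funext => z; rewrite /= /extend.
by rewrite [RHS]/GRing.mul /=; case: insub => //; rewrite mulr0.
Qed.

Lemma uhp_near t : \forall z \near (val t : C^o), (0 < complex.Im z)%R.
Proof.
apply/nbhs_normP; exists (complex.Im (val t))%:C => /=.
  by rewrite ltcR; exact: (valP t).
move=> z; rewrite /= -normrN opprB.
set y := complex.Im _ => h.
have : `|complex.Im (z - val t)|%:C < y%:C.
  apply: le_lt_trans h; rewrite normc_def lecR.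
  by rewrite -sqrtr_sqr ler_wsqrtr// lerDr sqr_ge0.
rewrite ltcR ltr_norml => /andP[+ _].
by rewrite /y /=; case: (sval t) => u v; case: z {h} => c d /=; lra.
Qed.

Lemma holomorphic_cst (c : C) : holomorphic (fun=> c).
Proof.
move=> t; apply: (@near_eq_derivable _ C^o C^o (cst c)).
- near=> z; rewrite /extend insubT//.
  by near: z; exact: uhp_near.
- exact: derivable_cst.
Unshelve. all: by end_near. Qed.

Lemma holomorphicZ (c : C) f : holomorphic f -> holomorphic (fun t => c * f t).
Proof. by move=> hf; exact (holomorphicM (@holomorphic_cst c) hf). Qed.

Lemma holomorphic_sum (I : Type) (s : seq I) (F : I -> uhp R -> C) :
  (forall i, holomorphic (F i)) -> holomorphic (fun t => \sum_(i <- s) F i t).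
Proof.
move=> hF; elim: s => [|i s IH].
  have -> : (fun t : uhp R => \sum_(i <- [::]) F i t) = (fun=> 0).
    by apply/funext => t; rewrite big_nil.
  exact (@holomorphic_cst 0).
have -> : (fun t => \sum_(j <- i :: s) F j t) =
          (fun t => F i t + \sum_(j <- s) F j t).
  by apply/funext => t; rewrite big_cons.
exact (holomorphicD (hF i) IH).
Qed.

Lemma has_qexp0 (m : R) : has_qexp m (fun=> 0) (fun=> 0).
Proof.
move=> t.
have -> : (fun n => 0 * e2pi ((m + n%:R)%:C * val t) : C^o) = (fun=> 0).
  by apply/funext => n; rewrite mul0r.
have -> : series (fun=> 0 : C^o) = (fun=> 0).
  by apply/funext => n; rewrite /series/= big1.
exact: cvg_cst.
Qed.

Lemma has_qexpD (m : R) f g a b : has_qexp m f a -> has_qexp m g b ->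
  has_qexp m (fun t => f t + g t) (fun n => a n + b n).
Proof.
move=> hf hg t.
have -> : (fun n => (a n + b n) * e2pi ((m + n%:R)%:C * val t) : C^o) =
  (fun n => a n * e2pi ((m + n%:R)%:C * val t) : C^o) +
  (fun n => b n * e2pi ((m + n%:R)%:C * val t) : C^o).
  by apply/funext => n; rewrite mulrDl.
by rewrite seriesD; apply: cvgD; [exact: hf|exact: hg].
Qed.

Lemma has_qexpZ (m : R) (c : C) f a : has_qexp m f a ->
  has_qexp m (fun t => c * f t) (fun n => c * a n).
Proof.
move=> hf t.
have -> : (fun n => (c * a n) * e2pi ((m + n%:R)%:C * val t) : C^o) =
  c *: (fun n => a n * e2pi ((m + n%:R)%:C * val t) : C^o).
  by apply/funext => n; rewrite -mulrA.
by rewrite seriesZ; apply: cvgZr; exact: hf.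
Qed.

Lemma has_qexp_sum (m : R) (I : Type) (s : seq I) (F : I -> uhp R -> C) :
  (forall i, exists a, has_qexp m (F i) a) ->
  exists a, has_qexp m (fun t => \sum_(i <- s) F i t) a.
Proof.
move=> hF; elim: s => [|i s [a ha]].
  exists (fun=> 0).
  have -> : (fun t : uhp R => \sum_(i <- [::]) F i t) = (fun=> 0).
    by apply/funext => t; rewrite big_nil.
  exact: has_qexp0.
have -> : (fun t => \sum_(j <- i :: s) F j t) =
          (fun t => F i t + \sum_(j <- s) F j t).
  by apply/funext => t; rewrite big_cons.
by have [b hb] := hF i; exists (fun n => b n + a n); exact (has_qexpD hb ha).
Qed.

Lemma has_qexp_cst (c : C) :
  has_qexp 0 (fun=> c) (fun n => if n is 0%N then c else 0).
Proof.
move=> t; rewrite -(@cvg_shiftS _).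
have -> : [sequence series (fun n : nat => (if n is 0%N then c else 0) *
    e2pi ((0 + n%:R)%:C * val t) : C^o) n.+1]_n = (fun=> c).
  apply/funext => n; rewrite /series /= big_nat_recl//= big1 => [|i _].
    have -> : (0 + 0%:R)%:C * val t = 0 :> C by rewrite addr0 mul0r.
    by rewrite addr0 e2pi0 mulr1.
  by rewrite mul0r.
exact: cvg_cst.
Qed.

End Closure.

Section CauchyProduct.
Variable R : realType.
Local Notation C := R[i].

Lemma natC n : n%:R = (n%:R)%:C :> C.
Proof. by rewrite rmorph_nat. Qed.

Lemma series_cauchy (u v : nat -> C) N :
  \sum_(0 <= n < N) \sum_(0 <= i < n.+1) u i * v (n - i)%N =
  \sum_(0 <= i < N) u i * \sum_(0 <= j < N - i) v j.
Proof.
elim: N => [|N IH]; first by rewrite !big_nil.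
rewrite big_nat_recr//= IH [RHS]big_nat_recr//= big_nat_recr//=.
rewrite addrA -big_split/= subSnn big_nat1 subnn; congr (_ + _).
rewrite big_nat_cond [RHS]big_nat_cond; apply: eq_bigr => i.
rewrite andbT => /andP[_ iN].
by rewrite subSn ?(ltnW iN)// big_nat_recr//= mulrDr.
Qed.

Lemma cauchy_bound (u v : nat -> C) (A s : R) N : 0 <= A -> 0 <= s ->
  (forall i, `|u i| <= (A * expR (- (s * i%:R)))%:C) ->
  (forall i, `|v i| <= (A * expR (- (s * i%:R)))%:C) ->
  `|(\sum_(0 <= i < N) u i) * (\sum_(0 <= j < N) v j) -
    \sum_(0 <= n < N) \sum_(0 <= i < n.+1) u i * v (n - i)%N| <=
  (A ^+ 2 * (N%:R ^+ 2 * expR (- (s * N%:R))))%:C.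
Proof.
move=> A0 s0 hu hv.
rewrite series_cauchy mulr_suml -sumrB.
set K := (A ^+ 2 * expR (- (s * N%:R))).
have K0 : 0 <= K by rewrite mulr_ge0 ?sqr_ge0 ?expR_ge0.
apply: (@le_trans _ _ (\sum_(0 <= i < N) (K * N%:R)%:C)); last first.
  rewrite sumr_const_nat subn0 -[leLHS]mulr_natr natC.
  rewrite -rmorphM /= lecR /K le_eqVlt; apply/orP; left; apply/eqP; ring.
apply: le_trans (ler_norm_sum _ _ _) _.
rewrite big_nat_cond [leRHS]big_nat_cond; apply: ler_sum => i.
rewrite andbT => /andP[_ iN].
rewrite -mulrBr (big_cat_nat (n := (N - i)%N)) ?leq_subr//= addrAC subrr add0r.
rewrite mulr_sumr; apply: le_trans (ler_norm_sum _ _ _) _.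
apply: (@le_trans _ _ (\sum_(N - i <= j < N) K%:C)); last first.
  rewrite sumr_const_nat -[leLHS]mulr_natr natC -rmorphM.
  rewrite lecR ler_wpM2l// ler_nat; apply: leq_trans (leq_subr _ _) _.
  exact: leqnn.
rewrite big_nat_cond [leRHS]big_nat_cond; apply: ler_sum => j.
rewrite andbT => /andP[jN _].
rewrite normrM; apply: le_trans (ler_pM _ _ (hu i) (hv j)) _ => //.
rewrite -rmorphM lecR /K.
have -> : A * expR (- (s * i%:R)) * (A * expR (- (s * j%:R))) =
   A ^+ 2 * expR (- (s * (i + j)%:R)).
  by rewrite natrD mulrDr opprD expRD; ring.
rewrite ler_wpM2l ?sqr_ge0// ler_expR lerN2 ler_wpM2l// ler_nat.
by rewrite -leq_subLR.
Qed.

Lemma sqr_expR_small (s : R) N : 0 < s ->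
  (N%:R ^+ 2 * expR (- (s * N%:R))) * N%:R <= 27%:R / s ^+ 3.
Proof.
move=> s0; set x := s * N%:R.
have x0 : 0 <= x by rewrite mulr_ge0 ?(ltW s0).
have h : (x / 3) ^+ 3 <= expR x.
  have -> : expR x = expR (x / 3) ^+ 3.
    by rewrite -expRM_natl; congr expR; field.
  rewrite lerXn2r ?nnegrE ?expR_ge0 ?divr_ge0//.
  by apply: le_trans (expR_ge1Dx _); rewrite lerDr.
rewrite expRN.
have -> : N%:R ^+ 2 * (expR x)^-1 * N%:R = (27 / s ^+ 3) * ((x / 3) ^+ 3 / expR x).
  rewrite /x; field.
  by rewrite !gt_eqF// expR_gt0.
rewrite ler_piMr ?divr_ge0 ?exprn_ge0 ?(ltW s0)//.
by rewrite ler_pdivrMr ?expR_gt0// mul1r.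
Qed.

Lemma cauchy_product (u v : nat -> C) (U W : C) (A s : R) : 0 <= A -> 0 < s ->
  (forall i, `|u i| <= (A * expR (- (s * i%:R)))%:C) ->
  (forall i, `|v i| <= (A * expR (- (s * i%:R)))%:C) ->
  series (u : nat -> C^o) @ \oo --> (U : C^o) ->
  series (v : nat -> C^o) @ \oo --> (W : C^o) ->
  series (fun n => \sum_(0 <= i < n.+1) u i * v (n - i)%N : C^o) @ \oo
    --> (U * W : C^o).
Proof.
move=> A0 s0 hu hv cu cv.
set w := (fun n => _ : C^o).
pose U' := series (u : nat -> C^o); pose V' := series (v : nat -> C^o).
pose d : nat -> C^o := fun N => U' N * V' N - series w N.
have cUV : U' * V' @ \oo --> (U * W : C^o) by exact: (cvgM cu cv).
suff d0 : d @ \oo --> (0 : C^o).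
  have E : U' * V' - d = series w.
    apply/funext => N; rewrite /d.
    pose x : C := U' N * V' N.
    suff : x - (x - series w N) = series w N by [].
    by rewrite opprB addrC subrK.
  by have := cvgB cUV d0; rewrite subr0 E; apply.
apply/cvgr0Pnorm_lt => e e0.
have /complex_realP[r er] : e \is Num.real by exact: gtr0_real.
move: e0; rewrite {e}er ltcR => r0.
set K := A ^+ 2 * (27%:R / s ^+ 3).
near=> N.
have N0 : (0 < N)%N by near: N; exact: nbhs_infty_gt.
apply: le_lt_trans (cauchy_bound N A0 (ltW s0) hu hv) _.
rewrite ltcR.
have NR : 0 < N%:R :> R by rewrite ltr0n.
rewrite -(ltr_pM2r NR) -mulrA.
apply: (@le_lt_trans _ _ K).
  by rewrite /K ler_wpM2l ?sqr_ge0// sqr_expR_small.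
rewrite -ltr_pdivrMl//.
by near: N; exact: nbhs_infty_gtr.
Unshelve. all: by end_near. Qed.

Lemma has_qexp_bound (m : R) (f : uhp R -> C) a (t : uhp R) : has_qexp m f a ->
  exists2 A : R, 0 <= A & forall n,
  `|a n * e2pi ((m + n%:R)%:C * val t)| <=
  (A * expR (- ((pi * complex.Im (val t)) * n%:R)))%:C.
Proof.
move=> hf; set x := complex.Re (val t); set y := complex.Im (val t).
have y0 : 0 < y := valP t.
have y'0 : 0 < complex.Im (x +i* (y / 2) : C) by rewrite /= divr_gt0.
pose t' : uhp R := exist _ (x +i* (y / 2)) y'0.
have /cvgP/cvg_series_cvg_0 c0 := hf t'.
have /cvg_seq_bounded/pinfty_ex_gt0[M M0 hM] : cvgn
  (fun n => a n * e2pi ((m + n%:R)%:C * val t') : C^o) by apply/cvgP: c0.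
have /complex_realP[r er] : M \is Num.real by exact: gtr0_real.
move: M0 hM; rewrite {M}er ltcR => r0 hM.
exists (r * expR (- (pi * y * m))); first by rewrite mulr_ge0 ?expR_ge0 ?ltW.
move=> n.
have h : `|a n * e2pi ((m + n%:R)%:C * val t')| <= r%:C by exact: (hM n I).
rewrite normrM normc_e2pi in h; rewrite normrM normc_e2pi.
have -> : r * expR (- (pi * y * m)) * expR (- (pi * y * n%:R)) =
    r * expR (- (pi * y * (m + n%:R))).
  by rewrite mulrDr opprD expRD mulrA.
set P : R := expR (- (pi *+ 2 * _)).
set Q : R := expR (- (pi *+ 2 * _)) in h.
have PQ : P = Q * expR (- (pi * y * (m + n%:R))).
  rewrite /P /Q -expRD; congr expR.
  have ImZ (c : R) (z : C) : complex.Im (c%:C * z) = c * complex.Im z.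
    by case: z => p q /=; ring.
  by rewrite !ImZ /= -/y; lra.
rewrite PQ !rmorphM /= mulrA ler_wpM2r//.
by rewrite lecR expR_ge0.
Qed.

Lemma has_qexpM (m : R) (f g : uhp R -> C) a b : has_qexp 0 f a -> has_qexp m g b ->
  has_qexp m (fun t => f t * g t)
    (fun n => \sum_(0 <= i < n.+1) a i * b (n - i)%N).
Proof.
move=> hf hg t.
have [A A0 hA] := has_qexp_bound t hf.
have [B B0 hB] := has_qexp_bound t hg.
pose u i := a i * e2pi ((0 + i%:R)%:C * val t).
pose v j := b j * e2pi ((m + j%:R)%:C * val t).
have -> : (fun n => (\sum_(0 <= i < n.+1) a i * b (n - i)%N) *
    e2pi ((m + n%:R)%:C * val t) : C^o) =
  (fun n => \sum_(0 <= i < n.+1) u i * v (n - i)%N).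
  apply/funext => n; rewrite mulr_suml big_nat_cond [RHS]big_nat_cond.
  apply: eq_bigr => i; rewrite andbT ltnS => /andP[_ iN].
  rewrite /u /v [RHS]mulrACA -e2piD -mulrDl -rmorphD /=.
  suff -> : 0 + i%:R + (m + (n - i)%:R) = m + n%:R :> R by reflexivity.
  by rewrite natrB//; ring.
apply: (@cauchy_product u v _ _ (A + B) (pi * complex.Im (val t))).
- exact: addr_ge0.
- by rewrite mulr_gt0 ?pi_gt0//; exact: (valP t).
- move=> i; apply: le_trans (hA i) _.
  by rewrite lecR ler_wpM2r ?expR_ge0// lerDl.
- move=> i; apply: le_trans (hB i) _.
  by rewrite lecR ler_wpM2r ?expR_ge0// lerDr.
- exact: hf.
- exact: hg.
Qed.
End CauchyProduct.

Section ModularForms.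
Variable R : realType.
Local Notation C := R[i].

Definition is_mform (k : int) n (X : gammaMod R n) (F : uhp R -> 'cV[C]_n) :=
  [/\ forall j, holomorphic (fun t => F t j 0),
      forall g t, aut_factor g t ^ (- k) *: F (SL2Z_act g t) = X g *m F t
    & forall j, exists a, has_qexp (gexp X j) (fun t => F t j 0) a].

Definition mform_pred k n (X : gammaMod R n) : {pred (uhp R -> 'cV[C]_n)} :=
  fun F => `[< is_mform k X F >].

(** [mform k X] is the space [H(k, X)]. *)
Record mform k n (X : gammaMod R n) := MForm {
  mfun :> uhp R -> 'cV[C]_n;
  _ : mfun \in mform_pred k X
}.

Lemma mformP k n (X : gammaMod R n) (F : mform k X) : is_mform k X F.
Proof. by case: F => F /= /asboolP. Qed.

Definition mkMForm k n (X : gammaMod R n) F (hF : is_mform k X F) : mform k X :=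
  MForm (introT (asboolP _) hF).

HB.instance Definition _ k n (X : gammaMod R n) := [isSub for @mfun k n X].
HB.instance Definition _ k n (X : gammaMod R n) :=
  [Choice of mform k X by <:].

Fact mform_submod_closed k n (X : gammaMod R n) :
  submod_closed (mform_pred k X).
Proof.
split.
  apply/asboolP; split=> [j|g t|j].
  - have -> : (fun t => (0 : uhp R -> 'cV[C]_n) t j 0) = (fun=> 0).
      by apply/funext => t; rewrite mxE.
    exact (@holomorphic_cst R 0).
  - by rewrite [LHS]scaler0 [RHS]mulmx0.
  - exists (fun=> 0).
    have -> : (fun t => (0 : uhp R -> 'cV[C]_n) t j 0) = (fun=> 0).
      by apply/funext => t; rewrite mxE.
    exact (@has_qexp0 R _).
move=> c F G /asboolP[Fh Fm Fq] /asboolP[Gh Gm Gq].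
have E j : (fun t => (c *: F + G) t j 0) = (fun t => c * F t j 0 + G t j 0).
  by apply/funext => t; rewrite !mxE.
apply/asboolP; split=> [j|g t|j].
- by rewrite E; exact (holomorphicD (@holomorphicZ R c _ (Fh j)) (Gh j)).
- have A s : (c *: F + G) s = c *: F s + G s by [].
  by rewrite !A scalerDr mulmxDr -Gm scalerA mulrC -scalerA Fm scalemxAr.
- have [a ha] := Fq j; have [b hb] := Gq j.
  exists (fun n => c * a n + b n).
  by rewrite E; exact (has_qexpD (@has_qexpZ R _ c _ _ ha) hb).
Qed.

HB.instance Definition _ k n (X : gammaMod R n) :=
  GRing.isSubmodClosed.Build C (uhp R -> 'cV[C]_n) (mform_pred k X)
    (mform_submod_closed k X).
HB.instance Definition _ k n (X : gammaMod R n) :=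
  [SubChoice_isSubLmodule of mform k X by <:].

Lemma mform_eq k n (X : gammaMod R n) (F G : mform k X) :
  (forall t, F t = G t) -> F = G.
Proof. by move=> h; apply/val_inj/funext. Qed.

Lemma mformDE k n (X : gammaMod R n) (F G : mform k X) t :
  (F + G) t = F t + G t.
Proof. by []. Qed.

Lemma mformZE k n (X : gammaMod R n) c (F : mform k X) t :
  (c *: F) t = c *: F t.
Proof. by []. Qed.

Fact trivMod_T_subproof :
  1%:M = diag_mx (\row_(j < 1) e2pi (0 : R)%:C) :> 'M[C]_1.
Proof. by apply/matrixP => i j; rewrite !mxE !ord1 (e2pi0 R). Qed.

Fact trivMod_bound_subproof (j : 'I_1) : 0 <= (0 : R) < 1.
Proof. by rewrite lexx ltr01. Qed.

Definition trivMod : gammaMod R 1 :=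
  @GammaMod R 1 (fun=> 1%:M) erefl (fun _ _ => esym (mulmx1 _)) (fun=> 0)
    trivMod_bound_subproof trivMod_T_subproof.

(** [modform k] is the component of weight [k] of the graded ring of holomorphic
    modular forms of level one, which is [C[E_4, E_6]]. *)
Definition modform k := mform k trivMod.

Fact mact_subproof k l m (klm : k + l = m) n (X : gammaMod R n)
  (f : modform k) (F : mform l X) :
  is_mform m X (fun t => f t 0 0 *: F t).
Proof.
have [fh fm fq] := mformP f; have [Fh Fm Fq] := mformP F.
have E j : (fun t => (f t 0 0 *: F t) j 0) = (fun t => f t 0 0 * F t j 0).
  by apply/funext => t; rewrite mxE.
split=> [j|g t|j].
- by rewrite E; exact (holomorphicM (fh 0) (Fh j)).
- have := congr1 (fun A : 'cV[C]_1 => A 0 0) (fm g t).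
  rewrite /= mul1mx mxE => <-.
  rewrite -scalemxAr -Fm !scalerA -klm opprD expfzDr ?aut_factor_neq0//.
  by congr (_ *: _); ring.
- have [a ha] := fq 0; have [b hb] := Fq j; rewrite E.
  by eexists; exact: (has_qexpM ha hb).
Qed.

Definition mact k l m (klm : k + l = m) n (X : gammaMod R n)
    (f : modform k) (F : mform l X) : mform m X :=
  mkMForm (mact_subproof klm f F).

Fact modform1_subproof : is_mform 0 trivMod (fun=> const_mx 1).
Proof.
have E j : (fun t : uhp R => (const_mx 1 : 'cV[C]_1) j 0) = (fun=> 1).
  by apply/funext => t; rewrite mxE.
split=> [j|g t|j].
- by rewrite E; exact (@holomorphic_cst R 1).
- by rewrite oppr0 expr0z scale1r mul1mx.
- by rewrite E; eexists; exact (@has_qexp_cst R 1).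
Qed.

Definition modform1 : modform 0 := mkMForm modform1_subproof.

(** A Z-graded module is given by its homogeneous components and by the action
    of homogeneous elements; the weight equations are arguments of the action,
    so that no transport along equalities between weights is needed. *)
Record gradedMod := GradedMod {
  gcomp :> int -> lmodType C;
  gact : forall k l m, k + l = m -> modform k -> gcomp l -> gcomp m;
  gactDl : forall k l m (e : k + l = m) f g x,
    gact e (f + g) x = gact e f x + gact e g x;
  gactDr : forall k l m (e : k + l = m) f x y,
    gact e f (x + y) = gact e f x + gact e f y;
  gactZl : forall k l m (e : k + l = m) c f x,
    gact e (c *: f) x = c *: gact e f x;
  gactZr : forall k l m (e : k + l = m) c f x,
    gact e f (c *: x) = c *: gact e f x;
  gact1 : forall l (e : 0 + l = l) x, gact e modform1 x = x;
  gactA : forall k l m kl lm n (e1 : k + l = kl) (e2 : kl + m = n)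
    (e3 : l + m = lm) (e4 : k + lm = n) f g x,
    gact e2 (mact e1 f g) x = gact e4 f (gact e3 g x)
}.

Record gradedMap (M N : gradedMod) := GradedMap {
  gmap :> forall k, {linear M k -> N k};
  gmap_act : forall k l m (e : k + l = m) (f : modform k) (x : M l),
    gmap m (gact e f x) = gact e f (gmap l x)
}.

Definition graded_injective (M N : gradedMod) (u : gradedMap M N) :=
  forall k, injective (u k).

Definition graded_surjective (M N : gradedMod) (u : gradedMap M N) :=
  forall k y, exists x, u k x = y.

Definition graded_exact (M N P : gradedMod)
    (u : gradedMap M N) (v : gradedMap N P) :=
  forall k y, v k y = 0 <-> exists x, u k x = y.

Definition graded_split_short_exact (M N P : gradedMod)
    (u : gradedMap M N) (v : gradedMap N P) :=
  [/\ graded_injective u, graded_exact u v, graded_surjective v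
    & exists s : gradedMap P N, forall k z, v k (s k z) = z].

(** One-dimensional over [C] and concentrated in weight [b]. Such a module is
    unique up to isomorphism, as the modular forms of weight zero are the
    constants. *)
Definition graded_line (Q : gradedMod) (b : int) :=
  (exists2 x : Q b, x != 0 & forall y : Q b, exists c : C, y = c *: x) /\
  forall k, k != b -> forall x : Q k, x = 0.

Section GradedForms.
Variables (n : nat) (X : gammaMod R n).

Fact HmodDl k l m (e : k + l = m) (f g : modform k) (F : mform l X) :
  mact e (f + g) F = mact e f F + mact e g F.
Proof.
apply: mform_eq => t; rewrite mformDE /= mxE.
exact: scalerDl.
Qed.

Fact HmodDr k l m (e : k + l = m) (f : modform k) (F G : mform l X) :
  mact e f (F + G) = mact e f F + mact e f G.
Proof. by apply: mform_eq => t; exact: scalerDr. Qed.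

Fact HmodZl k l m (e : k + l = m) c (f : modform k) (F : mform l X) :
  mact e (c *: f) F = c *: mact e f F.
Proof. by apply: mform_eq => t; rewrite mformZE /= mxE scalerA. Qed.

Fact HmodZr k l m (e : k + l = m) c (f : modform k) (F : mform l X) :
  mact e f (c *: F) = c *: mact e f F.
Proof. by apply: mform_eq => t; rewrite mformZE /= !scalerA mulrC. Qed.

Fact Hmod1 l (e : 0 + l = l) (F : mform l X) : mact e modform1 F = F.
Proof. by apply: mform_eq => t; rewrite /= mxE scale1r. Qed.

Fact HmodA k l m kl lm p (e1 : k + l = kl) (e2 : kl + m = p)
  (e3 : l + m = lm) (e4 : k + lm = p)
  (f : modform k) (g : modform l) (F : mform m X) :
  mact e2 (mact e1 f g) F = mact e4 f (mact e3 g F).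
Proof. by apply: mform_eq => t; rewrite /= mxE scalerA. Qed.

Definition Hmod : gradedMod :=
  @GradedMod (fun k => mform k X) (fun k l m e f F => mact e f F)
    HmodDl HmodDr HmodZl HmodZr Hmod1 HmodA.

End GradedForms.

Section Pushforward.
Variables (n p : nat) (X : gammaMod R n) (Y : gammaMod R p).
Variable alpha : gammaMap X Y.

Lemma gammaMap_gexp i j : alpha i j != 0 -> gexp X j = gexp Y i.
Proof.
move=> aij; have := hmxP alpha SL2Z_T; rewrite !gmxT.
move=> /matrixP/(_ i j); rewrite mul_mx_diag mul_diag_mx !mxE mulrC.
by move/(mulIf aij)/e2pi_inj; apply; exact: gexp_bound.
Qed.

Fact push_subproof k (F : mform k X) :
  is_mform k Y (fun t => alpha *m F t).
Proof.
have [Fh Fm Fq] := mformP F.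
have E i : (fun t => (alpha *m F t) i 0) =
    (fun t => \sum_j alpha i j * F t j 0).
  by apply/funext => t; rewrite mxE.
split=> [i|g t|i].
- by rewrite E; apply: holomorphic_sum => j; exact (@holomorphicZ R _ _ (Fh j)).
- by rewrite mulmxA -hmxP -mulmxA -Fm scalemxAr.
- rewrite E; apply: has_qexp_sum => j.
  have [a0|a0] := eqVneq (alpha i j) 0.
    exists (fun=> 0).
    have -> : (fun t => alpha i j * F t j 0) = (fun=> 0).
      by apply/funext => t; rewrite a0 mul0r.
    exact (@has_qexp0 R _).
  have [a ha] := Fq j; exists (fun n => alpha i j * a n).
  by rewrite -(gammaMap_gexp a0); exact (@has_qexpZ R _ _ _ _ ha).
Qed.

Definition push_fun k (F : Hmod X k) : Hmod Y k := mkMForm (push_subproof F).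

Fact push_linear k : linear (@push_fun k).
Proof.
move=> c F G; apply: mform_eq => t.
by rewrite mformDE mformZE /= mulmxDr -scalemxAr.
Qed.

HB.instance Definition _ k :=
  GRing.isLinear.Build C (Hmod X k) (Hmod Y k) _ (@push_fun k) (@push_linear k).

Fact push_act k l m (e : k + l = m) (f : modform k) (F : Hmod X l) :
  push_fun (gact e f F) = gact e f (push_fun F).
Proof. by apply: mform_eq => t; rewrite /= scalemxAr. Qed.

Definition push : gradedMap (Hmod X) (Hmod Y) :=
  @GradedMap (Hmod X) (Hmod Y) (fun k => @push_fun k : {linear _ -> _}) push_act.

End Pushforward.

Section CharMod.
Variables (chi : SL2Z -> C) (chiP : is_character chi).
Hypothesis chiT : chi SL2Z_T = e2pi (12%:R^-1).
Variable c : int.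

Definition charMod_gexp (j : 'I_1) : R := (c %% 12)%Z%:~R / 12%:R.

Fact charMod_1 : (chi 1%g ^ c)%:M = 1%:M :> 'M[C]_1.
Proof. by rewrite (character1 chiP) exp1rz. Qed.

Fact charMod_M g h :
  (chi (g * h)%g ^ c)%:M = (chi g ^ c)%:M *m (chi h ^ c)%:M :> 'M[C]_1.
Proof. by rewrite (characterM chiP) expfzMl scalar_mxM. Qed.

Fact charMod_bound j : 0 <= charMod_gexp j < 1.
Proof.
rewrite /charMod_gexp divr_ge0 ?ler0z ?modz_ge0//=.
by rewrite ltr_pdivrMr// mul1r (ltr_int R _ 12) ltz_pmod.
Qed.

Fact charMod_T :
  (chi SL2Z_T ^ c)%:M = diag_mx (\row_j e2pi (charMod_gexp j)%:C) :> 'M[C]_1.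
Proof.
have e2piXn (z : C) n : e2pi z ^+ n = e2pi (n%:R * z).
  elim: n => [|n IH]; first by rewrite mul0r e2pi0.
  by rewrite exprS IH -e2piD -[n.+1]addn1 natrD mulrDl mul1r addrC.
have u12 : e2pi (12%:R^-1) ^+ 12 = 1 :> C by rewrite e2piXn mulfV// e2pi1.
have u0 : e2pi (12%:R^-1) != 0 :> C by exact: e2pi_neq0.
apply/matrixP => i j; rewrite !mxE !ord1 eqxx !mulr1n chiT /charMod_gexp.
rewrite {1}(divz_eq c 12) expfzDr// [_ * 12]mulrC -exprz_exp.
have -> : e2pi (12%:R^-1) ^ 12 = 1 :> C by exact: u12.
rewrite exp1rz mul1r.
have : (0 <= c %% 12)%Z by rewrite modz_ge0.
case: (c %% 12)%Z => // n _; rewrite -exprnP e2piXn; congr e2pi.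
by rewrite -pmulrn rmorphM fmorphV !rmorph_nat.
Qed.

Definition charMod : gammaMod R 1 :=
  @GammaMod R 1 (fun g => (chi g ^ c)%:M) charMod_1 charMod_M charMod_gexp
    charMod_bound charMod_T.

End CharMod.

End ModularForms.

(* Main.v *)
(** A form [G] for [chi^b] lifts along [j] as soon as [psi * G] can be corrected to a
    legal first coordinate, where [psi] solves the cocycle equation of the off-diagonal
    entry of [V].  Such a [psi] is a multiple of an Eichler integral [phi], a primitive
    of [eta^4] if [a = b + 2] mod 12 and of [E4 * eta^-4] if [a = b - 2] mod 12: it
    satisfies [phi (-1/tau) = - phi tau + kappa], and [kappa <> 0], as otherwise
    [phi * eta^-4 * E4], respectively [phi * eta^4], would be a level one form of weight
    2 with nonzero constant term.  Comparing leading exponents, [psi * G] is holomorphic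
    at the cusp, so that [psi] itself splits the sequence, unless [a = b + 10].  In that
    case [psi * G] may have a pole.  If [G] has weight [k <> b], a multiple of [eta^-4]
    times the Serre derivative of [G] cancels it, because that derivative has leading
    coefficient proportional to [k - b].  If [k = b], a lift would give, after
    multiplication by [eta^(4-2b)], a level one form of weight 2 with nonzero constant
    term.

    No such form exists: its primitive, evaluated at the points fixed by [S] and by [ST],
    is seen to be [S]-invariant and to have no linear part.  The transformation law of
    [E2] comes from summing a conditionally convergent double series in both orders,
    that of [eta] by integration. *)
Require Import Defs.
From HB Require Import structures.
From mathcomp Require Import all_boot all_order all_algebra.
From mathcomp Require Import all_classical all_reals all_analysis.
From mathcomp Require Import complex ring lra zify.

Set Implicit Arguments.
Unset Strict Implicit.
Unset Printing Implicit Defensive.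
Import Order.TTheory GRing.Theory Num.Theory numFieldNormedType.Exports.
Import ComplexField.Normc.
Local Open Scope classical_set_scope.
Local Open Scope complex_scope.
Local Open Scope ring_scope.

(** The double series for E2 is compared with a telescoping one, made of differences of 1/(m tau +
    s) at half-integral s. The difference of the two is absolutely summable, so all dependence on
    the order of summation sits in the telescoping part, where the cotangent series computes it as 2
    pi i / (2 tau). The value of zeta(2) stays an unknown Z until eta is available: the fixed point
    of S T then forces e^(2 pi i Z/4) = i, and Z < 4 leaves only Z = 1.

    The factor E4 is there because eta^-4 has weight -2: eta^4 and E4 * eta^-4 both have weight 2
    and sign -1 under S, which is the ratio of chi^a and chi^b at S, and their exponents 1/6 and
    -1/6 match a - b = 2 and -2 in twelfths.

    In the exceptional case the leading coefficient at the cusp detects the cokernel. For C_b to be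
    a module on which f acts through its constant term, the constant terms of two forms of opposite
    nonzero weights must have product 0. This comes from the lifting itself: a form of weight other
    than b lifts, hence so do its multiples of weight b, whose leading coefficients therefore
    vanish. *)

Section ComplexLimits.
Variable R : realType.
Local Notation C := R[i].
Implicit Types (u v : nat -> C) (l z w : C).

(** * Limits and absolutely convergent series of complex numbers *)

Lemma norm_normc z : `|z| = (normc z)%:C.
Proof. by rewrite normc_def; case: z. Qed.

Lemma normc_ge0 z : 0 <= normc z.
Proof. by rewrite -ler0c -norm_normc. Qed.

Lemma normc_eq0 z : (normc z == 0) = (z == 0).
Proof.
apply/eqP/eqP => [/eq0_normc//|->]; exact: normc0.
Qed.

Lemma normc_gt0 z : (0 < normc z) = (z != 0).
Proof. by rewrite lt_neqAle normc_ge0 andbT eq_sym normc_eq0. Qed.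

Lemma normcR (x : R) : normc x%:C = `|x|.
Proof. by rewrite /= expr0n addr0 sqrtr_sqr. Qed.

Lemma normcX z n : normc (z ^+ n) = normc z ^+ n.
Proof.
by elim: n => [|n IH]; rewrite ?expr0 ?normc1// !exprS normcM IH.
Qed.

Lemma normc_sum (I : Type) (r : seq I) (P : pred I) (F : I -> C) :
  normc (\sum_(i <- r | P i) F i) <= \sum_(i <- r | P i) normc (F i).
Proof.
elim/big_rec2 : _ => [|i x y _ h]; first by rewrite normc0.
by apply: le_trans (le_normcD _ _) _; rewrite lerD2l.
Qed.

Lemma normcB z w : normc (z - w) = normc (w - z).
Proof. by rewrite -normcN opprB. Qed.

Lemma ler_normcB z w : normc z - normc w <= normc (z - w).
Proof. by rewrite lerBlDr -[in leLHS](subrK w z) le_normcD. Qed.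

Lemma normc_le_ReIm z : normc z <= `|complex.Re z| + `|complex.Im z|.
Proof.
have -> : z = (complex.Re z)%:C + (0 +i* complex.Im z).
  by case: z => a b; apply/eqP; rewrite eq_complex /= addr0 add0r !eqxx.
apply: le_trans (le_normcD _ _) _; rewrite normcR /=.
by rewrite !expr0n /= !add0r sqrtr_sqr; case: z => a b /=; rewrite !addr0.
Qed.

Lemma ge_Re_normc z : `|complex.Re z| <= normc z.
Proof.
by case: z => a b /=; rewrite -sqrtr_sqr ler_wsqrtr// lerDl sqr_ge0.
Qed.

Lemma ge_Im_normc z : `|complex.Im z| <= normc z.
Proof.
by case: z => a b /=; rewrite -sqrtr_sqr ler_wsqrtr// lerDr sqr_ge0.
Qed.

Lemma Re_sum (I : Type) (r : seq I) (P : pred I) (F : I -> C) :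
  complex.Re (\sum_(i <- r | P i) F i) = \sum_(i <- r | P i) complex.Re (F i).
Proof. by apply: big_morph => // -[a b] [c d]. Qed.

Lemma Im_sum (I : Type) (r : seq I) (P : pred I) (F : I -> C) :
  complex.Im (\sum_(i <- r | P i) F i) = \sum_(i <- r | P i) complex.Im (F i).
Proof. by apply: big_morph => // -[a b] [c d]. Qed.

(** The library norm on [C] takes values in [C]; limits are restated through the real number
    [normc], so that real estimates apply directly. *)
Definition clim u l := (fun n => normc (u n - l)) @ \oo --> (0 : R).

Lemma climP u l : clim u l <-> (u : nat -> C^o) @ \oo --> (l : C^o).
Proof.
split => [|] h.
  apply/(@cvgrPdist_lt _ C^o) => e e0.
  have /complex_realP[r er] : e \is Num.real by exact: gtr0_real.
  move: e0; rewrite {e}er ltcR => r0.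
  move/cvgrPdist_lt : h => /(_ r r0); apply: filterS => n.
  rewrite sub0r normrN ger0_norm ?normc_ge0// => h1.
  by rewrite -[X in is_true X]/(`|(l - u n : C)| < r%:C) norm_normc ltcR normcB.
apply/cvgrPdist_lt => e e0.
have e0' : 0 < e%:C by rewrite ltcR.
move/(@cvgrPdist_lt _ C^o) : h => /(_ _ e0'); apply: filterS => n.
rewrite -[X in is_true X -> _]/(`|(l - u n : C)| < e%:C) norm_normc ltcR normcB.
by rewrite sub0r normrN ger0_norm ?normc_ge0.
Qed.

Lemma clim_uniq u l l' : clim u l -> clim u l' -> l = l'.
Proof. by move=> /climP h /climP h'; exact: (cvg_unique _ h h'). Qed.

Lemma clim_cst l : clim (fun=> l) l.
Proof. by apply/climP; exact: cvg_cst. Qed.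

Lemma climD u v l l' : clim u l -> clim v l' -> clim (fun n => u n + v n) (l + l').
Proof. by move=> /climP h /climP h'; apply/climP; exact: (cvgD h h'). Qed.

Lemma climN u l : clim u l -> clim (fun n => - u n) (- l).
Proof. by move=> /climP h; apply/climP; exact: (cvgN h). Qed.

Lemma climB u v l l' : clim u l -> clim v l' -> clim (fun n => u n - v n) (l - l').
Proof. by move=> h h'; apply: climD => //; exact: climN. Qed.

Lemma climM u v l l' : clim u l -> clim v l' -> clim (fun n => u n * v n) (l * l').
Proof. by move=> /climP h /climP h'; apply/climP; exact: (cvgM h h'). Qed.

Lemma climMl c u l : clim u l -> clim (fun n => c * u n) (c * l).
Proof. by apply: climM; exact: clim_cst. Qed.

Lemma clim_eq u v l : (forall n, u n = v n) -> clim u l -> clim v l.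
Proof. by move=> /funext ->. Qed.

Lemma clim_near u v l : (exists N, forall n, (N <= n)%N -> u n = v n) ->
  clim u l -> clim v l.
Proof.
move=> [N hN] /climP h; apply/climP; apply: cvg_trans h.
by apply: near_eq_cvg; exists N => // n /= Nn; rewrite hN.
Qed.

Lemma climS u l : clim (fun n => u n.+1) l <-> clim u l.
Proof. by rewrite /clim -(@cvg_shiftS _ (fun n => normc (u n - l))). Qed.

Lemma clim_le u l (v : nat -> R) : (forall n, normc (u n - l) <= v n) ->
  v @ \oo --> (0 : R) -> clim u l.
Proof.
move=> h v0; apply: (squeeze_cvgr _ (cvg_cst 0) v0).
by apply: nearW => n; rewrite normc_ge0 h.
Qed.

Lemma clim_normc u l : clim u l -> (fun n => normc (u n)) @ \oo --> normc l.
Proof.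
move=> h; apply/cvgrPdist_lt => e e0.
move/cvgrPdist_lt : h => /(_ _ e0); apply: filterS => n.
rewrite sub0r normrN ger0_norm ?normc_ge0//; apply: le_lt_trans.
rewrite ler_norml; apply/andP; split; first by rewrite lerNl opprB ler_normcB.
by rewrite normcB ler_normcB.
Qed.

Lemma clim_normc_le u l (B : R) : (forall n, normc (u n) <= B) -> clim u l ->
  normc l <= B.
Proof.
move=> h /clim_normc hu; rewrite -(cvg_lim _ hu)//.
by apply: limr_le; [apply/cvgP: hu|apply: nearW].
Qed.

Lemma clim_ReIm u l : (fun n => complex.Re (u n)) @ \oo --> complex.Re l ->
  (fun n => complex.Im (u n)) @ \oo --> complex.Im l -> clim u l.
Proof.
move=> h1 h2; apply: (@clim_le _ _ (fun n =>
   `|complex.Re (u n) - complex.Re l| + `|complex.Im (u n) - complex.Im l|)).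
  move=> n; apply: le_trans (normc_le_ReIm _) _.
  by case: (u n) l {h1 h2} => a b [c d].
rewrite -(addr0 (0 : R)); apply: cvgD.
  by rewrite -(normr0 R) -(subrr (complex.Re l)); apply: cvg_norm; apply: cvgB => //; exact: cvg_cst.
by rewrite -(normr0 R) -(subrr (complex.Im l)); apply: cvg_norm; apply: cvgB => //; exact: cvg_cst.
Qed.

Definition csum u l := clim (fun n => \sum_(0 <= i < n) u i) l.

Lemma csumP u l : csum u l <-> series (u : nat -> C^o) @ \oo --> (l : C^o).
Proof. exact: climP. Qed.

Definition rsummable (v : nat -> R) := exists B, forall n, \sum_(0 <= i < n) v i <= B.

Lemma rsummable_cvg (v : nat -> R) : (forall n, 0 <= v n) -> rsummable v ->
  cvgn (series v).
Proof.
move=> v0 [B hB]; apply: nondecreasing_is_cvgn; first exact: nondecreasing_series.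
by exists B => _ [n _ <-]; exact: hB.
Qed.

Lemma rsummable_le (u v : nat -> R) : (forall n, u n <= v n) ->
  rsummable v -> rsummable u.
Proof.
move=> h [B hB]; exists B => n; apply: le_trans (hB n).
exact: ler_sum.
Qed.

Lemma rsummableZ (c : R) (v : nat -> R) : 0 <= c -> rsummable v ->
  rsummable (fun n => c * v n).
Proof.
move=> c0 [B hB]; exists (c * B) => n.
by rewrite -mulr_sumr ler_wpM2l.
Qed.

Lemma rsummable_tail (v : nat -> R) (e : R) : (forall n, 0 <= v n) ->
  rsummable v -> 0 < e ->
  exists N, forall m n, (N <= m)%N -> \sum_(m <= i < n) v i <= e.
Proof.
move=> v0 hv e0; have /cvg_ex[/= l hl] := rsummable_cvg v0 hv.
have ub n : series v n <= l.
  rewrite -(cvg_lim _ hl)//.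
  apply: nondecreasing_cvgn_le; last by apply/cvgP; exact: hl.
  exact: nondecreasing_series.
move/cvgrPdist_lt : hl => /(_ _ e0)[N _ hN]; exists N => m n Nm.
have [nm|/ltnW mn] := leqP n m; first by rewrite big_geq// ltW.
have := hN m Nm; rewrite ger0_norm ?subr_ge0// => /ltW h.
apply: le_trans h; rewrite lerBrDl.
by have := ub n; rewrite /series /= (big_cat_nat (n := m)).
Qed.

Lemma csum_abs u (v : nat -> R) : (forall n, normc (u n) <= v n) ->
  rsummable v -> exists l, csum u l.
Proof.
move=> h hv.
have hr (f : C -> R) : (forall z, `|f z| <= normc z) ->
    cvgn (series (fun n => f (u n))).
  move=> hf; apply: normed_cvg; apply: rsummable_cvg => [n|]; first exact: normr_ge0.
  by apply: rsummable_le hv => n; exact: le_trans (hf _) (h n).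
have /cvg_ex[/= a ha] := hr _ ge_Re_normc.
have /cvg_ex[/= b hb] := hr _ ge_Im_normc.
exists (a +i* b); apply: clim_ReIm => /=.
  apply: cvg_trans ha; apply: near_eq_cvg; apply: nearW => n.
  by rewrite /series /= Re_sum.
apply: cvg_trans hb; apply: near_eq_cvg; apply: nearW => n.
by rewrite /series /= Im_sum.
Qed.

Lemma csum_normc_le u l (v : nat -> R) B : (forall n, normc (u n) <= v n) ->
  (forall n, \sum_(0 <= i < n) v i <= B) -> csum u l -> normc l <= B.
Proof.
move=> h hB hu; apply: clim_normc_le hu => n.
apply: le_trans (normc_sum _ _ _) _; apply: le_trans (hB n).
exact: ler_sum.
Qed.

Lemma csum_uniq u l l' : csum u l -> csum u l' -> l = l'.
Proof. exact: clim_uniq. Qed.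

Lemma csum_eq u v l : (forall n, u n = v n) -> csum u l -> csum v l.
Proof. by move=> /funext ->. Qed.

Lemma csumD u v l l' : csum u l -> csum v l' -> csum (fun n => u n + v n) (l + l').
Proof.
move=> h h'; apply: clim_eq (climD h h') => n.
by rewrite big_split.
Qed.

Lemma csumMl c u l : csum u l -> csum (fun n => c * u n) (c * l).
Proof. by move=> h; apply: clim_eq (climMl c h) => n; rewrite mulr_sumr. Qed.

Lemma csumN u l : csum u l -> csum (fun n => - u n) (- l).
Proof. by move=> h; apply: clim_eq (climN h) => n; rewrite sumrN. Qed.

Lemma csumB u v l l' : csum u l -> csum v l' -> csum (fun n => u n - v n) (l - l').
Proof. by move=> h h'; apply: csumD h (csumN h'). Qed.

Lemma csumS u l : csum u l <-> csum (fun n => u n.+1) (l - u 0%N).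
Proof.
split=> h.
  apply: clim_eq (climB ((climS _ _).2 h) (clim_cst (u 0%N))) => n.
  by rewrite big_nat_recl//= addrAC subrr add0r.
apply/climS; rewrite -(subrK (u 0%N) l).
apply: clim_eq (climD h (clim_cst (u 0%N))) => n.
by rewrite [RHS]big_nat_recl//= addrC.
Qed.

Lemma csum_fin u N : (forall n, (N <= n)%N -> u n = 0) ->
  csum u (\sum_(0 <= i < N) u i).
Proof.
move=> h; apply: clim_near (clim_cst _); exists N => n Nn.
rewrite [RHS](big_cat_nat (n := N))//= [X in _ + X]big_nat_cond.
by rewrite [X in _ + X]big1 ?addr0// => i; rewrite andbT => /andP[/h].
Qed.

(** Dominated convergence for sums whose terms and length both vary with N: past a fixed K, the
    terms and their limits are dominated by a tail of [v], and the finitely many terms below K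
    converge. *)
Lemma tannery (f : nat -> nat -> C) (g : nat -> C) (v : nat -> R) (G : C) :
  (forall k, 0 <= v k) -> rsummable v ->
  (forall N k, (k < N)%N -> normc (f N k) <= v k) ->
  (forall k, clim (f^~ k) (g k)) -> csum g G ->
  clim (fun N => \sum_(0 <= k < N) f N k) G.
Proof.
move=> v0 hv hf hg hG.
(* The bound on [f N k] is given only for [k < N]; shifting the index past k transfers it to the
   limit. *)
have hgv k : normc (g k) <= v k.
  apply: (@clim_normc_le (fun n => f (n + k.+1)%N k)) => [n|].
    by apply: hf; rewrite addnS ltnS leq_addl.
  rewrite /clim (@cvg_shiftn k.+1 _ (fun n => normc (f n k - g k))).
  exact: hg.
suff h0 : clim (fun N => \sum_(0 <= k < N) (f N k - g k)) 0.
  have := climD h0 hG; rewrite add0r; apply: clim_eq => n.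
  by rewrite -big_split; apply: eq_bigr => i _; rewrite /= subrK.
apply/cvgrPdist_lt => e e0.
(* The head below K costs e/4 and the tail twice e/4, as [f N i] and [g i] are both bounded by
   [v i]. *)
have e4 : 0 < e / 4 by rewrite divr_gt0.
have [K hK] := rsummable_tail v0 hv e4.
have hfin : (fun N => \sum_(0 <= k < K) normc (f N k - g k)) @ \oo --> (0 : R).
  elim: K {hK} => [|K IH].
    rewrite (_ : (fun _ => _) = cst 0); first exact: cvg_cst.
    by apply/funext => n; rewrite big_nil.
  rewrite (_ : (fun _ => _) = (fun N => \sum_(0 <= k < K) normc (f N k - g k)
     + normc (f N K - g K))); last by apply/funext => n; rewrite big_nat_recr.
  rewrite -[X in _ --> X](addr0 0); apply: cvgD IH _; exact: hg.
move/cvgrPdist_lt : hfin => /(_ _ e4)[M _ hM].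
exists (maxn M K) => // N /=; rewrite geq_max => /andP[MN KN].
rewrite sub0r normrN ger0_norm ?normc_ge0// subr0.
apply: le_lt_trans (normc_sum _ _ _) _.
rewrite (big_cat_nat (n := K))//=.
have := hM N MN; rewrite sub0r normrN ger0_norm ?sumr_ge0//; last by move=> *; exact: normc_ge0.
move=> h1.
have h2 : \sum_(K <= i < N) normc (f N i - g i) <= 2 * \sum_(K <= i < N) v i.
  rewrite mulr_sumr big_nat_cond [leRHS]big_nat_cond; apply: ler_sum => i.
  rewrite andbT => /andP[_ iN]; apply: le_trans (le_normcD _ _) _.
  by rewrite normcN mulr_natl mulr2n lerD// hf.
have h3 := hK K N (leqnn _).
lra.
Qed.

(** Since the majorant is a product, row sums and column sums are again dominated by summable
    sequences, and both iterated series are limits of the same square partial sums. *)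
Lemma exchange_csum (r : nat -> nat -> C) (u v : nat -> R) (A B : nat -> C) :
  (forall m, 0 <= u m) -> (forall n, 0 <= v n) -> rsummable u -> rsummable v ->
  (forall m n, normc (r m n) <= u m * v n) ->
  (forall m, csum (r m) (A m)) -> (forall n, csum (r^~ n) (B n)) ->
  exists S, csum A S /\ csum B S.
Proof.
move=> u0 v0 hu hv hr hA hB.
have [V hV] := hv; have [U hU] := hu.
have hAu m : normc (A m) <= V * u m.
  apply: (csum_normc_le (hr m) _ (hA m)) => n.
  by rewrite -mulr_sumr mulrC ler_wpM2r.
have V0 : 0 <= V by apply: le_trans (hV 0%N); rewrite big_nil.
have U0 : 0 <= U by apply: le_trans (hU 0%N); rewrite big_nil.
have [S hS] := csum_abs hAu (rsummableZ V0 hu).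
exists S; split => //.
have hsq : clim (fun N => \sum_(0 <= m < N) \sum_(0 <= n < N) r m n) S.
  apply: (@tannery _ A (fun m => V * u m)) => //.
  - by move=> k; rewrite mulr_ge0.
  - exact: rsummableZ.
  - move=> N m _; apply: le_trans (normc_sum _ _ _) _.
    apply: le_trans (_ : \sum_(0 <= n < N) u m * v n <= _).
      exact: ler_sum.
    by rewrite -mulr_sumr mulrC ler_wpM2r.
have hBv n : normc (B n) <= U * v n.
  apply: (csum_normc_le (hr^~ n) _ (hB n)) => m.
  by rewrite -mulr_suml ler_wpM2r.
have [S' hS'] := csum_abs hBv (rsummableZ U0 hv).
have hsq' : clim (fun N => \sum_(0 <= n < N) \sum_(0 <= m < N) r m n) S'.
  apply: (@tannery _ B (fun n => U * v n)) => //.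
  - by move=> k; rewrite mulr_ge0.
  - exact: rsummableZ.
  - move=> N n _; apply: le_trans (normc_sum _ _ _) _.
    apply: le_trans (_ : \sum_(0 <= m < N) u m * v n <= _).
      exact: ler_sum.
    by rewrite -mulr_suml ler_wpM2r.
suff -> : S = S' by [].
apply: clim_uniq hsq _; apply: clim_eq hsq' => n.
by rewrite exchange_big.
Qed.

End ComplexLimits.

(** * Elementary bounds for the complex exponential *)

Section ComplexDerivative.
Variable R : realType.
Local Notation C := R[i].

Lemma expR_sub1_le (x : R) : `|expR x - 1| <= `|x| * expR `|x|.
Proof.
have h1 := expR_ge1Dx x; have h2 := expR_ge1Dx (- x).
have e1 : 1 <= expR `|x|.
  by apply: le_trans (expR_ge1Dx _); rewrite lerDl normr_ge0.
have [x0|x0] := leP 0 x; last first.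
  rewrite (ltr0_norm x0) in e1 *.
  rewrite ler0_norm; last by rewrite subr_le0 -expR0 ler_expR ltW.
  have : - x <= - x * expR (- x) by rewrite ler_peMr// oppr_ge0 ltW.
  lra.
rewrite !ger0_norm//; last by rewrite subr_ge0 -expR0 ler_expR.
have : (1 - x) * expR x <= expR (- x) * expR x by rewrite ler_wpM2r ?expR_ge0.
rewrite -expRD addNr expR0; lra.
Qed.

Lemma expR_sub1x_le (x : R) : `|expR x - 1 - x| <= x ^+ 2 * expR `|x|.
Proof.
have h1 := expR_ge1Dx x.
have h3 : expR x - 1 - x <= x * (expR x - 1).
  have := expR_ge1Dx (- x) => h2.
  have : (1 - x) * expR x <= expR (- x) * expR x by rewrite ler_wpM2r ?expR_ge0.
  rewrite -expRD addNr expR0; lra.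
rewrite ger0_norm; last by lra.
apply: le_trans h3 _; apply: le_trans (ler_norm _) _.
rewrite normrM -(real_normK (num_real x)) expr2 -mulrA.
by rewrite ler_wpM2l// expR_sub1_le.
Qed.

(** Bounding c by the maximum treats [x <= y] and [y <= x] at once, which spares the estimates below
    a distinction of signs. *)
Lemma is_derive_MVT (f df : R -> R) (x y : R) :
  (forall z : R, is_derive z 1 f (df z)) ->
  exists2 c, `|c| <= Num.max `|x| `|y| & f y - f x = df c * (y - x).
Proof.
move=> hf.
have cf a b : {within `[a, b], continuous f}.
  apply: continuous_subspaceT => z; apply: differentiable_continuous.
  by apply/derivable1_diffP; case: (hf z).
have [xy|/ltW yx] := leP x y.
  have [c] := MVT_segment xy (fun z _ => hf z) (cf _ _).
  rewrite in_itv /= => /andP[xc cy] ->; exists c => //.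
  rewrite ler_norml le_max; apply/andP; split.
    rewrite lerNl le_max -(normrN x); apply/orP; left.
    by apply: le_trans (ler_norm _); rewrite lerN2.
  by apply/orP; right; apply: le_trans cy (ler_norm _).
have [c] := MVT_segment yx (fun z _ => hf z) (cf _ _).
rewrite in_itv /= => /andP[yc cx] h; exists c; last by rewrite -opprB h; ring.
rewrite ler_norml le_max; apply/andP; split.
  rewrite lerNl le_max -(normrN y); apply/orP; right.
  by apply: le_trans (ler_norm _); rewrite lerN2.
by apply/orP; left; apply: le_trans cx (ler_norm _).
Qed.

Lemma sin_norm_le (x : R) : `|sin x| <= `|x|.
Proof.
have [c _ h] := @is_derive_MVT sin cos 0 x (fun z => is_derive_sin z).
move: h; rewrite sin0 !subr0 => ->.
by rewrite normrM ler_piMl// cos_max.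
Qed.

Lemma cos_sub1E (x : R) : cos x - 1 = - (sin (x / 2) ^+ 2 *+ 2).
Proof.
have {1}-> : x = (x / 2) *+ 2 by rewrite -mulr_natr divfK.
rewrite cos_mulr2n cos2sin2; ring.
Qed.

Lemma cos_sub1_le2 (x : R) : `|cos x - 1| <= x ^+ 2.
Proof.
rewrite cos_sub1E normrN normrMn normrX.
have h := sin_norm_le (x / 2).
have : `|sin (x / 2)| ^+ 2 <= (`|x / 2|) ^+ 2 by rewrite lerXn2r ?nnegrE.
rewrite !real_normK ?num_real// expr_div_n; have := sqr_ge0 x; lra.
Qed.

Lemma cos_sub1_le (x : R) : `|cos x - 1| <= `|x|.
Proof.
rewrite cos_sub1E normrN normrMn normrX.
have h := sin_norm_le (x / 2); have h1 := sin_max (x / 2).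
have : `|sin (x / 2)| ^+ 2 <= `|x / 2|.
  by rewrite expr2; apply: le_trans h; rewrite ler_piMl.
rewrite normrM (@ger0_norm _ (2^-1))//; lra.
Qed.

Lemma sin_sub_le (x : R) : `|sin x - x| <= x ^+ 2.
Proof.
have hd (z : R) : is_derive z 1 (fun x : R => sin x - x) (cos z - 1) by apply: is_deriveB.
have [c + h] := @is_derive_MVT (fun x => sin x - x) (fun x => cos x - 1) 0 x hd.
rewrite normr0 max_r// => hc.
move: h; rewrite /= sin0 !subr0 => ->.
rewrite normrM -(real_normK (num_real x)) expr2 ler_wpM2r//.
exact: le_trans (cos_sub1_le _) hc.
Qed.

(** The real and imaginary parts of the remainder split into four products of real remainders, each
    at most |w|^2 e^|w|. The derivatives of q-series and of exponentials, and the pole of [gcot],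
    rest on this bound. *)
Lemma cexp_quad (w : C) :
  normc (cexp w - 1 - w) <= 4 * normc w ^+ 2 * expR (normc w).
Proof.
apply: le_trans (normc_le_ReIm _) _.
have hx := ge_Re_normc w; have hy := ge_Im_normc w.
move: (normc w) hx hy => n hx hy.
case: w hx hy => x y; rewrite [complex.Re _]/= [complex.Im _]/= => hx hy.
have -> : complex.Re (cexp (x +i* y) - 1 - (x +i* y)) =
   expR x * (cos y - 1) + (expR x - 1 - x).
  by rewrite /cexp /=; ring.
have -> : complex.Im (cexp (x +i* y) - 1 - (x +i* y)) =
   expR x * (sin y - y) + y * (expR x - 1).
  by rewrite /cexp /=; ring.
have n0 : 0 <= n by apply: le_trans hx.
have E : expR x <= expR n by rewrite ler_expR; apply: le_trans (ler_norm _) hx.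
have E' : expR `|x| <= expR n by rewrite ler_expR.
have e0 := expR_ge0 x.
have x2 : x ^+ 2 <= n ^+ 2.
  by rewrite -(real_normK (num_real x)) lerXn2r ?nnegrE.
have y2 : y ^+ 2 <= n ^+ 2.
  by rewrite -(real_normK (num_real y)) lerXn2r ?nnegrE.
have h1 : `|expR x * (cos y - 1)| <= n ^+ 2 * expR n.
  rewrite normrM ger0_norm// mulrC ler_pM//.
  exact: le_trans (cos_sub1_le2 _) y2.
have h2 : `|expR x * (sin y - y)| <= n ^+ 2 * expR n.
  rewrite normrM ger0_norm// mulrC ler_pM//.
  exact: le_trans (sin_sub_le _) y2.
have h3 : `|expR x - 1 - x| <= n ^+ 2 * expR n.
  apply: le_trans (expR_sub1x_le _) _.
  by rewrite ler_pM ?sqr_ge0 ?expR_ge0.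
have h4 : `|y * (expR x - 1)| <= n ^+ 2 * expR n.
  rewrite normrM expr2 -mulrA ler_pM//.
  apply: le_trans (expR_sub1_le _) _.
  by rewrite ler_pM// expR_ge0.
apply: le_trans (lerD (ler_normD _ _) (ler_normD _ _)) _.
lra.
Qed.

End ComplexDerivative.

(** * Complex derivatives on the upper half-plane *)

Section HolomorphicDerivative.
Variable R : realType.
Local Notation C := R[i].
Implicit Types (f g : uhp R -> C) (t : uhp R).

Lemma is_derive_littleo (F : C -> C) (z l : C) :
  (forall e : R, 0 < e -> exists2 d : R, 0 < d &
   forall h, normc h < d -> normc (F (z + h) - F z - l * h) <= e * normc h) ->
  @is_derive C C^o C^o z 1 F l.
Proof.
move=> hF.
have cv : (fun h : C^o => h^-1 *: (F (h *: (1 : C^o) + z) - F z) : C^o) @ 0^' --> (l : C^o).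
  apply/(@cvgrPdist_le _ C^o) => e e0.
  have /complex_realP[r er] : e \is Num.real by exact: gtr0_real.
  move: e0; rewrite {e}er ltcR => r0.
  have [d d0 hd] := hF r r0.
  have h1 : \forall h \near (0 : C^o)^', `|h| < d%:C.
    by apply: dnbhs0_lt; rewrite ltcR.
  near=> h.
  have hn : normc h < d by rewrite -ltcR -norm_normc; near: h.
  have h0 : h != 0 by near: h; exact: nbhs_dnbhs_neq.
  rewrite -[X in is_true X]/(`|(l - h^-1 * (F (h * 1 + z) - F z) : C)| <= r%:C).
  rewrite norm_normc lecR mulr1 [h + z]addrC.
  have -> : l - h^-1 * (F (z + h) - F z) = - h^-1 * (F (z + h) - F z - l * h).
    by field.
  have hp : 0 < normc h by rewrite normc_gt0.
  by rewrite normcM normcN normcV ler_pdivrMl// [normc h * r]mulrC hd.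
apply: DeriveDef; first by apply/cvg_ex; exists l.
exact: cvg_lim cv.
Unshelve. all: by end_near. Qed.

Lemma is_derive_quad (F : C -> C) (z l : C) (K d : R) : 0 < d ->
  (forall h, normc h < d -> normc (F (z + h) - F z - l * h) <= K * normc h ^+ 2) ->
  @is_derive C C^o C^o z 1 F l.
Proof.
move=> d0 hF; apply: is_derive_littleo => e e0.
have K0 : 0 < `|K| + 1 by rewrite ltr_wpDl.
exists (Num.min d (e / (`|K| + 1))); first by rewrite lt_min d0 divr_gt0.
move=> h; rewrite lt_min => /andP[hd he].
apply: le_trans (hF h hd) _; rewrite expr2 mulrA ler_wpM2r ?normc_ge0//.
apply: (@le_trans _ _ ((`|K| + 1) * normc h)).
  by rewrite ler_wpM2r ?normc_ge0//; have := ler_norm K; lra.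
by rewrite mulrC -ler_pdivlMr// ltW.
Qed.

Lemma is_derive_lin (F : C -> C) (z l : C) :
  @is_derive C C^o C^o z 1 F l ->
  forall e : R, 0 < e -> exists2 d : R, 0 < d &
  forall h, normc h < d -> normc (F (z + h) - F z - l * h) <= e * normc h.
Proof.
move=> [/cvg_ex[/= l' hl'] dl] e e0.
have {}dl : l' = l by rewrite -dl; apply/esym; exact: cvg_lim hl'.
rewrite {}dl in hl'.
have e0' : 0 < e%:C by rewrite ltcR.
have /(@cvgrPdist_lt _ C^o)/(_ _ e0') := hl'.
move=> /nbhs_normP[r /= r0 hr].
have /complex_realP[d ed] : r \is Num.real by exact: gtr0_real.
move: r0 hr; rewrite {r}ed ltcR => d0 hd; exists d => // h hh.
have [->|h0] := eqVneq h 0.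
  by rewrite addr0 subrr mulr0 subr0 normc0 mulr0.
have := hd h; rewrite /ball_ /= => H.
have : `|(l - h^-1 * (F (h * 1 + z) - F z) : C)| < e%:C.
  apply: H => //.
  by rewrite -[X in is_true X]/(`|(0 - h : C)| < d%:C) sub0r normrN norm_normc ltcR.
rewrite norm_normc ltcR mulr1 [h + z]addrC => /ltW H'.
have -> : F (z + h) - F z - l * h = - h * (l - h^-1 * (F (z + h) - F z)).
  by field.
by rewrite normcM normcN mulrC ler_wpM2r// normc_ge0.
Qed.

(** Keeping the derivative as an explicit function lets two computations of it be compared by
    [hasD_uniq]; transformation laws are differentiated in this way. *)
Definition hasD f f' := forall t, @is_derive C C^o C^o (val t) 1 (extend f) (f' t).

Lemma hasD_holomorphic f f' : hasD f f' -> holomorphic f.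
Proof. by move=> h t; case: (h t). Qed.

Lemma hasD_uniq f f' f'' t : hasD f f' -> hasD f f'' -> f' t = f'' t.
Proof. by move=> h h'; have [_ <-] := h t; have [_ <-] := h' t. Qed.

Lemma hasD_eq f f' f'' : hasD f f' -> (forall t, f' t = f'' t) -> hasD f f''.
Proof. by move=> h e t; rewrite -e. Qed.

Lemma hasDD f g f' g' : hasD f f' -> hasD g g' ->
  hasD (fun t => f t + g t) (fun t => f' t + g' t).
Proof.
move=> hf hg t.
suff -> : extend (fun t => f t + g t) =
    ((extend f : C^o -> C^o) + (extend g : C^o -> C^o)) :> (C^o -> C^o).
  by apply: is_deriveD; [exact: hf|exact: hg].
apply/funext => z; rewrite /= /extend.
by rewrite [RHS]/GRing.add /=; case: insub => //; rewrite addr0.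
Qed.

Lemma hasDM f g f' g' : hasD f f' -> hasD g g' ->
  hasD (fun t => f t * g t) (fun t => f' t * g t + f t * g' t).
Proof.
move=> hf hg t.
suff -> : extend (fun t => f t * g t) =
    ((extend f : C^o -> C^o) * (extend g : C^o -> C^o)) :> (C^o -> C^o).
  have := @is_deriveM _ C^o (extend f) (extend g) (val t) 1 _ _ (hf t) (hg t).
  move=> h; apply: is_derive_eq.
  by rewrite !extend_val addrC mulrC.
apply/funext => z; rewrite /= /extend.
by rewrite [RHS]/GRing.mul /=; case: insub => //; rewrite mulr0.
Qed.

Lemma Im_normc (z h : C) : normc h < complex.Im z -> 0 < complex.Im (z + h).
Proof.
move=> hd; have h1 := ge_Im_normc h.
have : - complex.Im h <= `|complex.Im h| by rewrite -normrN ler_norm.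
have -> : complex.Im (z + h) = complex.Im z + complex.Im h by case: z h {hd h1} => [a b] [c d].
lra.
Qed.

Lemma uhp_shift t (h : C) : normc h < complex.Im (val t) ->
  exists t' : uhp R, val t' = val t + h.
Proof. by move=> /Im_normc hz; exists (exist (fun z : C => is_true (0 < complex.Im z)) _ hz). Qed.

Lemma hasD_quad f t (l : C) (K d : R) : 0 < d ->
  (forall h t', val t' = val t + h -> normc h < d ->
     normc (f t' - f t - l * h) <= K * normc h ^+ 2) ->
  @is_derive C C^o C^o (val t) 1 (extend f) l.
Proof.
move=> d0 hf; apply: (@is_derive_quad _ _ _ K (Num.min d (complex.Im (val t)))).
  by rewrite lt_min d0; exact: (valP t).
move=> h; rewrite lt_min => /andP[h1 /uhp_shift[t' et']].
by rewrite -et' !extend_val; apply: hf.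
Qed.

Lemma hasD_cst c : hasD (fun=> c) (fun=> 0).
Proof.
move=> t; apply: (@hasD_quad _ _ _ 0 1) => // h t' _ _.
by rewrite subrr mul0r subr0 normc0 mul0r.
Qed.

Lemma hasD_id : hasD (fun t => val t) (fun=> 1).
Proof.
move=> t; apply: (@hasD_quad _ _ _ 0 1) => // h t' e _.
have -> : val t' - val t - 1 * h = 0 by rewrite e; ring.
by rewrite normc0 mul0r.
Qed.

Lemma hasDZ c f f' : hasD f f' -> hasD (fun t => c * f t) (fun t => c * f' t).
Proof.
move=> h; apply: hasD_eq (hasDM (hasD_cst c) h) _ => t.
by rewrite mul0r add0r.
Qed.

Lemma hasDB f g f' g' : hasD f f' -> hasD g g' ->
  hasD (fun t => f t - g t) (fun t => f' t - g' t).
Proof.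
move=> hf hg; have := hasDD hf (hasDZ (-1) hg).
have E (u v : uhp R -> C) : (fun t => u t + -1 * v t) = (fun t => u t - v t).
  by apply/funext => t; rewrite mulN1r.
by rewrite !E.
Qed.

Lemma uhp_neq0 t : val t != 0.
Proof.
apply/eqP => h; have := valP t; rewrite /= h /=; by rewrite ltxx.
Qed.

Lemma hasD_inv : hasD (fun t => (val t)^-1) (fun t => - (val t)^-1 ^+ 2).
Proof.
move=> t; have t0 := uhp_neq0 t; set n := normc (val t).
have n0 : 0 < n by rewrite normc_gt0.
apply: (@hasD_quad _ _ _ (2 / n ^+ 3) (n / 2)) => [|h t' et hd]; first by rewrite divr_gt0.
have t'0 := uhp_neq0 t'; rewrite et in t'0 *.
have -> : (val t + h)^-1 - (val t)^-1 - - (val t)^-1 ^+ 2 * h =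
    h ^+ 2 * ((val t) ^- 2 * (val t + h)^-1) by field; rewrite t0 t'0.
rewrite !(normcM, normcV, normcX) -/n mulrC.
apply: ler_wpM2r; first by rewrite exprn_ge0 ?normc_ge0.
have hn : n / 2 <= normc (val t + h).
  have := ler_normcB (val t) (- h); rewrite opprK normcN -/n; lra.
have -> : 2 / n ^+ 3 = n ^- 2 * (n / 2)^-1 by field; rewrite gt_eqF.
apply: ler_wpM2l; first by rewrite invr_ge0 exprn_ge0// ltW.
have h2 : 0 < n / 2 by rewrite divr_gt0.
by rewrite lef_pV2 ?posrE// (lt_le_trans h2).
Qed.

Lemma ReB (z w : C) : complex.Re (z - w) = complex.Re z - complex.Re w.
Proof. by case: z w => [a b] [c d]. Qed.

Lemma uhp_convex (t1 t2 : uhp R) (s : R) : 0 <= s <= 1 ->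
  0 < complex.Im (val t1 + s%:C * (val t2 - val t1)).
Proof.
move=> /andP[s0 s1]; have := valP t1; have := valP t2 => /=.
case: (sval t1) (sval t2) => a b [c d] /= h2 h1.
have -> : b + (s * (d - b) + 0 * (c - a)) = (1 - s) * b + s * d by ring.
have [->|sn0] := eqVneq s 0; first by rewrite subr0 mul1r mul0r addr0.
apply: ltr_wpDl; first by rewrite mulr_ge0 ?subr_ge0// ltW.
by rewrite mulr_gt0// lt_neqAle eq_sym sn0.
Qed.

(** The real mean value theorem on the segment between the two points, which stays in the
    half-plane, is applied to the real part of [c * f]; c = 1 and c = -i recover [f]. *)
Lemma hasD0_cst f : hasD f (fun=> 0) -> forall t1 t2, f t1 = f t2.
Proof.
move=> hf t1 t2.
suff H c : complex.Re (c * f t1) = complex.Re (c * f t2).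
  have h1 := H 1; have h2 := H (- 'i).
  move: h1 h2; rewrite !mul1r; case: (f t1) (f t2) => [a b] [p q] /=.
  by move=> -> h; congr (_ +i* _); move: h; lra.
pose g (s : R) := complex.Re (c * extend f (val t1 + s%:C * (val t2 - val t1))).
have gd (s : R) : s \in `[0, 1] -> is_derive s 1 g 0.
  rewrite in_itv /= => s01.
  set w := val t2 - val t1; pose t : uhp R := exist (fun z : C => is_true (0 < complex.Im z)) _ (uhp_convex t1 t2 s01).
  have hd : (fun h : R => h^-1 *: (g (h *: (1 : R) + s) - g s) : R) @ 0^' --> (0 : R).
    apply/cvgrPdist_le => e e0.
    set M := normc c * normc w + 1.
    have M0 : 0 < M by rewrite ltr_wpDl// mulr_ge0 ?normc_ge0.
    have [d d0 hfd] := is_derive_lin (hf t) (divr_gt0 e0 M0).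
    have dM : 0 < d / (normc w + 1) by rewrite divr_gt0// ltr_wpDl ?normc_ge0.
    near=> h.
    have h0 : h != 0 by near: h; exact: nbhs_dnbhs_neq.
    have hh : `|h| < d / (normc w + 1) by near: h; exact: dnbhs0_lt.
    rewrite sub0r normrN.
    have hw : normc (h%:C * w) < d.
      rewrite normcM normcR.
      move: hh; rewrite ltr_pdivlMr; last by rewrite ltr_wpDl ?normc_ge0.
      apply: le_lt_trans; rewrite ler_wpM2l//; lra.
    have := hfd _ hw; rewrite /= mul0r subr0 => H1.
    have -> : h^-1 *: (g (h *: 1 + s) - g s) = h^-1 * (complex.Re (c * (
        extend f (val t1 + s%:C * w + h%:C * w) - extend f (val t1 + s%:C * w)))).
      congr (_ * _).
      have -> : g (h *: 1 + s) = complex.Re (c * extend f (val t1 + s%:C * w + h%:C * w)).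
        rewrite /g -/w; congr (complex.Re (c * extend f _)).
        rewrite -addrA -mulrDl -rmorphD; congr (_ + _%:C * _).
        by rewrite addrC; congr (_ + _); exact: mulr1.
      by rewrite /g -/w -ReB -mulrBr.
    rewrite normrM normfV ler_pdivrMl ?normr_gt0//.
    apply: le_trans (ge_Re_normc _) _; rewrite normcM.
    apply: le_trans (ler_wpM2l (normc_ge0 c) H1) _.
    rewrite normcM normcR.
    have -> : normc c * (e / M * (`|h| * normc w)) = `|h| * (e * (normc c * normc w / M)).
      ring.
    rewrite ler_wpM2l// ler_piMr ?ltW// ltr_pdivrMr// mul1r /M; lra.
  apply: DeriveDef; first by apply/cvg_ex; exists 0.
  exact: cvg_lim hd.
have cg : {within `[0, 1], continuous g}.
  apply: continuous_in_subspaceT => s; rewrite inE => hs.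
  apply: differentiable_continuous; apply/derivable1_diffP.
  by case: (gd s).
have [x _] := @MVT_segment R g (fun=> 0) 0 1 ler01
   (fun s hs => gd s (subset_itvW _ _ (lexx 0) (lexx 1) hs)) cg.
rewrite mul0r => /eqP; rewrite subr_eq0 /g.
rewrite !mul0r addr0 mul1r !extend_val addrC subrK extend_val => /eqP ->.
Unshelve. all: by end_near. Qed.

End HolomorphicDerivative.

(** * Convergence and differentiation of q-expansions *)

Section QExpansions.
Variable R : realType.
Local Notation C := R[i].
Implicit Types (f g : uhp R -> C) (t : uhp R) (a b : nat -> C).

Definition c2pi : C := (pi *+ 2)%:C * 'i.

Lemma e2piE (z : C) : e2pi z = cexp (c2pi * z).
Proof. by []. Qed.

Lemma normc_i : normc ('i : C) = 1.
Proof. by rewrite /= expr0n add0r expr1n sqrtr1. Qed.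

Lemma normc_c2pi : normc c2pi = pi *+ 2.
Proof.
by rewrite /c2pi normcM normcR normc_i mulr1 ger0_norm// mulrn_wge0// pi_ge0.
Qed.

Lemma normc_e2piE (z : C) : normc (e2pi z) = expR (- ((pi *+ 2) * complex.Im z)).
Proof. by apply: complexI; rewrite -norm_normc normc_e2pi. Qed.

Lemma ImZ (c : R) (z : C) : complex.Im (c%:C * z) = c * complex.Im z.
Proof. by case: z => p q /=; ring. Qed.

Lemma geo_bound (r : R) n : 0 <= r -> r < 1 -> \sum_(0 <= i < n) r ^+ i <= (1 - r)^-1.
Proof.
move=> r0 r1; have h : 0 < 1 - r by rewrite subr_gt0.
rewrite -(ler_pM2l h) mulfV ?gt_eqF// big_mkord.
rewrite -[1 - r]opprB mulNr -subrX1 opprB lerBlDr lerDl.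
exact: exprn_ge0.
Qed.

Lemma rsummable_expR (s : R) : 0 < s -> rsummable (fun n => expR (- (s * n%:R))).
Proof.
move=> s0; exists (1 - expR (- s))^-1 => n.
have E i : expR (- (s * i%:R)) = expR (- s) ^+ i.
  by rewrite -expRM_natl; congr expR; ring.
under eq_bigr => i _ do rewrite E.
apply: geo_bound; first exact: expR_ge0.
by rewrite -expR0 ltr_expR oppr_lt0.
Qed.

Lemma poly_expR (s : R) k : 0 < s -> exists2 K : R, 0 <= K &
  forall n, (1 + n%:R) ^+ k * expR (- (s * n%:R)) <= K * expR (- ((s / 2) * n%:R)).
Proof.
(* The k-th power of [expR (e * n)] then grows no faster than [expR (s / 2 * n)]; c is chosen to
   have 1 + n <= c * (1 + e * n). *)
move=> s0; pose e : R := s / (2 * k.+1%:R).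
have e0 : 0 < e by rewrite divr_gt0.
pose c := 1 + e^-1.
have c1 : 0 < c by rewrite addr_gt0// invr_gt0.
have ce : 1 <= c * e by rewrite /c mulrDl mulVf ?gt_eqF// mul1r lerDr ltW.
exists (c ^+ k) => [|n]; first by rewrite exprn_ge0// ltW.
have h1 : 1 + n%:R <= c * expR (e * n%:R).
  apply: le_trans (_ : c * (1 + e * n%:R) <= _); last first.
    by rewrite ler_wpM2l ?expR_ge1Dx// ltW.
  rewrite mulrDr mulr1 lerD//; first by rewrite /c lerDl invr_ge0 ltW.
  by rewrite mulrA ler_peMl.
have h2 : (1 + n%:R) ^+ k <= c ^+ k * expR ((s / 2) * n%:R).
  apply: le_trans (_ : (c * expR (e * n%:R)) ^+ k <= _).
    by rewrite lerXn2r// nnegrE ?addr_ge0// mulr_ge0 ?expR_ge0// ltW.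
  rewrite exprMn ler_wpM2l ?exprn_ge0 ?(ltW c1)//.
  rewrite -expRM_natl ler_expR mulrA ler_wpM2r//.
  rewrite /e; have -> : k%:R * (s / (2 * k.+1%:R)) = (s / 2) * (k%:R / k.+1%:R) :> R.
    have : k.+1%:R != 0 :> R by rewrite pnatr_eq0.
    by move: (k.+1%:R) => q q0; field.
  by rewrite ler_piMr ?divr_ge0 ?(ltW s0)// ler_pdivrMr// mul1r ler_nat.
apply: le_trans (ler_wpM2r (expR_ge0 _) h2) _.
rewrite -[_ * _ * expR (- (s * _))]mulrA -expRD.
apply: ler_wpM2l; first by rewrite exprn_ge0// ltW.
by rewrite ler_expR; lra.
Qed.

Lemma rsummable_poly_expR (s : R) k : 0 < s ->
  rsummable (fun n => (1 + n%:R) ^+ k * expR (- (s * n%:R))).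
Proof.
move=> s0; have [K K0 hK] := poly_expR k s0.
apply: rsummable_le hK _; apply: rsummableZ => //.
by apply: rsummable_expR; rewrite divr_gt0.
Qed.

Lemma has_qexpP (m : R) f a : has_qexp m f a <->
  forall t, csum (fun n => a n * e2pi ((m + n%:R)%:C * val t)) (f t).
Proof. by split=> h t; apply/csumP; exact: h. Qed.

Lemma has_qexp_normc (m : R) f a t : has_qexp m f a ->
  exists2 A : R, 0 <= A & forall n,
  normc (a n * e2pi ((m + n%:R)%:C * val t)) <=
  A * expR (- ((pi * complex.Im (val t)) * n%:R)).
Proof.
move=> /(has_qexp_bound t)[A A0 hA]; exists A => // n.
by rewrite -lecR -norm_normc; exact: hA.
Qed.

Lemma piIm_gt0 t : 0 < pi * complex.Im (val t).
Proof. by rewrite mulr_gt0 ?pi_gt0//; exact: (valP t). Qed.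

Definition qconv (m : R) a := forall t, exists l, csum (fun n => a n * e2pi ((m + n%:R)%:C * val t)) l.

Lemma qconv_has_qexp m a : qconv m a -> exists f, has_qexp m f a.
Proof. by move=> /choice[f hf]; exists f; apply/has_qexpP. Qed.

(** Convergence at every point of the half-plane forces exponential decay of the terms, which
    swallows a polynomial factor. The case k = 1 serves derivatives, the case k = 0 primitives. *)
Lemma qconv_poly m a b f (k : nat) (K : R) : has_qexp m f a ->
  (forall n, normc (b n) <= K * (1 + n%:R) ^+ k * normc (a n)) ->
  exists g, has_qexp m g b.
Proof.
move=> hf hb; apply: qconv_has_qexp => t.
have [A A0 hA] := has_qexp_normc t hf.
have [L L0 hL] := poly_expR k (piIm_gt0 t).
apply: (@csum_abs _ _ (fun n => `|K| * A * L * expR (- ((pi * complex.Im (val t)) / 2 * n%:R)))).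
  move=> n; rewrite normcM.
  have h1 : normc (b n) <= `|K| * ((1 + n%:R) ^+ k * normc (a n)).
    apply: le_trans (hb n) _; rewrite -mulrA ler_wpM2r ?ler_norm//.
    by rewrite mulr_ge0 ?normc_ge0// exprn_ge0// addr_ge0.
  apply: le_trans (ler_wpM2r (normc_ge0 _) h1) _.
  set y := normc (e2pi _); set E := expR _.
  have -> : `|K| * ((1 + n%:R) ^+ k * normc (a n)) * y =
     `|K| * ((1 + n%:R) ^+ k * (normc (a n) * y)) by ring.
  have -> : `|K| * A * L * E = `|K| * (A * (L * E)) by ring.
  rewrite ler_wpM2l// /y -normcM.
  apply: le_trans (ler_wpM2l _ (hA n)) _; first by rewrite exprn_ge0// addr_ge0.
  by rewrite mulrCA ler_wpM2l.
apply: rsummableZ; first by rewrite !mulr_ge0.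
by apply: rsummable_expR; rewrite divr_gt0// piIm_gt0.
Qed.

Lemma has_qexp_uniqf m f g a : has_qexp m f a -> has_qexp m g a -> f = g.
Proof.
move=> /has_qexpP hf /has_qexpP hg; apply/funext => t.
exact: csum_uniq (hf t) (hg t).
Qed.

(** By [cexp_quad] the remainder of the n-th term is quadratic in h, with a factor growing more
    slowly in n than the terms decay; the remainders can therefore be summed. *)
Lemma has_qexp_D m f a : has_qexp m f a ->
  exists2 g, has_qexp m g (fun n => (m + n%:R)%:C * a n) &
    hasD f (fun t => c2pi * g t).
Proof.
move=> hf; pose M := `|m| + 1.
have M0 : 0 < M by rewrite ltr_wpDl.
have hM n : `|m + n%:R| <= M * (1 + n%:R).
  apply: le_trans (ler_normD _ _) _; rewrite (@ger0_norm _ n%:R)//.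
  have : 0 <= `|m| * n%:R by rewrite mulr_ge0.
  rewrite /M; lra.
have [g hg] : exists g, has_qexp m g (fun n => (m + n%:R)%:C * a n).
  apply: (qconv_poly (k := 1) (K := M)) hf _ => n.
  by rewrite normcM normcR expr1 ler_wpM2r ?normc_ge0.
exists g => // t.
have [A A0 hA] := has_qexp_normc t hf.
set s := pi * complex.Im (val t) in hA.
have s0 : 0 < s := piIm_gt0 t.
(* For |h| < d the exponent 2 pi i (m + n) h is at most s / 2 * (1 + n) in norm, which uses up only
   half of the decay rate s of the terms. *)
pose d := s / (2 * (pi *+ 2 * M)).
have pM : 0 < pi *+ 2 * M by rewrite mulr_gt0// mulrn_wgt0// pi_gt0.
have d0 : 0 < d by rewrite divr_gt0// mulr_gt0.
have s20 : 0 < s / 2 by rewrite divr_gt0.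
have [B hB] := rsummable_poly_expR 2 s20.
pose K := A * (4 * (pi *+ 2 * M) ^+ 2 * expR (s / 2)).
have K0 : 0 <= K.
  by rewrite mulr_ge0// mulr_ge0 ?expR_ge0// mulr_ge0// exprn_ge0// ltW.
apply: (@hasD_quad _ _ _ _ (K * B) d) => // h t' et hd.
pose u n := a n * e2pi ((m + n%:R)%:C * val t') - a n * e2pi ((m + n%:R)%:C * val t)
   - (c2pi * h) * ((m + n%:R)%:C * a n * e2pi ((m + n%:R)%:C * val t)).
have hu : csum u (f t' - f t - c2pi * g t * h).
  rewrite -mulrA [g t * h]mulrC mulrA.
  have h1 := (has_qexpP _ _ _).1 hf t'; have h2 := (has_qexpP _ _ _).1 hf t.
  have h3 := csumMl (c2pi * h) ((has_qexpP _ _ _).1 hg t).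
  exact: (csumB (csumB h1 h2) h3).
have hbd n : normc (u n) <= K * normc h ^+ 2 * ((1 + n%:R) ^+ 2 * expR (- (s / 2 * n%:R))).
  set mu := m + n%:R.
  have -> : u n = (a n * e2pi (mu%:C * val t)) *
     (cexp (c2pi * (mu%:C * h)) - 1 - c2pi * (mu%:C * h)).
    rewrite /u et mulrDr e2piD -/mu (e2piE (mu%:C * h)); ring.
  rewrite normcM.
  have nw : normc (c2pi * (mu%:C * h)) <= (pi *+ 2 * M) * (1 + n%:R) * normc h.
    rewrite normcM normc_c2pi [normc (mu%:C * h)]normcM normcR mulrA ler_wpM2r ?normc_ge0//.
    rewrite -[pi *+ 2 * M * _]mulrA; apply: ler_wpM2l; last exact: hM.
    by rewrite mulrn_wge0// pi_ge0.
  have nw2 : normc (c2pi * (mu%:C * h)) <= s / 2 * (1 + n%:R).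
    apply: le_trans nw _; rewrite mulrAC ler_wpM2r ?addr_ge0//.
    apply: le_trans (ler_wpM2l (ltW pM) (ltW hd)) _.
    have E (q : R) : 0 < q -> q * (s / (2 * q)) = s / 2.
      by move=> q0; field; rewrite gt_eqF.
    by rewrite /d E.
  have h1 := cexp_quad (c2pi * (mu%:C * h)).
  have h2 : 4 * normc (c2pi * (mu%:C * h)) ^+ 2 * expR (normc (c2pi * (mu%:C * h)))
    <= 4 * ((pi *+ 2 * M) * (1 + n%:R) * normc h) ^+ 2 * expR (s / 2 * (1 + n%:R)).
    rewrite ler_pM ?expR_ge0 ?mulr_ge0 ?exprn_ge0 ?normc_ge0 ?ler_expR//.
    by rewrite ler_wpM2l// lerXn2r ?nnegrE ?normc_ge0// (le_trans (normc_ge0 _) nw).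
  apply: le_trans (ler_pM (normc_ge0 _) (normc_ge0 _) (hA n) (le_trans h1 h2)) _.
  rewrite le_eqVlt; apply/orP; left; apply/eqP.
  have -> : expR (s / 2 * (1 + n%:R)) = expR (s / 2) * expR (s / 2 * n%:R).
    by rewrite -expRD; congr expR; ring.
  have -> : expR (- (s * n%:R)) = expR (- (s / 2 * n%:R)) * expR (- (s / 2 * n%:R)).
    by rewrite -expRD; congr expR; lra.
  have E : expR (- (s / 2 * n%:R)) * expR (s / 2 * n%:R) = 1 by rewrite -expRD addNr expR0.
  rewrite /K; set e1 := expR (- _) in E *; set e2 := expR (s / 2 * _) in E *.
  transitivity (A * e1 * (e1 * e2) * (4 * (pi *+ 2 * M * (1 + n%:R) * normc h) ^+ 2 * expR (s / 2))); first by ring.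
  by rewrite E; ring.
have -> : K * B * normc h ^+ 2 = K * normc h ^+ 2 * B by ring.
apply: (csum_normc_le hbd _ hu) => n.
by rewrite -mulr_sumr ler_wpM2l// mulr_ge0// exprn_ge0// normc_ge0.
Qed.

Lemma has_qexp_holo m f a : has_qexp m f a -> holomorphic f.
Proof. by move=> /has_qexp_D[g _]; exact: hasD_holomorphic. Qed.

End QExpansions.

(** * Generation of the modular group by S and T *)

Fact SL2Z_S_subproof :
  \det (\matrix_(i < 2, j < 2) (if i == j then 0 else if (i < j)%N then -1 else 1) : 'M[int]_2) == 1.
Proof.
rewrite (expand_det_row _ ord0) !big_ord_recl big_ord0 /cofactor.
by rewrite !det_mx11 !mxE.
Qed.

Definition SL2Z_S : SL2Z := exist (fun g : 'M[int]_2 => \det g == 1) _ SL2Z_S_subproof.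

Lemma SL2Z_mulE (g h : SL2Z) (i j : 'I_2) :
  val (g * h)%g i j = val g i 0 * val h 0 j + val g i 1 * val h 1 j.
Proof.
rewrite mxE !big_ord_recl big_ord0 addr0.
by have -> : lift ord0 ord0 = 1 :> 'I_2 by apply/val_inj.
Qed.

Lemma SL2Z_eqP (g h : SL2Z) : val g 0 0 = val h 0 0 -> val g 0 1 = val h 0 1 ->
  val g 1 0 = val h 1 0 -> val g 1 1 = val h 1 1 -> g = h.
Proof.
have o (i : 'I_2) : i = 0 \/ i = 1.
  by case: i => -[|[|//]] hi; [left|right]; apply/val_inj.
move=> h1 h2 h3 h4; apply/val_inj/matrixP => i j.
by case: (o i) => ->; case: (o j) => ->.
Qed.

Lemma SL2Z_SE : [/\ val SL2Z_S 0 0 = 0, val SL2Z_S 0 1 = -1, val SL2Z_S 1 0 = 1 & val SL2Z_S 1 1 = 0].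
Proof. by split; rewrite mxE. Qed.

Lemma SL2Z_TE : [/\ val SL2Z_T 0 0 = 1, val SL2Z_T 0 1 = 1, val SL2Z_T 1 0 = 0 & val SL2Z_T 1 1 = 1].
Proof. by split; rewrite mxE. Qed.

Section Generation.
Variable P : SL2Z -> Prop.
Hypotheses (PS : P SL2Z_S) (PT : P SL2Z_T).
Hypothesis PM : forall g h, P g -> P h -> P (g * h)%g.
Hypothesis PV : forall g, P g -> P g^-1%g.

Lemma SL2Z_Tn (n : int) : exists2 h, P h &
  [/\ val h 0 0 = 1, val h 0 1 = n, val h 1 0 = 0 & val h 1 1 = 1].
Proof.
have key (h : SL2Z) (k : int) : [/\ val h 0 0 = 1, val h 0 1 = k, val h 1 0 = 0 & val h 1 1 = 1] ->
   [/\ val h^-1%g 0 0 = 1, val h^-1%g 0 1 = - k, val h^-1%g 1 0 = 0 & val h^-1%g 1 1 = 1].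
  move=> [h1 h2 h3 h4].
  have := SL2Z_mulE h h^-1%g; rewrite mulgV => E.
  have E00 : val (1%g : SL2Z) 0 0 = 1 by rewrite mxE.
  have E01 : val (1%g : SL2Z) 0 1 = 0 by rewrite mxE.
  have E10 : val (1%g : SL2Z) 1 0 = 0 by rewrite mxE.
  have E11 : val (1%g : SL2Z) 1 1 = 1 by rewrite mxE.
  move: (E 0 0) (E 0 1) (E 1 0) (E 1 1); rewrite E00 E01 E10 E11 h1 h2 h3 h4.
  set x := val h^-1%g 0 0; set y := val h^-1%g 0 1.
  set z := val h^-1%g 1 0; set t := val h^-1%g 1 1.
  rewrite !mul1r !mul0r !add0r => e1 e2 e3 e4.
  by move: e1 e2; rewrite -e3 -e4 !mulr0 !mulr1 addr0; split; lia.
have pos (k : nat) : exists2 h, P h &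
  [/\ val h 0 0 = 1, val h 0 1 = k, val h 1 0 = 0 & val h 1 1 = 1].
  elim: k => [|k [h Ph [h1 h2 h3 h4]]].
    exists (SL2Z_T * SL2Z_T^-1)%g; first by apply: PM => //; exact: PV.
    by rewrite mulgV; split; rewrite !mxE.
  exists (SL2Z_T * h)%g; first exact: PM.
  by split; rewrite SL2Z_mulE ?h1 ?h2 ?h3 ?h4 !mxE /= ?intS; ring.
case: n => n; first exact: pos.
have [h Ph hE] := pos n.+1; exists h^-1%g; first exact: PV.
exact: (key h n.+1 hE).
Qed.

Lemma SL2Z_ind g : P g.
Proof.
have [m] := ubnP (absz (val g 1 0)); elim: m g => // m IH g hg.
have [c0|c0] := eqVneq (val g 1 0) 0.
  have dg := SL2Z_det g; rewrite c0 mulr0 subr0 in dg.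
  have [h Ph [h1 h2 h3 h4]] := SL2Z_Tn (val g 0 1).
  (* For diagonal -1: multiplying by S^2 negates the entries, hence the opposite upper right entry
     here. *)
  have [h' Ph' [h1' h2' h3' h4']] := SL2Z_Tn (- val g 0 1).
  have PSS : P (SL2Z_S * SL2Z_S)%g by exact: PM.
  have [[a1 d1]|[a1 d1]] : (val g 0 0 = 1 /\ val g 1 1 = 1) \/ (val g 0 0 = -1 /\ val g 1 1 = -1).
    move: dg; set x := val g 0 0; set y := val g 1 1 => dg.
    have : absz (x * y) = 1%N by rewrite dg.
    rewrite abszM => /eqP; rewrite muln_eq1 => /andP[/eqP hx _].
    have [e|e] : x = 1 \/ x = -1 by lia.
      by left; move: dg; rewrite e; lia.
    by right; move: dg; rewrite e; lia.
    suff -> : g = h by [].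
    by apply: SL2Z_eqP; rewrite ?h1 ?h2 ?h3 ?h4.
  suff -> : g = ((SL2Z_S * SL2Z_S) * h')%g by exact: PM.
  by apply: SL2Z_eqP; rewrite !SL2Z_mulE ?h1' ?h2' ?h3' ?h4' !mxE /= ?a1 ?d1 ?c0; lia.
have [h Ph [h1 h2 h3 h4]] := SL2Z_Tn (- divz (val g 1 1) (val g 1 0)).
suff Pk : P (g * h * SL2Z_S)%g.
  have -> : g = ((g * h * SL2Z_S) * SL2Z_S^-1 * h^-1)%g by rewrite !mulgK.
  by apply: PM (PV Ph); apply: PM (PV PS).
rewrite ltnS in hg; apply: IH; apply: leq_trans hg.
have -> : val (g * h * SL2Z_S)%g 1 0 =
   val g 1 1 - val g 1 0 * divz (val g 1 1) (val g 1 0).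
  rewrite !SL2Z_mulE h1 h2 h3 h4.
  have [-> _ -> _] := SL2Z_SE; ring.
have := divz_eq (val g 1 1) (val g 1 0); have := modz_ge0 (val g 1 1) c0.
have := ltz_mod (val g 1 1) c0.
set x := val g 1 1; set y := val g 1 0; set q := divz _ _; set r := modz _ _.
lia.
Qed.

End Generation.

(** * S and T acting on points, functions and expansions *)

Section ActionST.
Variable R : realType.
Local Notation C := R[i].
Implicit Types (f g : uhp R -> C) (t : uhp R) (a b : nat -> C) (m : R).

Local Notation S := (@SL2Z_act R SL2Z_S).
Local Notation T := (@SL2Z_act R SL2Z_T).

Lemma aut_factorS t : aut_factor SL2Z_S t = val t.
Proof. by rewrite /aut_factor; have [_ _ -> ->] := SL2Z_SE; rewrite mul1r addr0. Qed.

Lemma aut_factorT t : aut_factor SL2Z_T t = 1.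
Proof. by rewrite /aut_factor; have [_ _ -> ->] := SL2Z_TE; rewrite mul0r add0r. Qed.

Lemma val_actS t : val (S t) = - (val t)^-1.
Proof.
rewrite [LHS]/= /moebius aut_factorS; have [-> -> _ _] := SL2Z_SE.
by rewrite mul0r add0r mulN1r.
Qed.

Lemma val_actT t : val (T t) = val t + 1.
Proof.
rewrite [LHS]/= /moebius aut_factorT; have [-> -> _ _] := SL2Z_TE.
by rewrite mul1r divr1.
Qed.

Lemma actSK t : S (S t) = t.
Proof. by apply/val_inj; rewrite !val_actS invrN opprK invrK. Qed.

Lemma aut_factorM (g h : SL2Z) t :
  aut_factor (g * h)%g t = aut_factor g (SL2Z_act h t) * aut_factor h t.
Proof.
have h0 := aut_factor_neq0 h t.
have E (c A : C) : c * (A / aut_factor h t) * aut_factor h t = c * A.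
  by rewrite -mulrA divfK.
rewrite [aut_factor g _]/aut_factor [val (SL2Z_act _ _)]/= /moebius mulrDl E.
rewrite /aut_factor !SL2Z_mulE !rmorphD !rmorphM /=; ring.
Qed.

Lemma SL2Z_actM (g h : SL2Z) t :
  SL2Z_act (g * h)%g t = SL2Z_act g (SL2Z_act h t).
Proof.
apply/val_inj; rewrite /= /moebius aut_factorM.
have h0 := aut_factor_neq0 h t.
have h1 := aut_factor_neq0 g (SL2Z_act h t).
apply: (canLR (mulfK _)); first by rewrite mulf_neq0.
rewrite mulrA mulfVK// mulrDl /= /moebius mulrA mulfVK//.
rewrite !SL2Z_mulE !rmorphD !rmorphM /aut_factor /=; ring.
Qed.

Lemma SL2Z_act1 t : SL2Z_act 1%g t = t.
Proof. by rewrite -[RHS]actSK -(actSK (SL2Z_act _ _)) -!SL2Z_actM mulg1. Qed.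

(** Modularity needs to be tested only on the generators [S] and [T]. *)
Lemma modular_ST (n : nat) (X : gammaMod R n) (k : int) (F : uhp R -> 'cV[C]_n) :
  (forall t, F (S t) = (val t) ^ k *: (X SL2Z_S *m F t)) ->
  (forall t, F (T t) = X SL2Z_T *m F t) ->
  forall (g : SL2Z) t, aut_factor g t ^ (- k) *: F (SL2Z_act g t) = X g *m F t.
Proof.
move=> hS hT g.
suff H t : F (SL2Z_act g t) = aut_factor g t ^ k *: (X g *m F t).
  move=> t; rewrite H scalerA -expfzDr ?aut_factor_neq0// addNr expr0z.
  by rewrite scale1r.
elim/SL2Z_ind : g t => [t|t|g h hg hh t|g hg t].
- by rewrite aut_factorS.
- by rewrite aut_factorT exp1rz scale1r.
- rewrite SL2Z_actM hg hh -scalemxAr scalerA gmxM mulmxA aut_factorM.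
  by rewrite expfzMl.
- have := hg (SL2Z_act g^-1%g t); rewrite -SL2Z_actM mulgV SL2Z_act1 => ->.
  have e : aut_factor g^-1%g t * aut_factor g (SL2Z_act g^-1%g t) = 1.
    by rewrite mulrC -aut_factorM mulgV /aut_factor !mxE /= mul0r add0r.
  rewrite -scalemxAr mulmxA -gmxM mulVg gmx1 mul1mx scalerA -expfzMl e.
  by rewrite exp1rz scale1r.
Qed.

Lemma hasD_actS f f' : hasD f f' ->
  hasD (fun t => f (S t)) (fun t => f' (S t) / (val t) ^+ 2).
Proof.
move=> hf t; have t0 := uhp_neq0 t.
set z := val t in t0 *; set l := f' (S t).
apply: is_derive_littleo => e e0.
pose n := normc z; have n0 : 0 < n by rewrite normc_gt0.
have e'0 : 0 < e * n ^+ 2 / 4 by rewrite divr_gt0// mulr_gt0// exprn_gt0.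
have [d d0 hd] := is_derive_lin (hf (S t)) e'0.
have L0 : 0 < normc l + 1 by rewrite ltr_wpDl ?normc_ge0.
exists (Num.min (Num.min (complex.Im z) (n / 2))
  (Num.min (d * n ^+ 2 / 2) (e * n ^+ 3 / (4 * (normc l + 1))))).
  by rewrite !lt_min !divr_gt0 ?mulr_gt0 ?exprn_gt0//; rewrite !andbT; exact: (valP t).
move=> h; rewrite !lt_min => /andP[/andP[h1 h2] /andP[h3 h4]].
have [t' et'] := uhp_shift h1; rewrite -et' !extend_val.
have t'0 := uhp_neq0 t'.
have hn : n / 2 <= normc (val t').
  by have := ler_normcB z (- h); rewrite et' opprK normcN -/n; lra.
(* The displacement of the image point: -1/(z + h) + 1/z = h / (z * (z + h)). *)
pose k := h / (z * val t').
have ek : val (S t') = val (S t) + k.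
  have zh : z + h != 0 by rewrite -et'.
  by rewrite !val_actS /k et' -/z; field; rewrite t0 zh.
have nk : normc k <= 2 / n ^+ 2 * normc h.
  rewrite /k normcM normcV normcM -/n mulrC ler_wpM2r ?normc_ge0//.
  have -> : 2 / n ^+ 2 = (n * (n / 2))^-1 by field; rewrite gt_eqF.
  have q1 : 0 < n * (n / 2) by rewrite mulr_gt0// divr_gt0.
  have q2 : n * (n / 2) <= n * normc (val t') by rewrite ler_wpM2l// ltW.
  by rewrite lef_pV2 ?posrE// (lt_le_trans q1).
have kd : normc k < d.
  apply: le_lt_trans nk _; rewrite mulrC mulrA ltr_pdivrMr ?exprn_gt0//.
  by move: h3; rewrite ltr_pdivlMr.
have := hd k kd; rewrite -ek !extend_val -/l => H.
(* Replacing [l * k] by l * h / z^2 costs a term quadratic in h. *)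
have -> : f (S t') - f (S t) - l / z ^+ 2 * h =
   (f (S t') - f (S t) - l * k) + - (l * h ^+ 2 / (z ^+ 2 * val t')).
  have zh : z + h != 0 by rewrite -et'.
  by rewrite /k et' -/z; field; rewrite t0 zh.
apply: le_trans (le_normcD _ _) _.
have H1 : normc (f (S t') - f (S t) - l * k) <= e / 2 * normc h.
  apply: le_trans H _; apply: le_trans (ler_wpM2l (ltW e'0) nk) _.
  rewrite le_eqVlt; apply/orP; left; apply/eqP; field; by rewrite gt_eqF.
have H2 : normc (- (l * h ^+ 2 / (z ^+ 2 * val t'))) <= e / 2 * normc h.
  rewrite normcN normcM normcV [normc (l * _)]normcM [normc (z ^+ 2 * _)]normcM !normcX -/n.
  have q1 : 0 < n ^+ 2 * (n / 2) by rewrite mulr_gt0// ?divr_gt0// exprn_gt0.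
  have q2 : n ^+ 2 * (n / 2) <= n ^+ 2 * normc (val t') by rewrite ler_wpM2l// exprn_ge0// ltW.
  rewrite ler_pdivrMr; last exact: lt_le_trans q2.
  apply: (@le_trans _ _ (e / 2 * normc h * (n ^+ 2 * (n / 2)))); last first.
    by rewrite ler_wpM2l// mulr_ge0 ?normc_ge0// divr_ge0// ltW.
  have -> : e / 2 * normc h * (n ^+ 2 * (n / 2)) = e * n ^+ 3 / 4 * normc h by field.
  rewrite expr2 mulrA ler_wpM2r ?normc_ge0//.
  move: h4; rewrite ltr_pdivlMr ?mulr_gt0// => h4.
  have := normc_ge0 h; lra.
lra.
Qed.

Lemma e2pi_nat (n : nat) : e2pi (n%:R : C) = 1.
Proof.
by elim: n => [|n IH]; rewrite ?e2pi0// -addn1 natrD e2piD IH e2pi1 mulr1.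
Qed.

Lemma has_qexp_T m f a t : has_qexp m f a -> f (T t) = e2pi m%:C * f t.
Proof.
move=> /has_qexpP hf; apply: csum_uniq (hf (T t)) _.
apply: csum_eq (csumMl (e2pi m%:C) (hf t)) => n.
rewrite val_actT mulrDr e2piD mulr1; set y := e2pi (_ * _).
by rewrite rmorphD /= e2piD rmorph_nat e2pi_nat mulr1; ring.
Qed.

Lemma has_qexp_twist (r : R) m f a : has_qexp m f a ->
  has_qexp (r + m) (fun t => e2pi (r%:C * val t) * f t) a.
Proof.
move=> /has_qexpP hf; apply/has_qexpP => t.
apply: csum_eq (csumMl _ (hf t)) => n.
by rewrite -addrA [(r + _)%:C]rmorphD mulrDl [e2pi (r%:C * _ + _)]e2piD; ring.
Qed.

Lemma has_qexp_mul m1 m2 f g a b : has_qexp m1 f a -> has_qexp m2 g b ->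
  exists2 c, has_qexp (m1 + m2) (fun t => f t * g t) c & c 0%N = a 0%N * b 0%N.
Proof.
(* [has_qexpM] wants exponent 0 in its first factor, so q^m1 is divided out and restored
   afterwards. *)
move=> hf hg; have h := has_qexp_twist (r := - m1) hf.
rewrite addNr in h; have := has_qexpM h hg => /(has_qexp_twist (r := m1)) H.
eexists.
  have -> : (fun t => f t * g t) = (fun t => e2pi (m1%:C * val t) *
     (e2pi ((- m1)%:C * val t) * f t * g t)).
    apply/funext => t.
    have E : e2pi (m1%:C * val t) * e2pi ((- m1)%:C * val t) = 1.
      by rewrite -e2piD -mulrDl -rmorphD subrr mul0r e2pi0.
    by rewrite -[f t in LHS]mul1r -E; ring.
  exact: H.
by rewrite /= big_nat1 subn0.
Qed.

(** The exponents of a form are normalised to [0, 1). This lemma re-normalises an expansion whose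
    polar term has been cancelled, and [has_qexp_unshift] one that starts too high. *)
Lemma has_qexp_shift m f a : has_qexp m f a -> a 0%N = 0 ->
  has_qexp (m + 1) f (fun n => a n.+1).
Proof.
move=> /has_qexpP hf a0; apply/has_qexpP => t.
have := (csumS _ _).1 (hf t); rewrite a0 mul0r subr0; apply: csum_eq => n.
by have -> : m + n.+1%:R = m + 1 + n%:R by rewrite -natr1; ring.
Qed.

Lemma has_qexp_unshift m f a : has_qexp (m + 1) f a ->
  has_qexp m f (fun n => if n is n'.+1 then a n' else 0).
Proof.
move=> /has_qexpP hf; apply/has_qexpP => t.
apply/csumS; rewrite mul0r subr0; apply: csum_eq (hf t) => n.
by have -> : m + n.+1%:R = m + 1 + n%:R by rewrite -natr1; ring.
Qed.

(** At the points i (N + 1) the terms of positive index decay faster than the leading one by at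
    least a factor e^(-pi N), so growing N isolates the leading coefficient. Leading coefficients
    are thereby well defined. *)
Lemma has_qexp_lead0 m a : has_qexp m (fun=> 0) a -> a 0%N = 0.
Proof.
move=> h0; apply/eqP; rewrite -normc_eq0; apply/eqP.
have i0 (N : nat) : 0 < complex.Im (N.+1%:R%:C * 'i : C) by rewrite ImZ /= mulr1 ltr0n.
pose t N : uhp R := exist (fun z : C => is_true (0 < complex.Im z)) _ (i0 N).
have [A A0 hA] := has_qexp_normc (t 0%N) h0.
pose s : R := pi.
have s0 : 0 < s by exact: pi_gt0.
have [B hB] := rsummable_expR s0.
have B0 : 0 <= B by apply: le_trans (hB 0%N); rewrite big_nil.
pose w := normc (e2pi ((m + 0%:R)%:C * val (t 0%N))).
have w0 : 0 < w by rewrite normc_gt0 e2pi_neq0.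
have tE (N : nat) : val (t N) = val (t 0%N) + (N%:R%:C * 'i).
  by rewrite /= -mulrDl -rmorphD /= -natr1 addrC.
have key (N : nat) : normc (a 0%N) * w <= A * B * expR (- (s * N%:R)).
  have /has_qexpP/(_ (t N))/csumS/= := h0; rewrite sub0r => hs.
  have E : normc (- (a 0%N * e2pi ((m + 0%:R)%:C * val (t N)))) =
     normc (a 0%N) * w * expR (- (pi *+ 2 * (m * N%:R))).
    rewrite normcN normcM tE mulrDr e2piD normcM -/w mulrA; congr (_ * _).
    by rewrite normc_e2piE !ImZ /= mulr1 addr0.
  have hb (n : nat) : normc (a n.+1 * e2pi ((m + n.+1%:R)%:C * val (t N))) <=
     A * expR (- (pi *+ 2 * (m * N%:R))) * expR (- (s * N%:R)) * expR (- (s * n%:R)).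
    rewrite tE mulrDr e2piD mulrA normcM.
    apply: le_trans (ler_wpM2r (normc_ge0 _) (hA n.+1)) _.
    rewrite normc_e2piE !ImZ /= -!mulrA ler_wpM2l// -!expRD ler_expR.
    rewrite /s -natr1; have : 0 <= pi * N%:R * n%:R :> R by rewrite !mulr_ge0 ?pi_ge0.
    have : 0 <= pi * N%:R :> R by rewrite mulr_ge0 ?pi_ge0.
    have := pi_gt0 R; lra.
  have := csum_normc_le hb _ hs => /(_ (A * expR (- (pi *+ 2 * (m * N%:R))) * expR (- (s * N%:R)) * B)).
  rewrite E => H.
  have e0 := expR_gt0 (- (pi *+ 2 * (m * N%:R))).
  rewrite -(ler_pM2r e0); set e := expR (- (pi *+ 2 * _)) in H *.
  have -> : A * B * expR (- (s * N%:R)) * e = A * e * expR (- (s * N%:R)) * B by ring.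
  apply: H => n; rewrite -mulr_sumr ler_wpM2l//.
  by rewrite !mulr_ge0// expR_ge0.
apply/eqP; rewrite eq_le normc_ge0 andbT leNgt; apply/negP => an0.
have x0 : 0 < normc (a 0%N) * w by rewrite mulr_gt0.
set x := normc (a 0%N) * w in x0 key.
have [N hN] : exists N : nat, A * B < x * (1 + s * N%:R).
  exists (Num.bound (A * B / (x * s))).
  have := archi_boundP (divr_ge0 (mulr_ge0 A0 B0) (ltW (mulr_gt0 x0 s0))).
  rewrite ltr_pdivrMr ?mulr_gt0// => h; apply: lt_le_trans h _; lra.
have := key N; rewrite leNgt => /negP; apply.
rewrite expRN ltr_pdivrMr ?expR_gt0//; apply: lt_le_trans hN _.
by rewrite ler_wpM2l ?(ltW x0)// expR_ge1Dx.
Qed.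

Lemma has_qexp_lead m f a b : has_qexp m f a -> has_qexp m f b -> a 0%N = b 0%N.
Proof.
move=> ha hb; have := has_qexpD ha (has_qexpZ (c := -1) hb).
have -> : (fun t => f t + -1 * f t) = (fun=> 0).
  by apply/funext => t; rewrite mulN1r subrr.
by move=> /has_qexp_lead0/eqP; rewrite mulN1r subr_eq0 => /eqP.
Qed.

End ActionST.

(** * Finite identities and bounds for the cotangent *)

Section Cotangent.
Variable R : realType.
Local Notation C := R[i].
Implicit Types (z w : C).

Lemma climV (u : nat -> C) (l : C) : l != 0 -> clim u l -> clim (fun n => (u n)^-1) l^-1.
Proof.
by move=> l0 /climP h; apply/climP; exact: (cvgV l0 h).
Qed.

Lemma tannery_ex (f : nat -> nat -> C) (g : nat -> C) (v : nat -> R) :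
  (forall k, 0 <= v k) -> rsummable v ->
  (forall N k, (k < N)%N -> normc (f N k) <= v k) ->
  (forall k, clim (f^~ k) (g k)) ->
  exists2 G, csum g G & clim (fun N => \sum_(0 <= k < N) f N k) G.
Proof.
move=> v0 hv hf hg.
have hgv k : normc (g k) <= v k.
  apply: (@clim_normc_le _ (fun n => f (n + k.+1)%N k)) => [n|].
    by apply: hf; rewrite addnS ltnS leq_addl.
  rewrite /clim (@cvg_shiftn k.+1 _ (fun n => normc (f n k - g k))).
  exact: hg.
have [G hG] := csum_abs hgv hv; exists G => //.
exact: tannery hG.
Qed.

Lemma rsummable_inv2_le n : \sum_(0 <= i < n) i.+1%:R ^- 2 <= 2 :> R.
Proof.
suff h : \sum_(0 <= i < n) i.+1%:R ^- 2 <= 2 - 2 / n.+1%:R :> R.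
  by apply: le_trans h _; rewrite lerBlDr lerDl divr_ge0.
elim: n => [|n IH]; first by rewrite big_nil divr1 subrr.
rewrite big_nat_recr//=; apply: le_trans (lerD IH (lexx _)) _.
have n1 : 1 <= n.+1%:R :> R by rewrite ler1n.
rewrite -(@natr1 _ n.+1); move: n.+1%:R n1 => x x1.
have x0 : 0 < x by apply: lt_le_trans x1.
rewrite -subr_ge0.
have -> : 2 - 2 / (x + 1) - (2 - 2 / x + x ^- 2) = (x - 1) / (x ^+ 2 * (x + 1)).
  by field; rewrite !gt_eqF// addr_gt0.
by rewrite divr_ge0 ?subr_ge0// mulr_ge0 ?exprn_ge0 ?addr_ge0// ltW.
Qed.

Lemma rsummable_inv2 : rsummable (fun n => n.+1%:R ^- 2 : R).
Proof. by exists 2; exact: rsummable_inv2_le. Qed.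

Lemma e2piX z n : e2pi z ^+ n = e2pi (n%:R * z).
Proof.
elim: n => [|n IH]; first by rewrite mul0r e2pi0.
by rewrite exprS IH -e2piD -[n.+1]addn1 natrD mulrDl mul1r addrC.
Qed.

Lemma e2pi_neq1 z : 0 < complex.Im z -> e2pi z != 1.
Proof.
move=> z0; apply/eqP => h; have := normc_e2piE z; rewrite h normc1 => /esym/eqP.
rewrite lt_eqF// -[X in _ < X]expR0 ltr_expR oppr_lt0 mulr_gt0//.
by rewrite mulrn_wgt0// pi_gt0.
Qed.

(** This is i/2 times cot (pi z), in the form that shows its q-expansion. *)
Definition gcot z : C := (1 - e2pi z)^-1 - 2^-1.

Lemma e2pi_periodic z n : e2pi (z + n%:R) = e2pi z.
Proof.
rewrite e2piD; suff -> : e2pi (n%:R : C) = 1 by rewrite mulr1.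
by rewrite -[n%:R]mulr1 -e2piX e2pi1 expr1n.
Qed.

Lemma Im_addn z n : complex.Im (z + n%:R) = complex.Im z.
Proof. by case: z => a b; rewrite natC /= addr0. Qed.

Lemma Im_subn z n : complex.Im (z - n%:R) = complex.Im z.
Proof. by case: z => a b; rewrite natC /= oppr0 addr0. Qed.

Lemma Im_divn z n : complex.Im (z / n.+1%:R) = complex.Im z / n.+1%:R.
Proof.
by rewrite natC -fmorphV mulrC ImZ mulrC.
Qed.

Lemma sum_e2pi_root (N j : nat) : (j < N.+1)%N ->
  \sum_(0 <= k < N.+1) e2pi (j%:R * (k%:R / N.+1%:R) : C) = if j == 0%N then N.+1%:R else 0.
Proof.
move=> jN; have [->|j0] := eqVneq j 0%N.
  under eq_bigr => k _ do rewrite mul0r e2pi0.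
  by rewrite sumr_const_nat subn0.
set w := e2pi (j%:R / N.+1%:R : C).
have -> : \sum_(0 <= k < N.+1) e2pi (j%:R * (k%:R / N.+1%:R) : C) = \sum_(k < N.+1) w ^+ k.
  rewrite big_mkord; apply: eq_bigr => k _; rewrite /w e2piX; congr e2pi; ring.
have w1 : w - 1 != 0.
  rewrite subr_eq0; apply/eqP => h.
  have : (j%:R / N.+1%:R : R) = 0.
    apply: e2pi_inj; rewrite ?lexx ?ltr01 ?divr_ge0//=.
      by rewrite ltr_pdivrMr// mul1r ltr_nat.
    by rewrite e2pi0 -h /w rmorphM fmorphV !rmorph_nat.
  by move/eqP; rewrite mulf_eq0 invr_eq0 !pnatr_eq0 (negbTE j0).
apply: (mulfI w1); rewrite -subrX1 mulr0 /w e2piX mulrC divfK ?pnatr_eq0//.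
by rewrite -[j%:R]add0r e2pi_periodic e2pi0 subrr.
Qed.

(** With x = e2pi ((z + k) / N.+1), 1/(1 - x) is a geometric sum in x divided by 1 - x^N.+1, and
    x^N.+1 = e2pi z does not depend on k. Summing over k, orthogonality of the roots of unity kills
    all powers but the zeroth. *)
Lemma gcot_sum z N : 0 < complex.Im z ->
  \sum_(0 <= k < N.+1) gcot ((z + k%:R) / N.+1%:R) = N.+1%:R * gcot z.
Proof.
move=> z0; have N0 : N.+1%:R != 0 :> C by rewrite pnatr_eq0.
have q1 : 1 - e2pi z != 0 by rewrite subr_eq0 eq_sym e2pi_neq1.
have E k : (1 - e2pi ((z + k%:R) / N.+1%:R))^-1 =
    (1 - e2pi z)^-1 * \sum_(0 <= j < N.+1) (e2pi (j%:R * (z / N.+1%:R)) * e2pi (j%:R * (k%:R / N.+1%:R))).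
  set x := e2pi ((z + k%:R) / N.+1%:R).
  have x1 : 1 - x != 0.
    rewrite subr_eq0 eq_sym e2pi_neq1// Im_divn divr_gt0//.
    by rewrite Im_addn.
  have -> : \sum_(0 <= j < N.+1) (e2pi (j%:R * (z / N.+1%:R)) * e2pi (j%:R * (k%:R / N.+1%:R)))
     = \sum_(j < N.+1) x ^+ j.
    rewrite big_mkord; apply: eq_bigr => j _; rewrite /x e2piX -e2piD; congr e2pi; ring.
  have xN : x ^+ N.+1 = e2pi z.
    by rewrite /x e2piX mulrC divfK// e2pi_periodic.
  have H := subrX1 x N.+1; rewrite xN in H.
  apply: (mulfI x1); rewrite mulfV// mulrCA.
  have -> : (1 - x) * (\sum_(i < N.+1) x ^+ i) = 1 - e2pi z.
    by rewrite -opprB mulNr -H opprB.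
  by rewrite mulVf.
rewrite /gcot sumrB sumr_const_nat subn0.
under eq_bigr => k _ do rewrite E.
rewrite -mulr_sumr exchange_big /=.
under eq_big_nat => j /andP[_ jN] do rewrite -mulr_sumr sum_e2pi_root//.
rewrite big_nat_recl//= mul0r e2pi0 mul1r big1 ?addr0; last by move=> i _; rewrite mulr0.
by rewrite -mulr_natl; ring.
Qed.

(** Pairing gains decay: the numerator no longer involves B, and for A = z/N it is of order 1/N. *)
Lemma gcot_pair (A B : C) : 0 < complex.Im (A + B) -> 0 < complex.Im (A - B) ->
  gcot (A + B) + gcot (A - B) =
  (1 - e2pi (A *+ 2)) / ((1 - e2pi (A + B)) * (1 - e2pi (A - B))).
Proof.
move=> h1 h2.
have q1 : 1 - e2pi (A + B) != 0 by rewrite subr_eq0 eq_sym e2pi_neq1.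
have q2 : 1 - e2pi (A - B) != 0 by rewrite subr_eq0 eq_sym e2pi_neq1.
have -> : e2pi (A *+ 2) = e2pi (A + B) * e2pi (A - B) by rewrite -e2piD; congr e2pi; ring.
rewrite /gcot; field; by rewrite q1 q2.
Qed.

Lemma sin_lower (t : R) : 0 <= t <= pi / 2 -> t / 8 <= sin t.
Proof.
move=> /andP[t0 t1].
have h1 (s : R) : 0 <= s -> s <= 1 / 2 -> s / 2 <= sin s.
  move=> s0 s1; have := sin_sub_le s; rewrite ler_norml => /andP[h _].
  have : s ^+ 2 <= s / 2 by rewrite expr2 ler_wpM2l//; lra.
  lra.
have [ts|ts] := leP t (1 / 2); first by have := h1 t t0 ts; lra.
have p2 : pi / 2 <= 2 :> R by have [/andP[]] := @pihalf_02_cos_pihalf R.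
have p1 : 1 <= pi / 2 :> R by have := pi_ge2 R; lra.
have : sin (1 / 2) <= sin t.
  by apply: ltW; rewrite ltr_sin// in_itv /=; apply/andP; split; lra.
have := h1 (1 / 2) (ltW (divr_gt0 ltr01 (ltr0Sn _ 1))) (lexx _).
lra.
Qed.

Lemma normc_1e2pi (x : R) : 0 <= x <= 1 / 2 -> x / 2 <= normc (1 - e2pi (x%:C : C)).
Proof.
move=> /andP[x0 x1].
have -> : normc (1 - e2pi x%:C) = 2 * sin (pi * x).
  rewrite e2pi_real /=.
  have E : cos (pi *+ 2 * x) = 1 - sin (pi * x) ^+ 2 *+ 2.
    have := cos_sub1E (pi *+ 2 * x); have -> : pi *+ 2 * x / 2 = pi * x by field.
    by move/eqP; rewrite subr_eq => /eqP ->; ring.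
  have -> : (1 - cos (pi *+ 2 * x)) ^+ 2 + (0 - sin (pi *+ 2 * x)) ^+ 2 = (2 * sin (pi * x)) ^+ 2.
    rewrite sub0r sqrrN sin2cos2 E; ring.
  rewrite sqrtr_sqr ger0_norm// mulr_ge0// sin_ge0_pi//.
  have := pi_ge0 R => p0; rewrite mulr_ge0//= ler_piMr//; lra.
have pp : 2 <= pi :> R := pi_ge2 R.
have := @sin_lower (pi * x); rewrite mulr_ge0 ?pi_ge0//=.
have -> : pi * x <= pi / 2 by rewrite ler_wpM2l ?pi_ge0//; lra.
move/(_ isT) => h; have : 2 * x <= pi * x by rewrite ler_wpM2r.
lra.
Qed.

End Cotangent.

(** * Partial fractions of the cotangent *)

Section CotangentSeries.
Variable R : realType.
Local Notation C := R[i].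
Implicit Types (z w : C).

Lemma clim_harmonic (u : nat -> C) (l : C) (K : R) :
  (forall n, normc (u n - l) <= K / n.+1%:R) -> clim u l.
Proof.
move=> h; apply: clim_le h _.
rewrite -[X in _ --> X](mulr0 K); apply: cvgM; first exact: cvg_cst.
exact: cvg_harmonic.
Qed.

Lemma cexp_sub1 (w : C) (Y : R) : normc w <= Y ->
  normc (cexp w - 1) <= normc w * (1 + 4 * Y * expR Y).
Proof.
move=> hY; have n0 := normc_ge0 w.
have -> : cexp w - 1 = (cexp w - 1 - w) + w by rewrite subrK.
apply: le_trans (le_normcD _ _) _.
rewrite mulrDr mulr1 addrC lerD2l.
apply: le_trans (cexp_quad w) _.
rewrite expr2 -2!mulrA [leLHS]mulrCA ler_wpM2l// -!mulrA ler_wpM2l//.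
by rewrite ler_pM ?expR_ge0 ?ler_expR.
Qed.

(** The scaling picks out the pole of [gcot] at 0, of residue -1 / (2 pi i). Denominators are odd in
    view of the symmetric range of [cot_partial]. *)
Lemma gcot_lim w : 0 < complex.Im w ->
  clim (fun M => gcot (w / M.*2.+1%:R) / M.*2.+1%:R) (- (c2pi R * w)^-1).
Proof.
move=> w0; have wn0 : w != 0 by apply/eqP => h; move: w0; rewrite h ltxx.
have c0 : c2pi R != 0 by rewrite -normc_eq0 normc_c2pi gt_eqF// mulrn_wgt0// pi_gt0.
have hN (M : nat) : M.+1%:R <= M.*2.+1%:R :> R by rewrite ler_nat; lia.
have N0 (M : nat) : M.*2.+1%:R != 0 :> C by rewrite pnatr_eq0.
have nN (M : nat) : normc (M.*2.+1%:R : C) = M.*2.+1%:R.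
  by rewrite natC normcR ger0_norm.
pose Y := normc (c2pi R * w).
have h1 : clim (fun M => M.*2.+1%:R * (1 - e2pi (w / M.*2.+1%:R))) (- (c2pi R * w)).
  apply: (@clim_harmonic _ _ (4 * Y ^+ 2 * expR Y)) => M.
  set N : R := M.*2.+1%:R; have Np : 1 <= N by rewrite ler1n.
  have N1 : 0 < N by apply: lt_le_trans Np.
  have wE : normc (c2pi R * (w / M.*2.+1%:R)) = Y / N.
    by rewrite mulrA normcM normcV nN.
  have -> : M.*2.+1%:R * (1 - e2pi (w / M.*2.+1%:R)) - - (c2pi R * w) =
     - (M.*2.+1%:R * (cexp (c2pi R * (w / M.*2.+1%:R)) - 1 - c2pi R * (w / M.*2.+1%:R))).
    by rewrite -e2piE; field.
  rewrite normcN normcM nN -/N.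
  apply: le_trans (ler_wpM2l (ltW N1) (cexp_quad _)) _; rewrite wE.
  have YN : Y / N <= Y by rewrite ler_pdivrMr// ler_peMr// normc_ge0.
  apply: (@le_trans _ _ (4 * Y ^+ 2 * expR Y / N)).
    have -> : N * (4 * (Y / N) ^+ 2 * expR (Y / N)) = 4 * Y ^+ 2 * expR (Y / N) / N.
      by field; rewrite gt_eqF.
    rewrite ler_wpM2r ?invr_ge0 ?(ltW N1)// ler_wpM2l ?ler_expR//.
    by rewrite mulr_ge0// exprn_ge0// normc_ge0.
  rewrite ler_wpM2l//; first by rewrite !mulr_ge0 ?expR_ge0 ?exprn_ge0 ?normc_ge0.
  by rewrite lef_pV2 ?posrE ?ltr0n.
have h2 : clim (fun M => (2 * M.*2.+1%:R)^-1 : C) 0.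
  apply: (@clim_harmonic _ _ 1) => M.
  have n2 : normc (2 : C) = 2 by rewrite natC normcR ger0_norm.
  rewrite subr0 normcV normcM nN n2 mul1r.
  by rewrite lef_pV2 ?posrE ?mulr_gt0 ?ltr0n//; have := hN M; have := ltr0Sn R M; lra.
have cw0 : - (c2pi R * w) != 0 by rewrite oppr_eq0 mulf_neq0.
have := climB (climV cw0 h1) h2; rewrite subr0 invrN; apply: clim_eq => M.
have q1 : 1 - e2pi (w / M.*2.+1%:R) != 0.
  by rewrite subr_eq0 eq_sym e2pi_neq1// Im_divn divr_gt0.
rewrite /gcot; move: (M.*2.+1%:R) (N0 M) q1 => N N1 q1.
by field; rewrite q1 N1.
Qed.

(** This is [gcot_sum] with 2M + 1 terms, where periodicity lets the indices M + 1, ..., 2M be read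
    as -M, ..., -1. *)
Lemma cot_partial z (M : nat) : 0 < complex.Im z ->
  \sum_(0 <= k < M) (gcot ((z + k.+1%:R) / M.*2.+1%:R) + gcot ((z - k.+1%:R) / M.*2.+1%:R)) =
  M.*2.+1%:R * gcot z - gcot (z / M.*2.+1%:R).
Proof.
move=> z0; rewrite -gcot_sum// big_nat_recl//= addr0 addrAC subrr add0r.
rewrite [RHS](big_cat_nat (n := M))//=; last by rewrite -addnn leq_addr.
rewrite big_split/=; congr (_ + _).
have sh (F : nat -> C) : \sum_(M <= i < M.*2) F i = \sum_(0 <= i < M) F (i + M)%N.
  rewrite -{1}[M]add0n big_addn; congr (\sum_(0 <= i < _) _); lia.
rewrite [RHS]big_nat_rev/= sh.
rewrite big_nat_cond [RHS]big_nat_cond; apply: eq_bigr => i; rewrite andbT => /andP[_ iM].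
have -> : ((M + M.*2 - (i + M).+1).+1 = M.*2.+1 - i.+1)%N by lia.
rewrite natrB; last by lia.
have E (n x : C) : n != 0 -> (z + (n - x)) / n = (z - x) / n + 1.
  by move=> n0; field.
rewrite E ?pnatr_eq0// /gcot; congr ((1 - _)^-1 - _).
exact: esym (e2pi_periodic _ 1).
Qed.

(** For large k, e^(2 pi i k/N) is at distance at least k/(2N) from 1, which the perturbation by
    z/N, of order 1/N, cannot undo. For the remaining k the modulus e^(-x/N) alone keeps the point
    at distance of order 1/N from 1. *)
Lemma cot_lower z : 0 < complex.Im z -> exists2 c : R, 0 < c &
  forall M k, (k < M)%N ->
   c * k.+1%:R <= M.*2.+1%:R * normc (1 - e2pi ((z + k.+1%:R) / M.*2.+1%:R)) /\
   c * k.+1%:R <= M.*2.+1%:R * normc (1 - e2pi ((z - k.+1%:R) / M.*2.+1%:R)).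
Proof.
move=> z0; set y := complex.Im z.
pose Y := pi *+ 2 * normc z.
have Y0 : 0 <= Y by rewrite mulr_ge0 ?normc_ge0// mulrn_wge0// pi_ge0.
pose C1 := Y * (1 + 4 * Y * expR Y).
have C10 : 0 <= C1.
  apply: mulr_ge0 => //; apply: addr_ge0 => //.
  by apply: mulr_ge0; [apply: mulr_ge0|exact: expR_ge0].
pose x := pi *+ 2 * y; have x0 : 0 < x by rewrite mulr_gt0// mulrn_wgt0// pi_gt0.
pose c2 := x / (1 + x).
have c20 : 0 < c2 by rewrite divr_gt0// addr_gt0.
(* The factor 1/4 serves the range [4 * C1 <= K], where K / 2 - C1 >= K / 4; the other one serves K
   < 4 * C1, where the bound [c2] is enough. *)
pose c := Num.min (1 / 4) (c2 / (4 * C1 + 1)).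
have C41 : 0 < 4 * C1 + 1 by rewrite ltr_wpDl// mulr_ge0.
exists c; first by rewrite /c lt_min; apply/andP; split; apply: divr_gt0.
move=> M k kM; set N : R := M.*2.+1%:R.
have N1 : 1 <= N by rewrite ler1n.
have Np : 0 < N by apply: lt_le_trans N1.
have NN0 : N != 0 by rewrite gt_eqF.
set K : R := k.+1%:R; have K0 : 0 < K by rewrite ltr0n.
have KN : K / N <= 1 / 2.
  rewrite ler_pdivrMr//; have : 2 * K <= N; last by lra.
  by rewrite /K /N -natrM ler_nat; lia.
have KN0 : 0 <= K / N by rewrite divr_ge0// ltW.
have alpha : normc (1 - e2pi (z / M.*2.+1%:R)) <= C1 / N.
  rewrite normcB e2piE.
  have wE : normc (c2pi R * (z / M.*2.+1%:R)) = Y / N.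
    by rewrite mulrA normcM normcV normcM normc_c2pi natC normcR ger0_norm.
  have YN : normc (c2pi R * (z / M.*2.+1%:R)) <= Y.
    by rewrite wE ler_pdivrMr// ler_peMr.
  apply: le_trans (cexp_sub1 YN) _.
  by rewrite wE /C1 [leLHS]mulrAC.
suff H (v : C) : normc (e2pi v) = 1 -> K / N / 2 <= normc (1 - e2pi v) ->
    c * K <= N * normc (1 - e2pi (z / M.*2.+1%:R + v)).
  have KE : (K / N)%:C = k.+1%:R / M.*2.+1%:R :> C.
    by rewrite rmorphM fmorphV !rmorph_nat.
  have n1 : normc (e2pi (K / N)%:C) = 1.
    by rewrite normc_e2piE /= mulr0 oppr0 expR0.
  have n2 : K / N / 2 <= normc (1 - e2pi (K / N)%:C).
    by apply: normc_1e2pi; rewrite KN0.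
  split; first by rewrite mulrDl -KE; apply: H.
  rewrite mulrBl -KE; apply: H.
    by rewrite normc_e2piE /= !oppr0 mulr0 oppr0 expR0.
  suff -> : normc (1 - e2pi (- (K / N)%:C)) = normc (1 - e2pi (K / N)%:C) by [].
  rewrite -[LHS]mul1r -n1 -normcM mulrBr mulr1 -e2piD subrr e2pi0 normcB.
  by [].
move=> n1 n2.
have H1 : K / 2 - C1 <= N * normc (1 - e2pi (z / M.*2.+1%:R + v)).
  have -> : K / 2 - C1 = N * (K / N / 2 - C1 / N) by field.
  rewrite ler_wpM2l ?(ltW Np)//.
  have -> : 1 - e2pi (z / M.*2.+1%:R + v) = (1 - e2pi v) - (e2pi v * (e2pi (z / M.*2.+1%:R) - 1)).
    by rewrite e2piD; ring.
  apply: le_trans (ler_normcB _ _).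
  by rewrite normcM n1 mul1r [normc (e2pi _ - 1)]normcB lerB.
have H2 : c2 <= N * normc (1 - e2pi (z / M.*2.+1%:R + v)).
  have E : normc (e2pi (z / M.*2.+1%:R + v)) = expR (- (x / N)).
    by rewrite e2piD normcM n1 mulr1 normc_e2piE Im_divn mulrA.
  have := ler_normcB 1 (e2pi (z / M.*2.+1%:R + v)); rewrite normc1 E => h.
  apply: le_trans (ler_wpM2l (ltW Np) h).
  rewrite expRN; have := expR_ge1Dx (x / N); set e := expR _ => he.
  have xN : 0 < x / N by rewrite divr_gt0.
  have h1 : e^-1 <= (1 + x / N)^-1.
    have p1 : 0 < 1 + x / N by rewrite addr_gt0.
    by rewrite lef_pV2 ?posrE// (lt_le_trans p1).
  apply: (@le_trans _ _ (N * (1 - (1 + x / N)^-1))); last first.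
    by rewrite ler_wpM2l ?(ltW Np)// lerB.
  have -> : N * (1 - (1 + x / N)^-1) = x / (1 + x / N).
    have E1 (n u : R) : 0 < n -> 0 < u -> n * (1 - (1 + u / n)^-1) = u / (1 + u / n).
      by move=> n0 u0; field; rewrite !gt_eqF// addr_gt0.
    exact: E1.
  rewrite /c2 ler_wpM2l ?(ltW x0)// lef_pV2 ?posrE ?addr_gt0//.
  by rewrite lerD2l ler_pdivrMr// ler_peMr// ltW.
have [K4|K4] := leP (4 * C1) K.
  apply: le_trans H1; apply: (@le_trans _ _ (1 / 4 * K)); last by lra.
  by rewrite ler_wpM2r ?(ltW K0)// /c ge_min lexx.
apply: le_trans H2; apply: (@le_trans _ _ (c2 / (4 * C1 + 1) * K)).
  by rewrite ler_wpM2r ?(ltW K0)// /c ge_min lexx orbT.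
rewrite mulrAC ler_pdivrMr// ler_wpM2l ?(ltW c20)//; lra.
Qed.

(** Up to the term 1/z, the sum is pi * cot (pi z), which is -2 pi i times [gcot]: [cot_partial] is
    divided by 2M + 1, and [tannery_ex] lets M grow. *)
Lemma cot_series z : 0 < complex.Im z ->
  csum (fun k => (z + k.+1%:R)^-1 + (z - k.+1%:R)^-1) (- c2pi R * gcot z - z^-1).
Proof.
move=> z0.
have zn0 : z != 0 by apply/eqP => h; move: z0; rewrite h ltxx.
have c0 : c2pi R != 0 by rewrite -normc_eq0 normc_c2pi gt_eqF// mulrn_wgt0// pi_gt0.
have [c cp hc] := cot_lower z0.
pose N (M : nat) : C := M.*2.+1%:R.
have nN (M : nat) : normc (N M) = M.*2.+1%:R by rewrite /N natC normcR ger0_norm.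
have N0 (M : nat) : N M != 0 by rewrite pnatr_eq0.
pose f M k := (gcot ((z + k.+1%:R) / N M) + gcot ((z - k.+1%:R) / N M)) / N M.
pose w := c2pi R * (z *+ 2).
pose B := normc w * (1 + 4 * normc w * expR (normc w)) / c ^+ 2.
have B0 : 0 <= B.
  by rewrite divr_ge0 ?exprn_ge0 ?(ltW cp)// mulr_ge0 ?normc_ge0// addr_ge0// !mulr_ge0 ?expR_ge0 ?normc_ge0.
have ip (M k : nat) : 0 < complex.Im ((z + k.+1%:R) / N M) by rewrite Im_divn Im_addn divr_gt0.
have im (M k : nat) : 0 < complex.Im ((z - k.+1%:R) / N M) by rewrite Im_divn Im_subn divr_gt0.
have hf M k : (k < M)%N -> normc (f M k) <= B * k.+1%:R ^- 2.
  move=> kM; have [h1 h2] := hc M k kM.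
  have E : gcot ((z + k.+1%:R) / N M) + gcot ((z - k.+1%:R) / N M) =
     (1 - e2pi (z / N M *+ 2)) / ((1 - e2pi ((z + k.+1%:R) / N M)) *
        (1 - e2pi ((z - k.+1%:R) / N M))).
    have := ip M k; have := im M k.
    have e1 : (z + k.+1%:R) / N M = z / N M + k.+1%:R / N M by rewrite mulrDl.
    have e2 : (z - k.+1%:R) / N M = z / N M - k.+1%:R / N M by rewrite mulrBl.
    rewrite e1 e2 => i1 i2.
    by rewrite (gcot_pair i2 i1).
  rewrite /f E.
  set X1 := normc (1 - e2pi _) in h1; set X2 := normc (1 - e2pi _) in h2.
  rewrite normcM normcV normcM normcV [normc (_ * (1 - _))]normcM nN -/X1 -/X2.
  set K : R := k.+1%:R in h1 h2 *; set n : R := M.*2.+1%:R in h1 h2 *.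
  have n1 : 1 <= n by rewrite ler1n.
  have n0 : 0 < n by apply: lt_le_trans n1.
  have K0 : 0 < K by rewrite ltr0n.
  have top : normc (1 - e2pi (z / N M *+ 2)) <= normc w * (1 + 4 * normc w * expR (normc w)) / n.
    rewrite normcB e2piE.
    have -> : c2pi R * (z / N M *+ 2) = w / N M by rewrite /w; field.
    have wE : normc (w / N M) = normc w / n by rewrite normcM normcV nN.
    have wY : normc (w / N M) <= normc w by rewrite wE ler_pdivrMr// ler_peMr// normc_ge0.
    by apply: le_trans (cexp_sub1 wY) _; rewrite wE mulrAC.
  have cK : 0 < c * K by rewrite mulr_gt0.
  have bot : (X1 * X2)^-1 <= n ^+ 2 / (c * K) ^+ 2.
    have X1p : 0 < X1 by rewrite -(pmulr_rgt0 _ n0); apply: lt_le_trans h1.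
    have X2p : 0 < X2 by rewrite -(pmulr_rgt0 _ n0); apply: lt_le_trans h2.
    rewrite ler_pdivlMr ?exprn_gt0// mulrC ler_pdivrMr ?mulr_gt0//.
    have -> : n ^+ 2 * (X1 * X2) = (n * X1) * (n * X2) by ring.
    by rewrite expr2 ler_pM// ltW.
  (* The numerator is of order 1/n, the inverted denominators of order n^2 / K^2, and [f] carries a
     further 1/n; what remains depends on k alone. *)
  apply: (@le_trans _ _ (normc w * (1 + 4 * normc w * expR (normc w)) / n * (n ^+ 2 / (c * K) ^+ 2) / n)).
    rewrite ler_wpM2r ?invr_ge0 ?(ltW n0)//.
    by rewrite ler_pM ?normc_ge0// invr_ge0 mulr_ge0 ?normc_ge0.
  have E2 (p r m l : R) : r != 0 -> m != 0 -> l != 0 ->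
      p / m * (m ^+ 2 / (r * l) ^+ 2) / m = p / r ^+ 2 * l ^- 2.
    by move=> r0 m0 l0; field; rewrite r0 m0 l0.
  rewrite E2 ?gt_eqF//.
pose g k := - (c2pi R * (z + k.+1%:R))^-1 + - (c2pi R * (z - k.+1%:R))^-1.
have hg k : clim (f^~ k) (g k).
  have i1 : 0 < complex.Im (z + k.+1%:R) by rewrite Im_addn.
  have i2 : 0 < complex.Im (z - k.+1%:R) by rewrite Im_subn.
  apply: clim_eq (climD (gcot_lim i1) (gcot_lim i2)) => M.
  exact/esym/mulrDl.
have Bk (k : nat) : 0 <= B * k.+1%:R ^- 2 by rewrite mulr_ge0// invr_ge0 exprn_ge0.
have [G hG hl] := tannery_ex Bk (rsummableZ B0 (rsummable_inv2 R)) hf hg.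
have hl' : clim (fun M => gcot z - gcot (z / N M) / N M) (gcot z - - (c2pi R * z)^-1).
  exact: climB (clim_cst _) (gcot_lim z0).
have GE : G = gcot z - - (c2pi R * z)^-1.
  apply: clim_uniq hl _; apply: clim_eq hl' => M.
  rewrite /f -mulr_suml cot_partial// -/(N M) [RHS]mulrBl; congr (_ - _).
  by rewrite mulrAC divff// mul1r.
rewrite GE in hG.
have -> : - c2pi R * gcot z - z^-1 = - c2pi R * (gcot z - - (c2pi R * z)^-1).
  by field; rewrite zn0 c0.
apply: csum_eq (csumMl (- c2pi R) hG) => k.
have p0 : z + k.+1%:R != 0 by apply/eqP => h; have := Im_addn z k.+1; rewrite h /= => h'; move: z0; rewrite -h' ltxx.
have m0 : z - k.+1%:R != 0 by apply/eqP => h; have := Im_subn z k.+1; rewrite h /= => h'; move: z0; rewrite -h' ltxx.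
rewrite /g; move: (k.+1%:R : C) p0 m0 => x p0 m0.
by field; rewrite c0 p0 m0.
Qed.

End CotangentSeries.

(** * Lipschitz's formula in weight two *)

Section Lipschitz.
Variable R : realType.
Local Notation C := R[i].
Implicit Types (z w : C) (t : uhp R).

Lemma normc_sqr z : normc z ^+ 2 = complex.Re z ^+ 2 + complex.Im z ^+ 2.
Proof. by case: z => a b /=; rewrite sqr_sqrtr// addr_ge0 ?sqr_ge0. Qed.

(** The imaginary part controls m, and then the real part controls s; [D] collects the two costs. *)
Lemma lattice_lower t : exists2 c : R, 0 < c & forall m s : R,
  c * (m ^+ 2 + s ^+ 2) <= normc (m%:C * val t + s%:C) ^+ 2.
Proof.
have y0 := valP t; set x := complex.Re (val t); set y := complex.Im (val t) in y0 *.
have y2 : 0 < y ^+ 2 by rewrite exprn_gt0.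
pose D := 2 + (1 + 2 * x ^+ 2) / y ^+ 2.
have D0 : 0 < D.
  by rewrite addr_gt0// divr_gt0// ltr_wpDr// mulr_ge0// sqr_ge0.
exists D^-1; first by rewrite invr_gt0.
move=> m s; rewrite ler_pdivrMl// normc_sqr.
have -> : complex.Re (m%:C * val t + s%:C) = m * x + s.
  by rewrite /x; case: (val t) => a b /=; ring.
have -> : complex.Im (m%:C * val t + s%:C) = m * y.
  by rewrite /y; case: (val t) => a b /=; ring.
set X := (m * x + s) ^+ 2 + (m * y) ^+ 2.
have h1 : m ^+ 2 <= X / y ^+ 2.
  by rewrite ler_pdivlMr// /X exprMn lerDr sqr_ge0.
have h2 : s ^+ 2 <= 2 * X + 2 * x ^+ 2 * (X / y ^+ 2).
  apply: (@le_trans _ _ (2 * (m * x + s) ^+ 2 + 2 * x ^+ 2 * m ^+ 2)).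
    have := sqr_ge0 (m * x * 2 + s).
    rewrite -subr_ge0 => h; rewrite -subr_ge0.
    apply: le_trans h _; rewrite le_eqVlt; apply/orP; left; apply/eqP; ring.
  rewrite lerD//.
    by rewrite ler_wpM2l// /X lerDl sqr_ge0.
  by rewrite ler_wpM2l// mulr_ge0// sqr_ge0.
have -> : D * X = X / y ^+ 2 + (2 * X + 2 * x ^+ 2 * (X / y ^+ 2)).
  by rewrite /D; field; rewrite gt_eqF.
exact: lerD.
Qed.

Lemma geo_csum (q : C) : normc q < 1 -> csum (fun n => q ^+ n) (1 - q)^-1.
Proof.
move=> q1.
have q0 : 1 - q != 0 by rewrite subr_eq0; apply: contraTneq q1 => <-; rewrite normc1 ltxx.
have h : clim (fun n => q ^+ n) 0.
  rewrite /clim.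
  have -> : (fun n => normc (q ^+ n - 0)) = (fun n => normc q ^+ n).
    by apply/funext => n; rewrite subr0 normcX.
  by apply: cvg_expr; rewrite ger0_norm// normc_ge0.
have := climM (climB (clim_cst 1) h) (clim_cst (1 - q)^-1).
rewrite subr0 mul1r; apply: clim_eq => n.
rewrite big_mkord; apply: (mulIf q0); rewrite mulfVK// mulrC.
by rewrite -[1 - q]opprB mulNr -subrX1 opprB.
Qed.

Lemma normc_e2pi_lt1 z : 0 < complex.Im z -> normc (e2pi z) < 1.
Proof.
move=> z0; rewrite normc_e2piE -[X in _ < X]expR0 ltr_expR oppr_lt0 mulr_gt0//.
by rewrite mulrn_wgt0// pi_gt0.
Qed.

Lemma gcot_qexp : exists2 a : nat -> C,
  has_qexp 0 (fun t => gcot (val t)) a & forall n, a n.+1 = 1.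
Proof.
exists (fun n => 1 + (if n is 0%N then - 2^-1 else 0)); last by move=> n; rewrite addr0.
have hc : has_qexp 0 (fun=> - 2^-1) (fun n => if n is 0%N then - 2^-1 else 0 : C).
  exact: has_qexp_cst.
suff h1 : has_qexp 0 (fun t => (1 - e2pi (val t))^-1) (fun=> 1 : C).
  exact: (has_qexpD h1 hc).
apply/has_qexpP => t.
apply: csum_eq (geo_csum (normc_e2pi_lt1 (valP t))) => n.
by rewrite e2piX mul1r add0r natC.
Qed.

Lemma uhp_nat_neq0 t (n : nat) : (val t + n%:R != 0) * (val t - n%:R != 0).
Proof.
have t0 := valP t; split; apply/eqP => h.
  by have := Im_addn (val t) n; rewrite h /= => h'; move: t0; rewrite /= -h' ltxx.
by have := Im_subn (val t) n; rewrite h /= => h'; move: t0; rewrite /= -h' ltxx.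
Qed.

Definition pair1 t (k : nat) : C := (val t + k.+1%:R)^-1 + (val t - k.+1%:R)^-1.
Definition pair2 t (k : nat) : C := (val t + k.+1%:R) ^- 2 + (val t - k.+1%:R) ^- 2.

Lemma uhp_nat_lower t : exists2 c : R, 0 < c & forall k : nat,
  c * k.+1%:R ^+ 2 <= normc (val t + k.+1%:R) ^+ 2 /\
  c * k.+1%:R ^+ 2 <= normc (val t - k.+1%:R) ^+ 2.
Proof.
have [c c0 hc] := lattice_lower t; exists c => // k; split.
  have := hc 1 k.+1%:R; rewrite mul1r -natC; apply: le_trans.
  by rewrite ler_wpM2l ?(ltW c0)// lerDr sqr_ge0.
have := hc 1 (- k.+1%:R); rewrite mul1r rmorphN /= -natC sqrrN; apply: le_trans.
by rewrite ler_wpM2l ?(ltW c0)// lerDr sqr_ge0.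
Qed.

Lemma pair2_le t : exists2 K : R, 0 <= K & forall k, normc (pair2 t k) <= K * k.+1%:R ^- 2.
Proof.
have [c c0 hc] := uhp_nat_lower t.
exists (2 / c) => [|k]; first by rewrite divr_ge0// ltW.
have [h1 h2] := hc k.
have K0 : 0 < k.+1%:R ^+ 2 :> R by rewrite exprn_gt0.
apply: le_trans (le_normcD _ _) _; rewrite !normcV !normcX.
have inv (x : R) : c * k.+1%:R ^+ 2 <= x -> x^-1 <= c^-1 * k.+1%:R ^- 2.
  move=> hx; rewrite -invfM lef_pV2 ?posrE ?mulr_gt0//.
  by apply: lt_le_trans hx; rewrite mulr_gt0.
apply: le_trans (lerD (inv _ h1) (inv _ h2)) _.
by rewrite le_eqVlt; apply/orP; left; apply/eqP; ring.
Qed.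

(** The cotangent is differentiated in two ways, as a q-series through [gcot_qexp] and as a series
    of partial fractions, and the results are compared. The constant coefficient left open in
    [gcot_qexp] disappears. *)
Lemma pair2_sum : exists2 h : uhp R -> C, has_qexp 0 h (fun n => n%:R) &
  forall t, csum (pair2 t) (c2pi R ^+ 2 * h t - val t ^- 2).
Proof.
have [a ha a1] := gcot_qexp.
have [g hg hD] := has_qexp_D ha.
have coefE : (fun n => (0 + n%:R)%:C * a n) = (fun n => n%:R).
  apply/funext => -[|n]; first by rewrite addr0 mul0r.
  by rewrite a1 mulr1 add0r natC.
rewrite coefE in hg; exists g => //.
have /choice[Psi hPsi] : forall t, exists l, csum (pair2 t) l.
  by move=> t; have [K K0 hK] := pair2_le t; apply: csum_abs hK (rsummableZ K0 (rsummable_inv2 R)).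
pose E t : C := - c2pi R * gcot (val t) - (val t)^-1.
have hE t : csum (pair1 t) (E t) by exact: cot_series (valP t).
have D1 : hasD E (fun t => - c2pi R * (c2pi R * g t) - (- (val t)^-1 ^+ 2)).
  by apply: hasDB; [exact: hasDZ|exact: hasD_inv].
(* Termwise derivative of the partial fractions: each remainder is at most a multiple of |h|^2 /
   k^2, because the imaginary part keeps the displaced denominator above y / 2. *)
suff D2 : hasD E (fun t => - Psi t).
  move=> t; suff -> : c2pi R ^+ 2 * g t - val t ^- 2 = Psi t by [].
  have := hasD_uniq t D1 D2; rewrite -exprVn => e.
  by rewrite -[Psi t]opprK -e; ring.
move=> t; have y0 := valP t; set y := complex.Im (val t) in y0.
have [c c0 hc] := uhp_nat_lower t.
pose K := 2 * (2 / y) / c.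
have K0 : 0 <= K by rewrite divr_ge0 ?(ltW c0)// mulr_ge0// divr_ge0// ltW.
have y20 : 0 < y / 2 by rewrite divr_gt0.
have [B hB] := rsummable_inv2 R.
apply: (@hasD_quad _ _ _ _ (K * B) (y / 2)) => // h t' et hd.
have hs := csumB (csumB (hE t') (hE t)) (csumMl h (csumN (hPsi t))).
rewrite [- Psi t * h]mulrC.
have -> : K * B * normc h ^+ 2 = K * normc h ^+ 2 * B by ring.
apply: (csum_normc_le (v := fun k => K * normc h ^+ 2 * k.+1%:R ^- 2) _ _ hs) => [k|n]; last first.
  by rewrite -mulr_sumr ler_wpM2l// mulr_ge0// exprn_ge0// normc_ge0.
have key (n : C) : complex.Im n = 0 -> c * k.+1%:R ^+ 2 <= normc (val t + n) ^+ 2 ->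
   normc ((val t' + n)^-1 - (val t + n)^-1 + h * (val t + n) ^- 2) <=
   (2 / y) / c * normc h ^+ 2 * k.+1%:R ^- 2.
  move=> n0 hn.
  have i1 : complex.Im (val t + n) = y by rewrite /y; case: (val t) n n0 {hn} => p q [r s] /= ->; rewrite addr0.
  have i2 : y / 2 <= complex.Im (val t' + n).
    have -> : val t' + n = (val t + n) + h by rewrite et; ring.
    have := ge_Im_normc h; rewrite ler_norml => /andP[hh _].
    have -> : complex.Im (val t + n + h) = y + complex.Im h by rewrite -i1; case: (val t + n) (h) => ? ? [].
    lra.
  have nz1 : val t + n != 0 by apply/eqP => e; move: i1; rewrite e /= => e'; move: y0; rewrite -e' ltxx.
  have nz2 : val t' + n != 0 by apply/eqP => e; move: i2; rewrite e /= => e'; move: y20; lra.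
  have l2 : y / 2 <= normc (val t' + n) by apply: le_trans i2 (le_trans (ler_norm _) (ge_Im_normc _)).
  have -> : (val t' + n)^-1 - (val t + n)^-1 + h * (val t + n) ^- 2 =
      h ^+ 2 * ((val t + n) ^+ 2 * (val t' + n))^-1.
    have e1 : val t' + n = (val t + n) + h by rewrite et; ring.
    move: nz2; rewrite e1; move: (val t + n) nz1 => v v0 v1.
    by field; rewrite v0 v1.
  rewrite normcM normcV [normc (_ ^+ 2 * _)]normcM !normcX mulrC.
  have -> : 2 / y / c * normc h ^+ 2 * k.+1%:R ^- 2 = (c * k.+1%:R ^+ 2 * (y / 2))^-1 * normc h ^+ 2.
    have k0 : k.+1%:R != 0 :> R by rewrite pnatr_eq0.
    by move: (k.+1%:R) k0 => u u0; field; rewrite u0 !gt_eqF.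
  rewrite ler_wpM2r ?exprn_ge0 ?normc_ge0//.
  have ck : 0 < c * k.+1%:R ^+ 2 by rewrite mulr_gt0// exprn_gt0.
  have p : c * k.+1%:R ^+ 2 * (y / 2) <= normc (val t + n) ^+ 2 * normc (val t' + n).
    by rewrite ler_pM// ltW.
  have pp : 0 < c * k.+1%:R ^+ 2 * (y / 2) by rewrite mulr_gt0.
  by rewrite lef_pV2 ?posrE// (lt_le_trans pp).
have [h1 h2] := hc k.
have k1 := key k.+1%:R; have k2 := key (- k.+1%:R).
rewrite natC /= in k1 k2 h1 h2 *.
have {}k1 := k1 erefl h1; have {}k2 := k2 (oppr0 _) h2.
have -> : pair1 t' k - pair1 t k - h * - pair2 t k =
 ((val t' + (k.+1%:R)%:C)^-1 - (val t + (k.+1%:R)%:C)^-1 + h * (val t + (k.+1%:R)%:C) ^- 2) +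
 ((val t' - (k.+1%:R)%:C)^-1 - (val t - (k.+1%:R)%:C)^-1 + h * (val t - (k.+1%:R)%:C) ^- 2).
  by rewrite /pair1 /pair2 natC; ring.
apply: le_trans (le_normcD _ _) _; apply: le_trans (lerD k1 k2) _.
rewrite le_eqVlt; apply/orP; left; apply/eqP; rewrite /K; ring.
Qed.

End Lipschitz.

(** * The Eisenstein series of weight two and its law under S *)

Section EisensteinSeries.
Variable R : realType.
Local Notation C := R[i].
Implicit Types (z w : C) (t : uhp R).

Local Notation S := (@SL2Z_act R SL2Z_S).

Lemma clim_sub (u : nat -> C) (l : C) (phi : nat -> nat) : clim u l ->
  phi @ \oo --> \oo -> clim (u \o phi) l.
Proof.
move=> hu hphi; exact: (cvg_comp phi (fun n => normc (u n - l)) hphi hu).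
Qed.

(** Rewrites a series in q^(m+1) as a series in q; [phi N] counts the multiples of m + 1 below N. *)
Lemma csum_multiples (f : nat -> C) (l : C) (m : nat) : csum f l ->
  csum (fun j => if (m.+1 %| j)%N then f (j %/ m.+1)%N else 0) l.
Proof.
move=> hf; pose phi N := ((N + m) %/ m.+1)%N.
have E N : \sum_(0 <= j < N) (if (m.+1 %| j)%N then f (j %/ m.+1)%N else 0) =
    \sum_(0 <= i < phi N) f i.
  elim: N => [|N IH].
    by rewrite /phi add0n divn_small// !big_nil.
  rewrite big_nat_recr//= IH.
  have [/dvdnP[k ->]|ndiv] := boolP (m.+1 %| N)%N.
    have -> : phi (k * m.+1)%N = k by rewrite /phi divnMDl// divn_small// addn0.
    have -> : phi (k * m.+1).+1 = k.+1.
      by rewrite /phi addSnnS -mulSnr mulnK.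
    by rewrite mulnK// big_nat_recr.
  rewrite addr0; congr (\sum_(0 <= i < _) _).
  rewrite /phi (divn_eq N m.+1); set k := (N %/ m.+1)%N; set r := (N %% m.+1)%N.
  have r0 : (0 < r)%N by rewrite lt0n.
  have rm : (r < m.+1)%N by rewrite ltn_mod.
  have e1 : (k * m.+1 + r + m = k.+1 * m.+1 + r.-1)%N by nia.
  have e2 : ((k * m.+1 + r).+1 + m = k.+1 * m.+1 + r)%N by nia.
  rewrite e1 e2 !divnMDl// !divn_small//; lia.
apply: (@clim_eq _ ((fun N => \sum_(0 <= i < N) f i) \o phi)) => [N|]; first by rewrite E.
apply: clim_sub hf _.
move=> A [K _ hK]; exists (K * m.+1)%N => // N /= hN; apply: hK => /=.
by rewrite /phi leq_divRL// (leq_trans hN)// leq_addr.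
Qed.

Lemma uhp_scale_im t (r : R) : 0 < r -> 0 < complex.Im (r%:C * val t).
Proof. by move=> r0; rewrite ImZ mulr_gt0//; exact: (valP t). Qed.

Lemma uhp_scale t (r : R) : 0 < r -> {t' : uhp R | val t' = r%:C * val t}.
Proof.
by move=> r0; exists (exist (fun z : C => is_true (0 < complex.Im z)) _ (uhp_scale_im t r0)).
Qed.

Definition nscale (m : nat) t : uhp R := sval (uhp_scale t (ltr0Sn R m)).

Lemma val_nscale m t : val (nscale m t) = m.+1%:R * val t.
Proof. by rewrite /nscale; case: uhp_scale => t' /= ->; rewrite natC. Qed.

(** The sum of divisors, each written as the codivisor of m + 1, which is how it arises in column n
    of the array in [lambert]; its value at 0 is 0. *)
Definition sigma (n : nat) : C :=
  \sum_(0 <= m < n) if (m.+1 %| n)%N then (n %/ m.+1)%N%:R else 0.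

(** The exchange of summations is dominated because m <= j on the support: half of the decay of
    |q|^j is traded for decay in m, the other half pays for the coefficient. *)
Lemma lambert (h : uhp R -> C) : has_qexp 0 h (fun n => n%:R) ->
  exists2 H, has_qexp 0 H sigma & forall t, csum (fun m => h (nscale m t)) (H t).
Proof.
move=> hh.
have main t : exists S, csum (fun m => h (nscale m t)) S /\
    csum (fun n => sigma n * e2pi ((0 + n%:R)%:C * val t)) S.
  pose q := e2pi (val t).
  pose s := pi * complex.Im (val t); have s0 : 0 < s := piIm_gt0 t.
  pose r m j : C := if (m.+1 %| j)%N then (j %/ m.+1)%N%:R * q ^+ j else 0.
  have qE j : q ^+ j = e2pi ((0 + j%:R)%:C * val t) by rewrite /q e2piX add0r natC.
  apply: (@exchange_csum _ r (fun m => expR (- (s * m%:R))) (fun j => (1 + j%:R) ^+ 1 * expR (- (s * j%:R)))).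
  - by move=> m; exact: expR_ge0.
  - by move=> n; rewrite mulr_ge0 ?expR_ge0// exprn_ge0// addr_ge0.
  - exact: rsummable_expR.
  - exact: rsummable_poly_expR.
  - move=> m j; have rhs0 : 0 <= expR (- (s * m%:R)) * ((1 + j%:R) ^+ 1 * expR (- (s * j%:R))).
      by rewrite mulr_ge0 ?expR_ge0// mulr_ge0 ?expR_ge0 ?exprn_ge0 ?addr_ge0.
    rewrite /r; case: ifP => [mj|_]; last by rewrite normc0.
    have [j0|j0] := posnP j.
      by rewrite [in leLHS]j0 div0n mul0r normc0.
    have lemj : (m.+1 <= j)%N by apply: dvdn_leq.
    rewrite normcM natC normcR ger0_norm// qE normc_e2piE.
    have -> : complex.Im ((0 + j%:R)%:C * val t) = j%:R * complex.Im (val t).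
      by rewrite add0r ImZ.
    rewrite [leRHS]mulrCA expr1; apply: ler_pM; rewrite ?expR_ge0//.
      apply: (@le_trans _ _ j%:R); last by rewrite lerDr.
      by rewrite ler_nat leq_div.
    rewrite -expRD ler_expR.
    have : s * m%:R <= s * j%:R by rewrite ler_wpM2l ?(ltW s0)// ler_nat ltnW.
    rewrite /s; set x := pi * _ * m%:R; move=> hx.
    have -> : pi *+ 2 * (j%:R * complex.Im (val t)) = pi * complex.Im (val t) * j%:R *+ 2 by ring.
    lra.
  - move=> m.
    have := csum_multiples m ((has_qexpP _ _ _).1 hh (nscale m t)).
    apply: csum_eq => j; rewrite /r; case: ifP => // mj; congr (_ * _).
    have E : (0 + (j %/ m.+1)%N%:R)%:C * m.+1%:R = (0 + j%:R)%:C :> C.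
      by rewrite !add0r -!natC -natrM divnK.
    by rewrite qE val_nscale mulrA E.
  - move=> n; have := @csum_fin _ (r^~ n) n.
    have -> : \sum_(0 <= i < n) r i n = sigma n * e2pi ((0 + n%:R)%:C * val t).
      rewrite /sigma mulr_suml; apply: eq_bigr => i _; rewrite /r -qE.
      by case: ifP => // _; rewrite mul0r.
    apply=> m nm; rewrite /r; case: ifP => // mn.
    have [->|n0] := posnP n; first by rewrite div0n mul0r.
    by have := dvdn_leq n0 mn; rewrite ltnNge nm.
have /choice[H hH] := main; exists H.
  by apply/has_qexpP => t; case: (hH t).
by move=> t; case: (hH t).
Qed.

Section DoubleSum.
Variable t : uhp R.
Let tau := val t.

Let X (m : nat) (s : R) : C := m.+1%:R * tau + s%:C.

Let X_im m s : complex.Im (X m s) = m.+1%:R * complex.Im tau.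
Proof. by rewrite /X natC; case: tau => a b /=; ring. Qed.

Let X_neq0 m s : X m s != 0.
Proof.
apply/eqP => h; have := X_im m s; rewrite h /= => /esym/eqP.
by rewrite mulf_eq0 pnatr_eq0 /= gt_eqF//; exact: (valP t).
Qed.

Let u (m : nat) (s : R) : C := (X m s)^-1 - (X m (- s))^-1.
Let c (m n : nat) : C := X m n.+1%:R ^- 2 + X m (- n.+1%:R) ^- 2.
(** A centred difference of 1/X at half-integers: it imitates [c m n] closely and telescopes in
    n. *)
Let d (m n : nat) : C := u m (n%:R + 1 / 2) - u m (n.+1%:R + 1 / 2).

(** Since 1/X(s - 1/2) - 1/X(s + 1/2) = 1/(X(s)^2 - 1/4), the difference of [c] and [d] is of order
    |X|^-4; a lower bound of |X|^2 by a multiple of M * N gives the product majorant that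
    [exchange_csum] needs. *)
Lemma double_le : exists2 K : R, 0 <= K & forall m n,
  normc (c m n - d m n) <= (K * m.+1%:R ^- 2) * n.+1%:R ^- 2.
Proof.
have [e e0 he] := lattice_lower t.
exists (1 / 2 / e ^+ 2) => [|m n]; first by rewrite divr_ge0 ?exprn_ge0 ?(ltW e0)// divr_ge0.
pose M : R := m.+1%:R; pose N : R := n.+1%:R.
have M0 : 0 < M by rewrite ltr0n.
have N1 : 1 <= N by rewrite ler1n.
have N0 : 0 < N by apply: lt_le_trans N1.
(* From (M - N/2)^2 >= 0. Asking only |s| >= N/2 includes the neighbours N - 1/2 and N + 1/2. *)
have low (s : R) : N / 2 <= `|s| -> e * (M * N) <= normc (X m s) ^+ 2.
  move=> hs; rewrite /X natC; apply: le_trans (he _ _).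
  rewrite ler_wpM2l ?(ltW e0)// -/M -(real_normK (num_real s)).
  have h1 : (N / 2) ^+ 2 <= `|s| ^+ 2 by rewrite lerXn2r ?nnegrE ?divr_ge0 ?(ltW N0).
  have := sqr_ge0 (M - N / 2).
  have -> : (M - N / 2) ^+ 2 = M ^+ 2 - M * N + (N / 2) ^+ 2 by field.
  lra.
have key (s : R) : `|s| = N ->
   normc (X m s ^- 2 - ((X m (s - 1 / 2))^-1 - (X m (s + 1 / 2))^-1)) <= 1 / 4 / e ^+ 2 * M ^- 2 * N ^- 2.
  move=> hs.
  have [s1 s2] : N / 2 <= `|s - 1 / 2| /\ N / 2 <= `|s + 1 / 2|.
    by split; rewrite -hs; [have := lerB_dist s (1 / 2)|have := lerB_dist s (- (1 / 2))];
      rewrite ?opprK ?normrN (@ger0_norm _ (1 / 2)) ?hs//; lra.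
  have s3 : N / 2 <= `|s| by rewrite hs; lra.
  have eX1 : X m (s - 1 / 2) = X m s - 1 / 2.
    by rewrite /X rmorphB /= rmorphM fmorphV rmorph1 rmorph_nat; ring.
  have eX2 : X m (s + 1 / 2) = X m s + 1 / 2.
    by rewrite /X rmorphD /= rmorphM fmorphV rmorph1 rmorph_nat; ring.
  have -> : X m s ^- 2 - ((X m (s - 1 / 2))^-1 - (X m (s + 1 / 2))^-1) =
      - (4^-1 / (X m s ^+ 2 * (X m (s - 1 / 2) * X m (s + 1 / 2)))).
    have := X_neq0 m (s - 1 / 2); have := X_neq0 m (s + 1 / 2); have := X_neq0 m s.
    set a := X m (s - 1 / 2); set b := X m (s + 1 / 2); move: (X m s) eX1 eX2 => x eX1 eX2 x0 b0 a0.
    have hb : b = a + 1 by rewrite [a]eX1 [b]eX2; field.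
    have e1 : a^-1 - b^-1 = (a * b)^-1 by rewrite hb in b0 *; field; rewrite a0 b0.
    have e2 (p : C) : p != 0 -> x ^- 2 - p^-1 = (p - x ^+ 2) / (x ^+ 2 * p).
      by move=> p0; field; rewrite x0 p0.
    rewrite e1 e2 ?mulf_neq0//; have -> : a * b - x ^+ 2 = - 4^-1; last by rewrite mulNr.
    by rewrite [a]eX1 [b]eX2; field.
  have n4 : normc (4^-1 : C) = 1 / 4.
    by rewrite normcV natC normcR ger0_norm// mul1r.
  rewrite normcN normcM n4 normcV [normc (_ * (_ * _))]normcM normcX [normc (_ * _)]normcM.
  have a1 := low _ s3; have a2 := low _ s1; have a3 := low _ s2.
  have MN : 0 < e * (M * N) by rewrite !mulr_gt0.
  have a4 : e * (M * N) <= normc (X m (s - 1 / 2)) * normc (X m (s + 1 / 2)).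
    rewrite -(@ler_pXn2r _ 2) ?nnegrE ?mulr_ge0 ?normc_ge0 ?(ltW e0) ?(ltW M0) ?(ltW N0)//.
    rewrite [leRHS]exprMn [leLHS]expr2; apply: ler_pM; rewrite ?(ltW MN)//.
  have -> : 1 / 4 / e ^+ 2 * M ^- 2 * N ^- 2 = 1 / 4 * ((e * (M * N)) * (e * (M * N)))^-1.
    by move: N0 M0; move: M N {low MN a1 a2 a3 a4 hs s1 s2 s3 N1} => M N N0 M0; field; rewrite !gt_eqF.
  have p : 0 < (e * (M * N)) * (e * (M * N)) by rewrite mulr_gt0.
  have q := ler_pM (ltW MN) (ltW MN) a1 a4.
  by rewrite ler_wpM2l// lef_pV2 ?posrE// (lt_le_trans p).
have -> : c m n - d m n =
  (X m N ^- 2 - ((X m (N - 1 / 2))^-1 - (X m (N + 1 / 2))^-1)) +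
  (X m (- N) ^- 2 - ((X m (- N - 1 / 2))^-1 - (X m (- N + 1 / 2))^-1)).
  rewrite /c /d /u -/N.
  have -> : n%:R + 1 / 2 = N - 1 / 2 :> R by rewrite /N -natr1; field.
  have -> : - (N - 1 / 2) = - N + 1 / 2 by ring.
  have -> : - (N + 1 / 2) = - N - 1 / 2 by ring.
  ring.
apply: le_trans (le_normcD _ _) _.
have k1 := key N (ger0_norm (ltW N0)).
have k2 : `|- N| = N by rewrite normrN ger0_norm// ltW.
apply: le_trans (lerD k1 (key _ k2)) _.
have E (x y z : R) : 1 / 4 / x * y * z + 1 / 4 / x * y * z = 1 / 2 / x * y * z.
  by have -> : 1 / 2 / x * y * z = (1 / 4 + 1 / 4) / x * y * z; [congr (_ / _ * _ * _); field|ring].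
by rewrite E lexx.
Qed.

Lemma half_gt0 (n : nat) : 0 < n%:R + 1 / 2 :> R.
Proof. by rewrite ltr_wpDl. Qed.

(** The sum over m of [u m s], read off the cotangent series at the point -s / tau. *)
Definition Usum (s : R) : C := tau^-1 * (c2pi R * gcot (s%:C * val (S t)) + (s%:C * val (S t))^-1).

Let tau0 : tau != 0 := uhp_neq0 t.

Lemma u_sum (s : R) : 0 < s -> csum (u^~ s) (Usum s).
Proof.
move=> s0; have [w hw] := uhp_scale (S t) s0.
have := csumMl (- tau^-1) (cot_series (valP w)).
rewrite hw => h; have -> : Usum s = - tau^-1 * (- c2pi R * gcot (s%:C * val (S t)) - (s%:C * val (S t))^-1).
  by rewrite /Usum; ring.
apply: csum_eq h => m; have [w1 w2] := uhp_nat_neq0 w m.+1.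
have x1 := X_neq0 m s; have x2 := X_neq0 m (- s).
rewrite hw val_actS -/tau /u /X in w1 w2 x1 x2 *.
rewrite rmorphN /= in x2 *.
move: (s%:C) (m.+1%:R : C) w1 w2 x1 x2 => r k w1 w2 x1 x2.
have -> : r * - tau^-1 + k = (k * tau - r) / tau by field.
have -> : r * - tau^-1 - k = - (k * tau + r) / tau by field.
by field; rewrite tau0 x1 x2.
Qed.

(** As s grows so does the imaginary part of -s / tau, and [gcot] tends to 1/2. This limit is the
    whole non-modular term of E2. *)
Lemma Usum_lim : clim (fun n => Usum (n%:R + 1 / 2)) (c2pi R / (2 * tau)).
Proof.
have y0 := valP (S t); set y := complex.Im (val (S t)) in y0.
have h1 : clim (fun n => (((n%:R + 1 / 2)%:C * val (S t)))^-1) 0.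
  apply: (@clim_harmonic _ _ _ (2 / normc (val (S t)))) => n.
  have nt : 0 < normc (val (S t)) by rewrite normc_gt0 uhp_neq0.
  rewrite subr0 normcV normcM normcR ger0_norm ?(ltW (half_gt0 n))//.
  have h : n.+1%:R / 2 <= n%:R + 1 / 2 :> R by rewrite -natr1; have := ler0n R n; lra.
  have -> : 2 / normc (val (S t)) / n.+1%:R = (n.+1%:R / 2 * normc (val (S t)))^-1.
    have : n.+1%:R != 0 :> R by rewrite pnatr_eq0.
    by move: (n.+1%:R) => k k0; field; rewrite k0 gt_eqF.
  have p : 0 < n.+1%:R / 2 * normc (val (S t)) by rewrite mulr_gt0// divr_gt0.
  have q : n.+1%:R / 2 * normc (val (S t)) <= (n%:R + 1 / 2) * normc (val (S t)).
    by rewrite ler_wpM2r// ltW.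
  by rewrite lef_pV2 ?posrE// (lt_le_trans p).
have h2 : clim (fun n => e2pi ((n%:R + 1 / 2)%:C * val (S t))) 0.
  pose s := pi *+ 2 * y; have s0 : 0 < s by rewrite mulr_gt0// mulrn_wgt0// pi_gt0.
  apply: (@clim_harmonic _ _ _ (2 / s)) => n.
  rewrite subr0 normc_e2piE ImZ -/y.
  have -> : pi *+ 2 * ((n%:R + 1 / 2) * y) = s * (n%:R + 1 / 2) by rewrite /s; ring.
  have h : n.+1%:R / 2 <= n%:R + 1 / 2 :> R by rewrite -natr1; have := ler0n R n; lra.
  rewrite expRN; have e1 := expR_ge1Dx (s * (n%:R + 1 / 2)).
  have -> : 2 / s / n.+1%:R = (n.+1%:R / 2 * s)^-1.
    have : n.+1%:R != 0 :> R by rewrite pnatr_eq0.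
    by move: (n.+1%:R) => k k0; field; rewrite k0 gt_eqF.
  have p : 0 < n.+1%:R / 2 * s by rewrite mulr_gt0// divr_gt0.
  have q : n.+1%:R / 2 * s <= expR (s * (n%:R + 1 / 2)).
    have : n.+1%:R / 2 * s <= (n%:R + 1 / 2) * s by rewrite ler_wpM2r// ltW.
    lra.
  by rewrite lef_pV2 ?posrE// (lt_le_trans p).
have h3 := climB (clim_cst 1) h2; rewrite subr0 in h3.
have h4 := climB (climV (oner_neq0 _) h3) (clim_cst (2^-1)).
have := climMl tau^-1 (climD (climMl (c2pi R) h4) h1).
have -> : tau^-1 * (c2pi R * (1^-1 - 2^-1) + 0) = c2pi R / (2 * tau).
  by field.
by [].
Qed.

Lemma d_row (m : nat) : csum (d m) (u m (1 / 2)).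
Proof.
have E N : \sum_(0 <= n < N) d m n = u m (1 / 2) - u m (N%:R + 1 / 2).
  elim: N => [|N IH]; first by rewrite big_nil add0r subrr.
  by rewrite big_nat_recr//= IH /d; ring.
rewrite /csum; apply: clim_eq (fun N => esym (E N)) _.
rewrite -[X in clim _ X]subr0; apply: climB; first exact: clim_cst.
have [e e0 he] := lattice_lower t.
apply: (@clim_harmonic _ _ _ (4 / e)) => n.
set s := n%:R + 1 / 2; have s0 : 0 < s := half_gt0 n.
have hs : n.+1%:R / 2 <= s by rewrite /s -natr1; have := ler0n R n; lra.
rewrite subr0 /u.
have -> : (X m s)^-1 - (X m (- s))^-1 = - (2 * s%:C / (X m s * X m (- s))).
  have := X_neq0 m (- s); have := X_neq0 m s.
  rewrite /X rmorphN /=; move: (s%:C) (m.+1%:R * tau) => r k x1 x2.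
  by field; rewrite x1 x2.
have low (r : R) : r ^+ 2 = s ^+ 2 -> e * s ^+ 2 <= normc (X m r) ^+ 2.
  move=> hr; rewrite /X natC; apply: le_trans (he _ _).
  by rewrite hr ler_wpM2l ?(ltW e0)// lerDr sqr_ge0.
have a1 := low _ (erefl (s ^+ 2)); have a2 := low _ (sqrrN s).
have es : 0 < e * s ^+ 2 by rewrite mulr_gt0// exprn_gt0.
have a4 : e * s ^+ 2 <= normc (X m s) * normc (X m (- s)).
  rewrite -(@ler_pXn2r _ 2) ?nnegrE ?(ltW es)//; last by rewrite mulr_ge0 ?normc_ge0.
  rewrite [leRHS]exprMn [leLHS]expr2; apply: ler_pM; rewrite ?(ltW es)//.
have n2 : normc (2 : C) = 2 by rewrite natC normcR ger0_norm.
rewrite normcN normcM normcV [normc (2 * _)]normcM [normc (X _ _ * _)]normcM n2 normcR gtr0_norm//.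
apply: (@le_trans _ _ (2 * s / (e * s ^+ 2))).
  rewrite ler_wpM2l ?mulr_ge0 ?(ltW s0)//.
  by rewrite lef_pV2 ?posrE// (lt_le_trans es).
have -> : 2 * s / (e * s ^+ 2) = 2 / e * s^-1 by field; rewrite !gt_eqF.
have -> : 4 / e / n.+1%:R = 2 / e * (n.+1%:R / 2)^-1.
  have : n.+1%:R != 0 :> R by rewrite pnatr_eq0.
  by move: (n.+1%:R) => k k0; field; rewrite k0 gt_eqF.
rewrite ler_wpM2l ?divr_ge0 ?(ltW e0)//.
have p : 0 < n.+1%:R / 2 :> R by rewrite divr_gt0.
by rewrite lef_pV2 ?posrE// (lt_le_trans p).
Qed.

(** Rows and columns of [c - d] have the same total. The columns of [c] are its rows at -1/tau up to
    a factor tau^-2; the row sums of [d] add up to [Usum (1 / 2)], its column sums to the same minus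
    the limit of [Usum]. *)
Lemma double_sum (h H : uhp R -> C) :
  (forall t, csum (pair2 t) (c2pi R ^+ 2 * h t - val t ^- 2)) ->
  (forall t, csum (fun m => h (nscale m t)) (H t)) ->
  forall zeta : C, csum (fun k => k.+1%:R ^- 2) zeta ->
  c2pi R ^+ 2 * H t - zeta / tau ^+ 2 =
  c2pi R ^+ 2 * H (S t) / tau ^+ 2 - zeta + c2pi R / (2 * tau).
Proof.
move=> hpair hH zeta hz.
have [K K0 hK] := double_le.
have St : val (S t) = - tau^-1 := val_actS t.
pose A m := c2pi R ^+ 2 * h (nscale m t) - tau ^- 2 * m.+1%:R ^- 2 - u m (1 / 2).
pose B n := tau ^- 2 * (c2pi R ^+ 2 * h (nscale n (S t))) - n.+1%:R ^- 2
   - (Usum (n%:R + 1 / 2) - Usum (n.+1%:R + 1 / 2)).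
have hA m : csum (fun n => c m n - d m n) (A m).
  apply: csumB (d_row m).
  have E : (m.+1%:R * tau) ^- 2 = tau ^- 2 * m.+1%:R ^- 2 by rewrite exprMn invfM mulrC.
  have := hpair (nscale m t); rewrite val_nscale -/tau E.
  by apply: csum_eq => n; rewrite /pair2 /c /X val_nscale rmorphN /= -natC.
have hB n : csum (fun m => c m n - d m n) (B n).
  apply: csumB; last first.
    by apply: csumB; apply: u_sum; exact: half_gt0.
  have E : tau ^- 2 * (c2pi R ^+ 2 * h (nscale n (S t))) - n.+1%:R ^- 2 =
     tau ^- 2 * (c2pi R ^+ 2 * h (nscale n (S t)) - val (nscale n (S t)) ^- 2).
    have n0 : n.+1%:R != 0 :> C by rewrite pnatr_eq0.
    rewrite val_nscale St; move: (n.+1%:R) n0 => k k0; field; by rewrite k0 tau0.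
  rewrite E; apply: csum_eq (csumMl (tau ^- 2) (hpair (nscale n (S t)))) => m.
  have x1 := X_neq0 m n.+1%:R; have x2 := X_neq0 m (- n.+1%:R).
  rewrite /pair2 /c /X val_nscale St.
  rewrite /X rmorphN /= -natC in x1 x2 *.
  move: (n.+1%:R : C) (m.+1%:R : C) x1 x2 => k l x1 x2.
  have -> : k * - tau^-1 + l = (l * tau - k) / tau by field.
  have -> : k * - tau^-1 - l = - (l * tau + k) / tau by field.
  by field; rewrite tau0 x1 x2.
have K1 (m : nat) : 0 <= K * m.+1%:R ^- 2 by rewrite mulr_ge0// invr_ge0 exprn_ge0.
have K2 (m : nat) : 0 <= m.+1%:R ^- 2 :> R by rewrite invr_ge0 exprn_ge0.
have [Q [QA QB]] := exchange_csum K1 K2 (rsummableZ K0 (rsummable_inv2 R))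
  (rsummable_inv2 R) hK hA hB.
have sA : csum A (c2pi R ^+ 2 * H t - tau ^- 2 * zeta - Usum (1 / 2)).
  apply: csumB (u_sum _); last by rewrite divr_gt0.
  by apply: csumB; apply: csumMl.
have tel : csum (fun n => Usum (n%:R + 1 / 2) - Usum (n.+1%:R + 1 / 2))
    (Usum (1 / 2) - c2pi R / (2 * tau)).
  have E N : \sum_(0 <= n < N) (Usum (n%:R + 1 / 2) - Usum (n.+1%:R + 1 / 2)) =
     Usum (1 / 2) - Usum (N%:R + 1 / 2).
    elim: N => [|N IH]; first by rewrite big_nil add0r subrr.
    by rewrite big_nat_recr//= IH; ring.
  apply: clim_eq (fun N => esym (E N)) _.
  exact: climB (clim_cst _) Usum_lim.
have sB : csum B (tau ^- 2 * (c2pi R ^+ 2 * H (S t)) - zeta - (Usum (1 / 2) - c2pi R / (2 * tau))).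
  apply: csumB tel; apply: csumB hz.
  by do 2!apply: csumMl.
have e1 := csum_uniq QA sA; have e2 := csum_uniq QB sB.
have := e1; rewrite e2 => /eqP; rewrite eq_sym => /eqP e3.
have -> : zeta / tau ^+ 2 = tau ^- 2 * zeta by rewrite mulrC.
have -> : c2pi R ^+ 2 * H t - tau ^- 2 * zeta =
  (c2pi R ^+ 2 * H t - tau ^- 2 * zeta - Usum (1 / 2)) + Usum (1 / 2) by rewrite subrK.
by rewrite e3; ring.
Qed.

End DoubleSum.

Lemma c2pi_neq0 : c2pi R != 0.
Proof. by rewrite -normc_eq0 normc_c2pi gt_eqF// mulrn_wgt0// pi_gt0. Qed.

Lemma inv2C (k : nat) : k.+1%:R ^- 2 = (k.+1%:R ^- 2 : R)%:C :> C.
Proof. by rewrite fmorphV rmorphXn rmorph_nat. Qed.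

Lemma c2pi_sqr : c2pi R ^+ 2 = - ((pi *+ 2) ^+ 2)%:C.
Proof.
rewrite /c2pi exprMn sqr_i mulrN1 rmorphXn. by [].
Qed.

(** [Z] is [zeta 2] divided by [pi^2 / 6]; the transformation law of [eta] will force
    [Z = 1]. *)
Lemma eisenstein2_pre : exists (Z : R) (E : uhp R -> C),
  [/\ 0 <= Z < 4, has_qexp 0 E (fun n => (if n is 0%N then Z%:C else 0) - 24 * sigma n)
    & forall t, E (S t) = val t ^+ 2 * E t + 12 * val t / c2pi R].
Proof.
have [h hh hpair] := pair2_sum R.
have [H hH hsum] := lambert hh.
have [z hz] : exists z : R, series (fun k => k.+1%:R ^- 2 : R) @ \oo --> z.
  apply/cvg_ex; apply: rsummable_cvg (rsummable_inv2 R) => n.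
  by rewrite invr_ge0 exprn_ge0.
have z0 : 0 <= z.
  rewrite -(cvg_lim _ hz)//; apply: limr_ge; first by apply/cvgP: hz.
  by apply: nearW => n; apply: sumr_ge0 => k _; rewrite invr_ge0 exprn_ge0.
have z2 : z <= 2.
  rewrite -(cvg_lim _ hz)//; apply: limr_le; first by apply/cvgP: hz.
  apply: nearW => n; exact: rsummable_inv2_le.
have hz' : csum (fun k => k.+1%:R ^- 2 : C) z%:C.
  apply: clim_ReIm => /=.
    apply: cvg_trans hz; apply: near_eq_cvg; apply: nearW => n.
    by rewrite Re_sum /series; apply: eq_bigr => k _; rewrite inv2C.
  have -> : (fun n => complex.Im (\sum_(0 <= i < n) i.+1%:R ^- 2 : C)) = (fun=> 0).
    by apply/funext => n; rewrite Im_sum big1// => k _; rewrite inv2C.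
  exact: cvg_cst.
(* From z <= 2 and pi >= 2 one gets Z <= 3. A bound below 4 is what later lets e^(2 pi i Z/4)
   determine Z. *)
pose Z := 24 * z / (pi *+ 2) ^+ 2.
have pp : 2 <= pi :> R := pi_ge2 R.
have p4 : 16 <= (pi *+ 2) ^+ 2 :> R.
  have -> : 16 = 4 ^+ 2 :> R by ring.
  by rewrite lerXn2r ?nnegrE//; lra.
exists Z; exists (fun t => Z%:C - 24 * H t); split.
- apply/andP; split; first by apply: divr_ge0; [exact: mulr_ge0|exact: sqr_ge0].
  rewrite ltr_pdivrMr; last by apply: lt_le_trans p4.
  lra.
- have hc : has_qexp 0 (fun=> Z%:C) (fun n => if n is 0%N then Z%:C else 0 : C).
    exact: has_qexp_cst.
  have := has_qexpD hc (has_qexpZ (c := - 24) hH).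
  have -> : (fun t => Z%:C + - 24 * H t) = (fun t => Z%:C - 24 * H t).
    by apply/funext => t; rewrite mulNr.
  by under [X in has_qexp _ _ X]eq_fun => n do rewrite mulNr.
move=> t; have t0 := uhp_neq0 t.
have := double_sum t hpair hsum hz'.
have -> : z%:C = - c2pi R ^+ 2 * (Z%:C / 24).
  rewrite c2pi_sqr opprK natC -fmorphV -!rmorphM /Z; congr (_%:C).
  have q0 : 0 < (pi *+ 2) ^+ 2 :> R by apply: lt_le_trans p4.
  by move: ((pi *+ 2) ^+ 2) q0 => q q0; field; rewrite gt_eqF.
move: (c2pi R) c2pi_neq0 (val t) t0 => p p0 tau tau0 e.
have e' : p ^+ 2 * H (S t) / tau ^+ 2 = p ^+ 2 * H t - - p ^+ 2 * (Z%:C / 24) / tau ^+ 2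
  + - p ^+ 2 * (Z%:C / 24) - p / (2 * tau) by rewrite e; ring.
have E : H (S t) = (p ^+ 2 * H (S t) / tau ^+ 2) * tau ^+ 2 / p ^+ 2.
  by field; rewrite p0 tau0.
by rewrite e' in E; rewrite E; field; rewrite p0 tau0.
Qed.

End EisensteinSeries.

(** * Exponentials of q-series *)

Section ExponentialQSeries.
Variable R : realType.
Local Notation C := R[i].
Implicit Types (f g : uhp R -> C) (t : uhp R).

Lemma cexp0 : cexp (0 : C) = 1.
Proof. by rewrite /cexp /= expR0 cos0 sin0 mul1r. Qed.

Lemma hasD_cexp f f' : hasD f f' ->
  hasD (fun t => cexp (f t)) (fun t => f' t * cexp (f t)).
Proof.
move=> hf t; apply: is_derive_littleo => e e0.
pose M := normc (cexp (f t)) + 1.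
have M0 : 0 < M by rewrite ltr_wpDl ?normc_ge0.
pose e1 := e / (2 * M).
have e10 : 0 < e1 by rewrite divr_gt0// mulr_gt0.
have [d d0 hd] := is_derive_lin (hf t) e10.
pose N := normc (f' t) + e1.
have N0 : 0 < N by rewrite ltr_wpDl ?normc_ge0.
pose Q := 4 * N ^+ 2 * expR N * M * 2.
have Q0 : 0 < Q by rewrite !mulr_gt0 ?exprn_gt0 ?expR_gt0.
exists (Num.min (Num.min (complex.Im (val t)) d) (Num.min 1 (e / Q))).
  by rewrite !lt_min d0 ltr01 divr_gt0// !andbT; exact: (valP t).
move=> h; rewrite !lt_min => /andP[/andP[h1 h2] /andP[h3 h4]].
have [t' et'] := uhp_shift h1; rewrite -et' !extend_val.
have := hd h h2; rewrite -et' !extend_val => H.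
set D := f t' - f t in H *.
have n0 := normc_ge0 h.
have nD : normc D <= N * normc h.
  have -> : D = (D - f' t * h) + f' t * h by rewrite subrK.
  apply: le_trans (le_normcD _ _) _; rewrite normcM /N; lra.
have -> : cexp (f t') - cexp (f t) - f' t * cexp (f t) * h =
   cexp (f t) * ((cexp D - 1 - D) + (D - f' t * h)).
  have -> : cexp (f t') = cexp (f t) * cexp D by rewrite -cexpD /D addrC subrK.
  by ring.
rewrite normcM.
have q : normc (cexp D - 1 - D) <= 4 * N ^+ 2 * expR N * normc h ^+ 2.
  apply: le_trans (cexp_quad _) _.
  have -> : 4 * N ^+ 2 * expR N * normc h ^+ 2 = 4 * (N * normc h) ^+ 2 * expR N by ring.
  have q1 : 4 * normc D ^+ 2 <= 4 * (N * normc h) ^+ 2.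
    apply: ler_wpM2l => //; rewrite lerXn2r ?nnegrE ?normc_ge0//.
    by rewrite mulr_ge0// ltW.
  have q2 : expR (normc D) <= expR N.
    rewrite ler_expR; apply: le_trans nD _; rewrite ger_pMr//; exact: ltW.
  by apply: ler_pM => //; rewrite mulr_ge0// sqr_ge0.
apply: (@le_trans _ _ (M * (4 * N ^+ 2 * expR N * normc h ^+ 2 + e1 * normc h))).
  apply: ler_pM; rewrite ?normc_ge0//; first by rewrite /M lerDl.
  by apply: le_trans (le_normcD _ _) _; apply: lerD.
have h5 : normc h * Q <= e by rewrite -ler_pdivlMr// ltW.
have -> : M * (4 * N ^+ 2 * expR N * normc h ^+ 2 + e1 * normc h) =
   (normc h * Q / 2 + M * e1) * normc h by rewrite /Q; field.
have -> : M * e1 = e / 2 by rewrite /e1; field; rewrite gt_eqF.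
rewrite ler_wpM2r//; lra.
Qed.

(** Once n + 1 exceeds D, the recurrence combines earlier values with total weight below n + 1, so
    no value can exceed a bound for the earlier ones. *)
Lemma recurrence_bounded (b k : nat -> R) (D : R) :
  (forall n, 0 <= b n) -> (forall n, 0 <= k n) ->
  (forall n, \sum_(0 <= i < n) k i <= D) ->
  (forall n, n.+1%:R * b n.+1 <= \sum_(0 <= i < n.+1) k i * b (n - i)%N) ->
  exists K, forall n, b n <= K.
Proof.
move=> b0 k0 hD hb.
pose N := Num.bound D; pose K := \sum_(0 <= i < N.+1) b i.
have D0 : 0 <= D by apply: le_trans (hD 0%N); rewrite big_nil.
have ND : D < N%:R by exact: archi_boundP.
exists K => n; elim/ltn_ind: n => n IH.
have [nN|nN] := leqP n N.
  rewrite /K (big_cat_nat (n := n))//=; last exact: leqW.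
  rewrite [X in _ <= _ + X]big_ltn ?ltnS// addrCA lerDl addr_ge0//; exact: sumr_ge0.
case: n IH nN => // n IH nN.
have n1 : 0 < n.+1%:R :> R by rewrite ltr0n.
rewrite -(ler_pM2l n1); apply: le_trans (hb n) _.
have K0 : 0 <= K by exact: sumr_ge0.
apply: (@le_trans _ _ (D * K)); last first.
  rewrite ler_wpM2r//; apply: ltW; apply: lt_le_trans ND _; rewrite ler_nat; exact: ltnW.
apply: (@le_trans _ _ (\sum_(0 <= i < n.+1) k i * K)).
  rewrite big_nat_cond [leRHS]big_nat_cond; apply: ler_sum => i; rewrite andbT => /andP[_ iN].
  by rewrite ler_wpM2l// IH// ltnS leq_subr.
by rewrite -mulr_suml ler_wpM2r.
Qed.

(** Power series solution of q dP/dq = g P, where [k] holds the coefficients of g; growing lists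
    carry the recursion, which looks back at all earlier values. *)
Lemma exp_coefs (k : nat -> C) : exists p : nat -> C, p 0%N = 1 /\
  forall n, n.+1%:R * p n.+1 = \sum_(0 <= i < n.+1) k i.+1 * p (n - i)%N.
Proof.
pose P := fix P n : seq C := if n is n'.+1 then
  rcons (P n') (n'.+1%:R^-1 * \sum_(0 <= i < n'.+1) k i.+1 * (P n')`_(n' - i)) else [:: 1].
have sP n : size (P n) = n.+1 by elim: n => //= n IH; rewrite size_rcons IH.
have nP n m : (m <= n)%N -> (P n)`_m = (P m)`_m.
  elim: n => [|n IH]; first by rewrite leqn0 => /eqP ->.
  rewrite leq_eqVlt => /orP[/eqP -> //|mn].
  by rewrite /= nth_rcons sP mn IH.
exists (fun n => (P n)`_n); split => // n.
rewrite /= nth_rcons sP ltnn eqxx mulrA divff ?pnatr_eq0// mul1r.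
by apply: eq_bigr => i _; rewrite nP// leq_subr.
Qed.

(** The exponential is expanded through its differential equation: the formal solution P converges,
    and P * cexp (- f) has derivative zero. The constant c is settled in [exp_qexp]. *)
Lemma exp_ode f (l : nat -> C) : has_qexp 0 f l -> l 0%N = 0 ->
  exists P p c, [/\ has_qexp 0 P p, p 0%N = 1 & forall t, P t = c * cexp (f t)].
Proof.
move=> hf l0; have [g hg hD] := has_qexp_D hf.
set k := (fun n : nat => _) in hg.
have [p [p0 hp]] := exp_coefs k.
have [P hP] : exists P, has_qexp 0 P p.
  apply: qconv_has_qexp => t.
  have [A A0 hA] := has_qexp_normc t hg.
  pose s := pi * complex.Im (val t); have s0 : 0 < s := piIm_gt0 t.
  have eE (n : nat) : normc (e2pi ((0 + n%:R)%:C * val t)) = expR (- (2 * s * n%:R)).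
    by rewrite normc_e2piE add0r ImZ /s; congr expR; ring.
  (* The rate 3/2 lies strictly between 1, beyond which [hA] makes the weighted coefficients [k]
     summable, and 2, the rate of |q|^n, so that bounded weighted coefficients [p] give a convergent
     series. *)
  pose w (n : nat) := expR (- (3 / 2 * s * n%:R)).
  have w0 n : 0 <= w n by exact: expR_ge0.
  have wD m n : w (m + n)%N = w m * w n by rewrite /w natrD -expRD; congr expR; ring.
  pose b n := normc (p n) * w n; pose kk n := normc (k n.+1) * w n.+1.
  have s20 : 0 < s / 2 by rewrite divr_gt0.
  have [B hB] := rsummable_expR s20.
  have hkk n : kk n <= A * expR (- (s / 2 * n%:R)).
    have := hA n.+1; rewrite normcM eE => h.
    have -> : kk n = normc (k n.+1) * expR (- (2 * s * n.+1%:R)) * expR (s / 2 * n.+1%:R).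
      by rewrite /kk /w -[RHS]mulrA -expRD; congr (_ * expR _); lra.
    apply: le_trans (ler_wpM2r (expR_ge0 _) h) _.
    rewrite -[leLHS]mulrA -expRD ler_wpM2l// ler_expR -/s -natr1; lra.
  have [K hK] : exists K, forall n, b n <= K.
    apply: (@recurrence_bounded b kk (A * B)) => [n|n|n|n].
    - by rewrite mulr_ge0 ?normc_ge0.
    - by rewrite mulr_ge0 ?normc_ge0.
    - apply: (@le_trans _ _ (\sum_(0 <= i < n) A * expR (- (s / 2 * i%:R)))).
        exact: ler_sum.
      by rewrite -mulr_sumr ler_wpM2l.
    - have -> : n.+1%:R * b n.+1 = normc (n.+1%:R * p n.+1) * w n.+1.
        by rewrite normcM natC normcR ger0_norm// mulrA.
      rewrite hp; apply: le_trans (ler_wpM2r (w0 _) (normc_sum _ _ _)) _.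
      rewrite mulr_suml big_nat_cond [leRHS]big_nat_cond; apply: ler_sum => i.
      rewrite andbT => /andP[_ iN].
      have -> : w n.+1 = w i.+1 * w (n - i)%N by rewrite -wD; congr w; lia.
      by rewrite normcM /kk /b le_eqVlt; apply/orP; left; apply/eqP; ring.
  apply: (@csum_abs _ _ (fun n => K * expR (- (s / 2 * n%:R)))).
    move=> n; rewrite normcM eE.
    have -> : expR (- (2 * s * n%:R)) = w n * expR (- (s / 2 * n%:R)).
      by rewrite /w -expRD; congr expR; lra.
    by rewrite mulrA ler_wpM2r ?expR_ge0//; exact: hK.
  apply: rsummableZ; last exact: rsummable_expR.
  by apply: le_trans (hK 0%N); rewrite mulr_ge0 ?normc_ge0.
have [P1 hP1 DP] := has_qexp_D hP.
have P1E : P1 = (fun t => g t * P t).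
  apply: has_qexp_uniqf hP1 _; have := has_qexpM hg hP.
  congr (has_qexp _ _ _); apply/funext => -[|n].
    by rewrite big_nat1 /k !addr0 !mul0r.
  have -> : (0 + n.+1%:R)%:C = n.+1%:R :> C by rewrite add0r natC.
  by rewrite hp big_nat_recl//= {1}/k l0 mulr0 mul0r add0r.
have De := hasD_cexp (hasDZ (-1) hD).
have cst t1 t2 : P t1 * cexp (-1 * f t1) = P t2 * cexp (-1 * f t2).
  apply: (@hasD0_cst _ (fun t => P t * cexp (-1 * f t))).
  apply: hasD_eq (hasDM DP De) _ => t; rewrite P1E; ring.
pose t0 : uhp R := sval (uhp_scale (SL2Z_act SL2Z_S (sval (uhp_scale (exist (fun z : C => is_true (0 < complex.Im z)) 'i ltr01) ltr01))) ltr01).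
exists P; exists p; exists (P t0 * cexp (-1 * f t0)); split => // t.
rewrite (cst t0 t) -mulrA -cexpD mulN1r addNr cexp0 mulr1.
by [].
Qed.

(** Applying [exp_ode] to f and to -f gives two series with product the constant [c * d], whose
    leading coefficient is 1. Hence c is invertible and can be divided out. *)
Lemma exp_qexp f (l : nat -> C) : has_qexp 0 f l -> l 0%N = 0 ->
  exists2 p, has_qexp 0 (fun t => cexp (f t)) p & p 0%N != 0.
Proof.
move=> hf l0; have [P [p [c [hP p0 PE]]]] := exp_ode hf l0.
have l0' : -1 * l 0%N = 0 by rewrite l0 mulr0.
have [Q [q [d [hQ q0 QE]]]] := exp_ode (has_qexpZ (c := -1) hf) l0'.
have PQ t : P t * Q t = c * d.
  by rewrite PE QE mulrACA -cexpD mulN1r subrr cexp0 mulr1.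
have cd : c * d = 1.
  have h1 := has_qexpM hP hQ; have h2 := @has_qexp_cst R (c * d).
  have E : (fun t => P t * Q t) = (fun=> c * d) by apply/funext => t; rewrite PQ.
  rewrite E in h1; have := has_qexp_lead h1 h2.
  by rewrite /= big_nat1 p0 q0 mulr1 => ->.
have c0 : c != 0 by apply: contra_eq_neq cd => ->; rewrite mul0r eq_sym oner_eq0.
exists (fun n => c^-1 * p n); last by rewrite p0 mulr1 invr_eq0.
have -> : (fun t => cexp (f t)) = (fun t => c^-1 * P t).
  by apply/funext => t; rewrite PE mulrA mulVf// mul1r.
exact: (has_qexpZ (c := c^-1) hP).
Qed.

End ExponentialQSeries.

(** * Even powers of Dedekind's eta *)

Section Eta.
Variable R : realType.
Local Notation C := R[i].
Implicit Types (f g : uhp R -> C) (t : uhp R).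

Local Notation S := (@SL2Z_act R SL2Z_S).
Local Notation T := (@SL2Z_act R SL2Z_T).

Lemma fixed_i : exists2 t : uhp R, val t = 'i & S t = t.
Proof.
exists (exist (fun z : C => is_true (0 < complex.Im z)) 'i ltr01) => //.
by apply/val_inj; rewrite val_actS /=; apply/eqP; rewrite eq_complex /=; apply/andP; split; apply/eqP; field.
Qed.

Lemma fixed_rho : exists2 t : uhp R, (val t + 1) ^+ 3 = -1 & S (T t) = t.
Proof.
have s3 : 0 < Num.sqrt (3 : R) / 2 by rewrite divr_gt0// sqrtr_gt0.
pose z : C := (- (1 / 2)) +i* (Num.sqrt 3 / 2).
have hz : 0 < complex.Im z by [].
have z2 : z ^+ 2 + z + 1 = 0.
  have q : Num.sqrt (3 : R) ^+ 2 = 3 by rewrite sqr_sqrtr.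
  apply/eqP; rewrite expr2 eq_complex /=; apply/andP; split; apply/eqP; last by field.
  move: q; rewrite expr2; set s := Num.sqrt 3; nra.
have z1 : z + 1 != 0.
  by apply/eqP => h; move: z2; rewrite -addrA h addr0 => /eqP; rewrite sqrf_eq0 => /eqP e; move: hz; rewrite e ltxx.
exists (exist (fun z : C => is_true (0 < complex.Im z)) z hz) => /=.
  have -> : (z + 1) ^+ 3 = (z ^+ 2 + z + 1) * (z + 2) - 1 by ring.
  by rewrite z2 mul0r sub0r.
apply/val_inj; rewrite val_actS val_actT /=.
apply: (mulIf z1); rewrite mulNr mulVf//.
have -> : z * (z + 1) = (z ^+ 2 + z + 1) - 1 by ring.
by rewrite z2 sub0r.
Qed.

Lemma e2pi_quarter : e2pi ((1 / 4 : R)%:C) = 'i :> C.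
Proof.
rewrite e2pi_real; have -> : pi *+ 2 * (1 / 4) = pi / 2 :> R by field.
by rewrite cos_pihalf sin_pihalf.
Qed.

Lemma hasD_exprz (k : int) : hasD (fun t => val t ^ k) (fun t => k%:~R * val t ^ (k - 1)).
Proof.
have pos (n : nat) : hasD (fun t => val t ^+ n) (fun t => n%:R * val t ^+ n.-1).
  elim: n => [|n IH].
    by apply: hasD_eq (hasD_cst 1) _ => t; rewrite mul0r.
  have E : (fun t => val t ^+ n.+1) = (fun t => val t * val t ^+ n).
    by apply/funext => t; rewrite exprS.
  rewrite E; apply: hasD_eq (hasDM (@hasD_id R) IH) _ => t.
  case: n {IH E} => [|n] /=; first by rewrite !expr0 mul0r mulr0 addr0 mul1r.
  by rewrite mul1r mulrCA -exprS -(@natr1 _ n.+1) mulrDl mul1r addrC.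
have neg (n : nat) : hasD (fun t => (val t)^-1 ^+ n) (fun t => - n%:R * (val t)^-1 ^+ n.+1).
  elim: n => [|n IH].
    by apply: hasD_eq (hasD_cst 1) _ => t; rewrite oppr0 mul0r.
  have E : (fun t => (val t)^-1 ^+ n.+1) = (fun t => (val t)^-1 * (val t)^-1 ^+ n).
    by apply/funext => t; rewrite exprS.
  rewrite E; apply: hasD_eq (hasDM (@hasD_inv R) IH) _ => t.
  by rewrite -(@natr1 _ n) !exprS; ring.
case: k => n.
  apply: hasD_eq (pos n) _ => t; case: n => [|n]; first by rewrite !mul0r.
  by rewrite intS addrAC subrr add0r.
have E : (fun t => val t ^ Negz n) = (fun t => (val t)^-1 ^+ n.+1).
  by apply/funext => t; rewrite exprVn.
rewrite E; apply: hasD_eq (neg n.+1) _ => t.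
have -> : Negz n - 1 = Negz n.+1 by rewrite !NegzE; lia.
by rewrite NegzE rmorphN /= exprVn.
Qed.

(** [E] is [E2], and [eta c] is the [2c]-th power of Dedekind's eta, of weight [c]. *)
Lemma eta_exists : exists (E : uhp R -> C) (e : nat -> C) (eta : int -> uhp R -> C),
  [/\ has_qexp 0 E e, e 0%N = 1, forall t, E (S t) = val t ^+ 2 * E t + 12 * val t / c2pi R,
      forall c, exists2 h, has_qexp (c%:~R / 12) (eta c) h & h 0%N != 0
    & forall c t, eta c (S t) = (- 'i * val t) ^ c * eta c t].
Proof.
have [Z [E [Z4 hE ES]]] := eisenstein2_pre R.
set e := (fun n : nat => _) in hE.
have s0 : sigma R 0 = 0 by rewrite /sigma big_nil.
have [K hK] : exists K, has_qexp 0 K (sigma R).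
  have hc := @has_qexp_cst R (- Z%:C).
  have := has_qexpZ (c := - 24^-1) (has_qexpD hE hc) => h; eexists.
  suff E1 : sigma R = (fun n => - 24^-1 * (e n + (if n is 0%N then - Z%:C else 0))).
    by rewrite E1; exact: h.
  apply/funext => -[|n]; first by rewrite /e s0 mulr0 subr0 subrr mulr0.
  by rewrite /e addr0 sub0r; field.
have EK t : E t = Z%:C - 24 * K t.
  have hc := @has_qexp_cst R Z%:C.
  have := has_qexpD hc (has_qexpZ (c := - 24) hK) => h.
  suff : E = (fun t => Z%:C + - 24 * K t) by move=> ->; rewrite mulNr.
  apply: has_qexp_uniqf hE _.
  suff -> : e = (fun n => (if n is 0%N then Z%:C else 0) + - 24 * sigma R n) by [].
  by apply/funext => n; rewrite /e mulNr.
(* Coefficients of minus the logarithm of the product of all 1 - q^n; at n = 0 the quotient is 0. *)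
pose l (n : nat) : C := sigma R n / n%:R.
have l0 : l 0%N = 0 by rewrite /l s0 mul0r.
have [L hL] : exists L, has_qexp 0 L l.
  apply: (@qconv_poly _ _ _ _ _ 0 1 hK) => n.
  rewrite expr0 mulr1 mul1r /l normcM normcV natC normcR ger0_norm//.
  case: n => [|n]; first by rewrite invr0 mulr0 normc_ge0.
  by rewrite ler_piMr ?normc_ge0// invf_le1 ?ltr0n// ler1n.
have [L1 hL1 DL] := has_qexp_D hL.
have L1E : L1 = K.
  apply: has_qexp_uniqf hL1 _.
  suff -> : (fun n => (0 + n%:R)%:C * l n) = sigma R by [].
  apply/funext => n; rewrite add0r -natC /l; case: n => [|n].
    by rewrite mul0r s0.
  by rewrite mulrC divfK// pnatr_eq0.
rewrite L1E in DL.
pose A (c : int) : C := Z%:C * c%:~R / 12.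
have AE (c : int) : (Z * c%:~R / 12)%:C = A c :> C.
  by rewrite /A !rmorphM fmorphV rmorph_int rmorph_nat.
(* The 2c-th power of the product of all 1 - q^n, times q^(Z c / 12). Defining all powers by one
   exponential makes [eta c] and [eta (- c)] mutually inverse. *)
pose eta (c : int) t : C := e2pi (A c * val t) * cexp (- 2 * c%:~R * L t).
have etaD a b t : eta (a + b) t = eta a t * eta b t.
  have e1 : A (a + b) * val t = A a * val t + A b * val t by rewrite /A intrD; ring.
  have e2 : - 2 * (a + b)%:~R * L t = - 2 * a%:~R * L t + - 2 * b%:~R * L t by rewrite intrD; ring.
  by rewrite /eta e1 e2 e2piD cexpD mulrACA.
have eta0 t : eta 0 t = 1 by rewrite /eta /A !(mulr0, mul0r) e2pi0 cexp0 mulr1.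
have etaX c t : eta c t = eta 1 t ^ c.
  have pos (n : nat) : eta n t = eta 1 t ^+ n.
    by elim: n => [|n IH]; rewrite ?eta0// intS etaD IH exprS.
  case: c => n; first exact: pos.
  have h : eta (Negz n) t * eta n.+1 t = 1 by rewrite -etaD NegzE addNr eta0.
  have h0 : eta n.+1 t != 0 by apply: contra_eq_neq h => ->; rewrite mulr0 eq_sym oner_eq0.
  by apply: (mulIf h0); rewrite h pos mulVf// -pos.
have Deta c : hasD (eta c) (fun t => c2pi R * (c%:~R / 12) * E t * eta c t).
  have D1 := hasD_cexp (hasDZ (c2pi R * A c) (@hasD_id R)).
  have D2 := hasD_cexp (hasDZ (- 2 * c%:~R) DL).
  have D := hasDM D1 D2.
  have E1 : (fun t => cexp (c2pi R * A c * val t) * cexp (- 2 * c%:~R * L t)) = eta c.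
    by apply/funext => t; rewrite /eta e2piE mulrA.
  rewrite E1 in D; apply: hasD_eq D _ => t; rewrite EK /eta e2piE [c2pi R * (_ * _)]mulrA.
  move: (cexp _) (cexp _) => u v; rewrite /A.
  by field.
have eta1S t : eta 1 (S t) = - 'i * val t * eta 1 t.
  (* The logarithmic derivative of [eta 1] is 2 pi i E / 12, so the non-modular term of E under S
     contributes exactly 1/tau, which the factor 1/tau of W compensates. The constant value is read
     off at i. *)
  pose W t := eta 1 (S t) * eta (-1) t * (val t)^-1.
  have DW : hasD W (fun=> 0).
    apply: hasD_eq (hasDM (hasDM (hasD_actS (Deta 1)) (Deta (-1))) (@hasD_inv R)) _ => s.
    rewrite ES; have s1 := uhp_neq0 s; have p1 := c2pi_neq0 R.
    move: (c2pi R) p1 (val s) s1 (eta 1 (S s)) (eta (-1) s) (E s) => p p1 z z1 u v w.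
    by rewrite rmorphN rmorph1; field; rewrite p1 z1.
  have [ti vi si] := fixed_i.
  have := hasD0_cst DW t ti; rewrite {2}/W si -etaD subrr eta0 mul1r vi /W => h.
  have t1 := uhp_neq0 t.
  have i1 : 'i^-1 = - 'i :> C.
    by apply/eqP; rewrite eq_complex /=; apply/andP; split; apply/eqP; field.
  have m1 : eta (-1) t * eta 1 t = 1 by rewrite -etaD addNr eta0.
  rewrite -i1 -h -[LHS]mulr1 -m1; field; by rewrite t1.
(* At rho = S (T rho) the laws of S and T combine to 1 = -i (rho + 1) e^(2 pi i Z/12); the cube of
   this relation is e^(2 pi i Z/4) = i. *)
have Z1 : Z = 1.
  have [tr hr sr] := fixed_rho.
  have vT : eta 1 (T tr) = e2pi (Z / 12)%:C * eta 1 tr.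
    have [q hq _] : exists2 q, has_qexp 0 (fun t => cexp (- 2 * 1%:~R * L t)) q & q 0%N != 0.
      by apply: exp_qexp (has_qexpZ hL) _; rewrite l0 mulr0.
    have hq' := has_qexp_twist (r := Z * 1%:~R / 12) hq; rewrite addr0 AE in hq'.
    by have := has_qexp_T tr hq'; rewrite -/(eta 1 _) -/(eta 1 _) mulr1z mulr1.
  have := eta1S (T tr); rewrite sr vT val_actT => h.
  have m1 : eta (-1) tr * eta 1 tr = 1 by rewrite -etaD addNr eta0.
  have n0 : eta 1 tr != 0 by apply: contra_eq_neq m1 => ->; rewrite mulr0 eq_sym oner_eq0.
  have h1 : 1 = - 'i * (val tr + 1) * e2pi (Z / 12)%:C.
    by apply: (mulIf n0); rewrite mul1r {1}h; ring.
  have h3 : e2pi (Z / 4)%:C = 'i :> C.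
    have -> : e2pi (Z / 4)%:C = e2pi (Z / 12)%:C ^+ 3 :> C.
      by rewrite e2piX natC -rmorphM; congr (e2pi _%:C); field.
    have : (- 'i * (val tr + 1) * e2pi (Z / 12)%:C) ^+ 3 = 1 by rewrite -h1 expr1n.
    set x := e2pi _; move: x => x; rewrite 2!exprMn hr.
    have -> : (- 'i) ^+ 3 = 'i :> C.
      by rewrite !exprS expr0; apply/eqP; rewrite eq_complex /=; apply/andP; split; apply/eqP; ring.
    move=> h2; have h4 : 'i * ('i * -1 * x ^+ 3) = 'i * 1 :> C by rewrite h2.
    rewrite mulr1 in h4; have i2 := sqr_i R; apply: etrans h4.
    by transitivity (- ('i ^+ 2) * x ^+ 3); [rewrite i2 opprK mul1r|ring].
  have /andP[Z0 Z44] := Z4.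
  have : Z / 4 = 1 / 4.
    apply: (@e2pi_inj R); [lra|lra|].
    by rewrite h3 e2pi_quarter.
  lra.
exists E; exists e; exists eta; split => //.
- by rewrite /e s0 mulr0 subr0 Z1.
- move=> c; have [q hq q0] : exists2 q, has_qexp 0 (fun t => cexp (- 2 * c%:~R * L t)) q & q 0%N != 0.
    by apply: exp_qexp (has_qexpZ hL) _; rewrite l0 mulr0.
  exists q; last exact: q0.
  have hq' := has_qexp_twist (r := Z * c%:~R / 12) hq.
  rewrite addr0 AE in hq'; rewrite Z1 mul1r in hq'.
  exact: hq'.
- by move=> c t; rewrite etaX eta1S expfzMl -etaX.
Qed.

End Eta.

(** * Weight two forms, Eichler integrals and Serre derivatives *)

Section WeightTwo.
Variable R : realType.
Local Notation C := R[i].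
Implicit Types (f g : uhp R -> C) (t : uhp R).

Local Notation S := (@SL2Z_act R SL2Z_S).
Local Notation T := (@SL2Z_act R SL2Z_T).

Lemma normc_invR (x c : R) : 0 < c -> c <= `|x| -> normc (x%:C)^-1 <= c^-1.
Proof.
move=> c0 h; rewrite normcV normcR.
by rewrite lef_pV2 ?posrE// (lt_le_trans c0).
Qed.

(** The primitive [F] of [f] is invariant under [S], having the same value at
    both [i] and [S i]; comparing [F] at [rho = S (T rho)] and [T rho] kills the
    constant term. *)
Lemma weight2_lead0 f (a : nat -> C) : has_qexp 0 f a ->
  (forall t, f (S t) = val t ^+ 2 * f t) -> a 0%N = 0.
Proof.
move=> hf fS.
pose b (n : nat) : C := a n / n%:R.
have [G hG] : exists G, has_qexp 0 G b.
  apply: (@qconv_poly _ _ _ _ _ 0 1 hf) => n.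
  rewrite expr0 mulr1 mul1r /b normcM normcV natC normcR ger0_norm//.
  case: n => [|n]; first by rewrite invr0 mulr0 normc_ge0.
  by rewrite ler_piMr ?normc_ge0// invf_le1 ?ltr0n// ler1n.
have [g hg DG] := has_qexp_D hG.
have gE t : g t = f t - a 0%N.
  have h1 := has_qexpD hf (@has_qexp_cst R (- a 0%N)).
  have -> : g = (fun t => f t + - a 0%N) by
    apply: has_qexp_uniqf hg _; move: h1; congr (has_qexp _ _ _);
    apply/funext => -[|n]; [rewrite subrr addr0 mul0r|
    rewrite addr0 add0r -natC /b mulrC divfK// pnatr_eq0].
  by [].
pose F t := c2pi R * a 0%N * val t + G t.
have DF : hasD F (fun t => c2pi R * f t).
  apply: hasD_eq (hasDD (hasDZ (c2pi R * a 0%N) (@hasD_id R)) DG) _ => t.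
  by rewrite gE; ring.
have D0 : hasD (fun t => F (S t) - F t) (fun=> 0).
  apply: hasD_eq (hasDB (hasD_actS DF) DF) _ => t.
  by rewrite fS; field; exact: uhp_neq0.
have [ti _ si] := fixed_i R; have [tr _ sr] := fixed_rho R.
have FS t : F (S t) = F t.
  by apply/eqP; rewrite -subr_eq0 (hasD0_cst D0 t ti) si subrr.
have FT : F (T tr) = F tr + c2pi R * a 0%N.
  by rewrite /F (has_qexp_T _ hG) e2pi0 mul1r val_actT; ring.
have := FS (T tr); rewrite sr FT => /eqP.
rewrite -subr_eq0 opprD addrA subrr add0r oppr_eq0 mulf_eq0.
by rewrite (negbTE (c2pi_neq0 R)) => /eqP.
Qed.

(** Termwise integration divides by mu + n, which stays away from 0; 1/6 is the distance for mu =
    1/6 and mu = -1/6. As f has weight 2 and sign -1 under S, phi (S t) + phi t has derivative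
    zero. *)
Lemma eichler_primitive (mu : R) f (a : nat -> C) :
  (forall n : nat, 1 / 6 <= `|mu + n%:R|) -> has_qexp mu f a ->
  (forall t, f (S t) = - (val t ^+ 2) * f t) ->
  exists phi p kappa, [/\ has_qexp mu phi p, p 0%N = a 0%N / mu%:C &
    forall t, phi (S t) = - phi t + kappa].
Proof.
move=> hmu hf fS.
pose p (n : nat) : C := a n / (mu + n%:R)%:C.
have [phi hphi] : exists phi, has_qexp mu phi p.
  apply: (@qconv_poly _ _ _ _ _ 0 ((1 / 6)^-1) hf) => n.
  by rewrite expr0 mulr1 mulrC /p normcM ler_wpM2l ?normc_ge0// normc_invR.
have [g hg D] := has_qexp_D hphi.
have gE : g = f.
  apply: has_qexp_uniqf hg _; move: hf; congr (has_qexp _ _ _).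
  apply/funext => n; rewrite /p mulrC divfK//.
  rewrite -normc_eq0 normcR gt_eqF//; apply: lt_le_trans (hmu n).
  by rewrite divr_gt0.
rewrite gE in D.
have D0 : hasD (fun t => phi (S t) + phi t) (fun=> 0).
  apply: hasD_eq (hasDD (hasD_actS D) D) _ => t.
  by rewrite fS; field; exact: uhp_neq0.
have [ti _ _] := fixed_i R.
exists phi; exists p; exists (phi (S ti) + phi ti); split => //.
  by rewrite /p addr0.
by move=> t; rewrite -(hasD0_cst D0 t ti) addrC addrK.
Qed.

Section WithEta.
Variables (E : uhp R -> C) (e : nat -> C) (eta : int -> uhp R -> C).
Hypothesis hE : has_qexp 0 E e.
Hypothesis e0 : e 0%N = 1.
Hypothesis ES : forall t, E (S t) = val t ^+ 2 * E t + 12 * val t / c2pi R.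
Hypothesis heta : forall c : int, exists2 h, has_qexp (c%:~R / 12) (eta c) h & h 0%N != 0.
Hypothesis etaS : forall c t, eta c (S t) = (- 'i * val t) ^ c * eta c t.

(** The non-modular term of E cancels the one produced by differentiating tau^k in the law of f. *)
Lemma serre_derivative (m : R) f (a : nat -> C) (k : int) (eps : C) : has_qexp m f a ->
  (forall t, f (S t) = eps * val t ^ k * f t) ->
  exists g b, [/\ has_qexp m g b, b 0%N = (m%:C - k%:~R / 12) * a 0%N &
    forall t, g (S t) = eps * val t ^ (k + 2) * g t].
Proof.
move=> hf fS; have [D hD fD] := has_qexp_D hf.
have [c hc c0] := has_qexp_mul hE hf; rewrite add0r in hc.
have hg := has_qexpD hD (has_qexpZ (c := - (k%:~R / 12)) hc).
exists (fun t => D t + - (k%:~R / 12) * (E t * f t)).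
eexists; split; first exact: hg.
  by rewrite /= c0 e0 addr0; ring.
move=> t; have t0 := uhp_neq0 t; have p0 := c2pi_neq0 R.
(* Both sides of the law of f under S are differentiated, and the result is solved for D (S t). *)
have DS : D (S t) = eps * val t ^ (k + 2) * D t + eps * k%:~R * val t ^ (k + 1) * f t / c2pi R.
  have D1 := hasD_actS fD.
  have D2 := hasDM (hasDZ eps (@hasD_exprz R k)) fD.
  have fE : (fun t => f (S t)) = (fun t => eps * val t ^ k * f t) by apply/funext.
  rewrite fE in D1; have := hasD_uniq t D1 D2.
  rewrite !(expfzDr _ _ t0) exprN1 !expr1z.
  move: (val t ^ k) (D (S t)) => X d h.
  have -> : d = (c2pi R * d / val t ^+ 2) * (val t ^+ 2 / c2pi R) by field; rewrite t0 p0.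
  by rewrite h; field; rewrite t0 p0.
rewrite DS ES fS !(expfzDr _ _ t0) !expr1z.
by field; exact: p0.
Qed.

(** Ramanujan's identity, 12 times q dE2/dq equals E2^2 - E4, serves as the definition of E4. *)
Lemma eisenstein4 : exists E4 e4, [/\ has_qexp 0 E4 e4, e4 0%N = 1 &
  forall t, E4 (S t) = val t ^+ 4 * E4 t].
Proof.
have [g hg D] := has_qexp_D hE.
have [c hc c0] := has_qexp_mul hE hE; rewrite add0r in hc.
have h4 := has_qexpD hc (has_qexpZ (c := - 12) hg).
exists (fun t => E t * E t + - 12 * g t).
eexists; split; first exact: h4.
  by rewrite /= c0 e0 !add0r mul0r mulr0 addr0 mulr1.
move=> t; have t0 := uhp_neq0 t; have p0 := c2pi_neq0 R.
have gS : g (S t) = val t ^+ 4 * g t + 2 * val t ^+ 3 * E t / c2pi R + 12 * val t ^+ 2 / c2pi R ^+ 2.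
  have D1 := hasD_actS D.
  have D2 := hasDD (hasDM (hasDM (@hasD_id R) (@hasD_id R)) D) (hasDZ (12 / c2pi R) (@hasD_id R)).
  have fE : (fun t => E (S t)) = (fun t => val t * val t * E t + 12 / c2pi R * val t).
    by apply/funext => u; rewrite ES; ring.
  rewrite fE in D1; have h := hasD_uniq t D1 D2; move: h.
  move: (g (S t)) => d h.
  have -> : d = (c2pi R * d / val t ^+ 2) * (val t ^+ 2 / c2pi R) by field; rewrite t0 p0.
  by rewrite h; field; rewrite ?t0 ?p0.
by rewrite gS ES; field; exact: p0.
Qed.

Lemma eta2S t : eta 2 (S t) = - (val t ^+ 2) * eta 2 t.
Proof.
rewrite etaS -[(_ ^ 2)]/((- 'i * val t) ^+ 2) exprMn sqrrN.
by have -> := sqr_i R; rewrite mulN1r.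
Qed.

Lemma etaN2S t : eta (- 2) (S t) = - (val t ^- 2) * eta (- 2) t.
Proof.
rewrite etaS -[(_ ^ (- 2))]/((- 'i * val t) ^- 2) exprMn sqrrN invfM.
by have -> := sqr_i R; rewrite invrN1 mulN1r.
Qed.

Lemma eta2_exp : (2 : int)%:~R / 12 = 1 / 6 :> R.
Proof. by rewrite -[(2 : int)%:~R]/(2%:R : R); field. Qed.

Lemma etaN2_exp : (- 2 : int)%:~R / 12 = - 1 / 6 :> R.
Proof. by rewrite rmorphN /= -[(2 : int)%:~R]/(2%:R : R); field. Qed.

Lemma eichler_exists (s : R) : s = 1 \/ s = -1 -> exists phi p kappa,
  [/\ has_qexp (s / 6) phi p, p 0%N != 0, kappa != 0 &
      forall t, phi (S t) = - phi t + kappa].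
Proof.
have [E4 [e4 [hE4 e40 E4S]]] := eisenstein4.
have [h h2 h20] := heta 2; rewrite eta2_exp in h2.
have [l hN2 l0] := heta (- 2); rewrite etaN2_exp in hN2.
have [c hEN c0] := has_qexp_mul hE4 hN2; rewrite add0r in hEN.
have ENS t : E4 (S t) * eta (- 2) (S t) = - (val t ^+ 2) * (E4 t * eta (- 2) t).
  by rewrite E4S etaN2S; field; exact: uhp_neq0.
have cn0 : c 0%N != 0 by rewrite c0 e40 mul1r.
have n6 : 1 / 6 != 0 :> R by rewrite gt_eqF// divr_gt0.
case=> ->.
  have hmu (n : nat) : 1 / 6 <= `|1 / 6 + n%:R| :> R.
    by have := ler0n R n => n0; rewrite ger0_norm; lra.
  have [phi [p [kappa [hphi p0 phiS]]]] := eichler_primitive hmu h2 eta2S.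
  have pn0 : p 0%N != 0.
    by rewrite p0 mulf_neq0// invr_eq0 (inj_eq (@complexI R) _ 0).
  exists phi; exists p; exists kappa; split => //.
  apply/eqP => k0.
  have [d hd d0] := has_qexp_mul hphi hEN.
  have e6 : 1 / 6 + - 1 / 6 = 0 :> R by field.
  rewrite e6 in hd.
  have := weight2_lead0 hd; rewrite d0 => H.
  have /eqP : p 0%N * c 0%N = 0 by apply: H => t; rewrite ENS phiS k0; ring.
  by rewrite mulf_eq0 (negbTE pn0) (negbTE cn0).
have hmu (n : nat) : 1 / 6 <= `|- 1 / 6 + n%:R| :> R.
  case: n => [|n]; first by rewrite addr0 mulNr normrN ger0_norm// divr_ge0.
  by have := ler0n R n => n0; rewrite -(@natr1 _ n) ger0_norm; lra.
have [phi [p [kappa [hphi p0 phiS]]]] := eichler_primitive hmu hEN ENS.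
have pn0 : p 0%N != 0.
  rewrite p0 mulf_neq0// invr_eq0 (inj_eq (@complexI R) _ 0).
  by rewrite mulNr oppr_eq0.
exists phi; exists p; exists kappa; split => //.
apply/eqP => k0.
have [d hd d0] := has_qexp_mul hphi h2.
have e' : - 1 / 6 + 1 / 6 = 0 :> R by field.
rewrite e' in hd.
have := weight2_lead0 hd; rewrite d0 => H.
have /eqP : p 0%N * h 0%N = 0 by apply: H => t; rewrite eta2S phiS k0; ring.
by rewrite mulf_eq0 (negbTE pn0) (negbTE h20).
Qed.

End WithEta.
End WeightTwo.

(** * Graded maps, leading coefficients and the one-dimensional module *)

Section GradedTools.
Variable R : realType.
Local Notation C := R[i].
Implicit Types (t : uhp R).

Local Notation S := (@SL2Z_act R SL2Z_S).
Local Notation T := (@SL2Z_act R SL2Z_T).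

(** The law under T is contained in the exponents of the expansions, and holomorphy in their
    convergence; only S remains to be tested. *)
Lemma is_mform_ST (k : int) n (X : gammaMod R n) (F : uhp R -> 'cV[C]_n) :
  (forall z, exists a, has_qexp (gexp X z) (fun t => F t z 0) a) ->
  (forall t, F (S t) = val t ^ k *: (X SL2Z_S *m F t)) ->
  is_mform k X F.
Proof.
move=> hq hS; split => //.
  by move=> z; have [a ha] := hq z; exact: has_qexp_holo ha.
apply: modular_ST => // t; apply/matrixP => z o; rewrite !ord1.
have [a ha] := hq z; rewrite (has_qexp_T t ha).
by rewrite gmxT mul_diag_mx !mxE.
Qed.

Lemma mform_S (k : int) n (X : gammaMod R n) (F : mform k X) t :
  F (S t) = val t ^ k *: (X SL2Z_S *m F t).
Proof.
have [_ /(_ SL2Z_S t) h _] := mformP F; rewrite -h aut_factorS scalerA.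
by rewrite -expfzDr ?uhp_neq0// subrr expr0z scale1r.
Qed.

Section Lift.
Variables (n p : nat) (X : gammaMod R n) (Y : gammaMod R p).
Variable A : uhp R -> 'M[C]_(p, n).
Hypothesis hA : forall k (F : mform k X), is_mform k Y (fun t => A t *m F t).

Definition lift_fun k (F : Hmod X k) : Hmod Y k := mkMForm (hA F).

Fact lift_linear k : linear (@lift_fun k).
Proof.
move=> c F G; apply: mform_eq => t.
by rewrite mformDE mformZE /= mulmxDr -scalemxAr.
Qed.

HB.instance Definition _ k :=
  GRing.isLinear.Build C (Hmod X k) (Hmod Y k) _ (@lift_fun k) (@lift_linear k).

Fact lift_act k l m (e : k + l = m) (f : modform R k) (F : Hmod X l) :
  lift_fun (gact e f F) = gact e f (lift_fun F).
Proof. by apply: mform_eq => t; rewrite /= scalemxAr. Qed.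

(** The splitting will be of this kind: multiplication by a matrix of functions commutes with
    multiplication by modular forms. *)
Definition graded_lift : gradedMap (Hmod X) (Hmod Y) :=
  @GradedMap R (Hmod X) (Hmod Y) (fun k => @lift_fun k : {linear _ -> _}) lift_act.

End Lift.

Lemma mform_lead_ex k (X : gammaMod R 1) (F : mform k X) :
  exists a, has_qexp (gexp X 0) (fun t => F t 0 0) a.
Proof. by have [_ _] := mformP F; apply. Qed.

(** Coefficient at the normalised exponent, possibly 0; [has_qexp_lead] makes it independent of the
    chosen expansion. *)
Definition lead k (X : gammaMod R 1) (F : mform k X) : C :=
  sval (cid (mform_lead_ex F)) 0%N.

Lemma leadE k (X : gammaMod R 1) (F : mform k X) a :
  has_qexp (gexp X 0) (fun t => F t 0 0) a -> lead F = a 0%N.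
Proof. by rewrite /lead; case: cid => b hb /= ha; exact: has_qexp_lead hb ha. Qed.

Lemma leadP k (X : gammaMod R 1) (F : mform k X) :
  exists2 a, has_qexp (gexp X 0) (fun t => F t 0 0) a & lead F = a 0%N.
Proof. by have [a ha] := mform_lead_ex F; exists a => //; exact: leadE. Qed.

Lemma leadZD k (X : gammaMod R 1) c (F G : mform k X) :
  lead (c *: F + G) = c * lead F + lead G.
Proof.
have [a ha ->] := leadP F; have [b hb ->] := leadP G.
have := has_qexpD (has_qexpZ (c := c) ha) hb => h.
apply: (@leadE _ _ _ (fun n => c * a n + b n)).
have -> // : (fun t => (c *: F + G) t 0 0) = (fun t => c * F t 0 0 + G t 0 0).
by apply/funext => t; rewrite mformDE mformZE !mxE.
Qed.

Lemma leadD k (X : gammaMod R 1) (F G : mform k X) : lead (F + G) = lead F + lead G.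
Proof. by rewrite -[F]scale1r leadZD mul1r scale1r. Qed.

Lemma leadZ k (X : gammaMod R 1) c (F : mform k X) : lead (c *: F) = c * lead F.
Proof.
have [a ha ->] := leadP F; apply: (@leadE _ _ _ (fun n => c * a n)).
have -> : (fun t => (c *: F) t 0 0) = (fun t => c * F t 0 0).
  by apply/funext => t; rewrite mformZE !mxE.
exact: (has_qexpZ (c := c) ha).
Qed.

Lemma lead_mact k l m (e : k + l = m) (X : gammaMod R 1) (f : modform R k) (F : mform l X) :
  lead (mact e f F) = lead f * lead F.
Proof.
have [a ha ->] := leadP f; have [b hb ->] := leadP F.
have [c hc <-] := has_qexp_mul ha hb; apply: leadE.
have -> : (fun t => mact e f F t 0 0) = (fun t => f t 0 0 * F t 0 0).
  by apply/funext => t; rewrite /= mxE.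
by rewrite /= add0r in hc.
Qed.

Lemma lead_modform1 : lead (modform1 R) = 1.
Proof.
have -> // := @leadE _ _ (modform1 R) (fun n => if n is 0%N then 1 else 0).
have -> : (fun t => modform1 R t 0 0) = (fun=> 1).
  by apply/funext => t; rewrite /= mxE.
exact: has_qexp_cst.
Qed.

Section Line.
Variable b : int.
(** Associativity of the action forces this: passing through an intermediate weight other than b
    gives 0, so acting by the product must give 0 as well. *)
Hypothesis lead_off : forall k l (f : modform R k) (g : modform R l),
  k + l = 0 -> l != 0 -> lead f * lead g = 0.

(** The boolean [k == b], read as 0 or 1, is the dimension, which avoids transport along equalities
    of weights. *)
Definition line_comp (k : int) : lmodType C := 'rV[C]_(k == b).

(** f acts by its constant term; the sum over the at most one entry of x returns that entry, or 0 in
    the zero space, whatever the weights are. *)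
Definition line_act k l m (e : k + l = m) (f : modform R k) (x : line_comp l) : line_comp m :=
  const_mx (lead f * \sum_i x 0 i).

Lemma line_index k (j : 'I_(k == b)) : k = b.
Proof. by case: (eqVneq k b) j => // _ []. Qed.

Lemma line_sum k (x : line_comp k) (j : 'I_(k == b)) : \sum_i x 0 i = x 0 j.
Proof.
rewrite (bigD1 j)//= big1 ?addr0// => i; move=> ij; exfalso.
move/eqP: ij; apply; apply/val_inj.
by case: (k == b) i j => -[i hi] [j hj] //=; move: hi hj; case: i => //; case: j.
Qed.

Lemma const_mxDr n (u v : C) : const_mx (u + v) = const_mx u + const_mx v :> 'rV[C]_n.
Proof. by apply/matrixP => i j; rewrite !mxE. Qed.

Lemma const_mxZr n (u v : C) : const_mx (u * v) = u *: const_mx v :> 'rV[C]_n.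
Proof. by apply/matrixP => i j; rewrite !mxE. Qed.

Lemma line_actE k l m (e : k + l = m) (f : modform R k) (x : line_comp l) :
  line_act e f x = const_mx (lead f * \sum_s (x : 'rV[C]_(l == b)) 0 s).
Proof. by []. Qed.

Fact line_actDl k l m (e : k + l = m) (f g : modform R k) (x : line_comp l) :
  line_act e (f + g) x = line_act e f x + line_act e g x.
Proof.
rewrite !line_actE; set s := \sum_s _.
apply: etrans (const_mxDr (m == b) (lead f * s) (lead g * s)).
by congr const_mx; rewrite -mulrDl; congr (_ * _); exact: leadD.
Qed.

Fact line_actDr k l m (e : k + l = m) (f : modform R k) (x y : line_comp l) :
  line_act e f (x + y) = line_act e f x + line_act e f y.
Proof.
rewrite !line_actE; set s := \sum_s _; set s1 := \sum_s _; set s2 := \sum_s _.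
apply: etrans (const_mxDr (m == b) (lead f * s1) (lead f * s2)).
congr const_mx; rewrite -mulrDr; congr (_ * _); rewrite /s /s1 /s2 -big_split /=.
by apply: eq_bigr => o _; exact: mxE.
Qed.

Fact line_actZl k l m (e : k + l = m) c (f : modform R k) (x : line_comp l) :
  line_act e (c *: f) x = c *: line_act e f x.
Proof.
rewrite !line_actE; set s := \sum_s _.
apply: etrans (const_mxZr (m == b) c (lead f * s)).
by congr const_mx; rewrite mulrA; congr (_ * _); exact: leadZ.
Qed.

Fact line_actZr k l m (e : k + l = m) c (f : modform R k) (x : line_comp l) :
  line_act e f (c *: x) = c *: line_act e f x.
Proof.
rewrite !line_actE; set s := \sum_s _; set s1 := \sum_s _.
apply: etrans (const_mxZr (m == b) c (lead f * s1)).
congr const_mx; rewrite mulrCA; congr (_ * _); rewrite /s /s1 mulr_sumr.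
by apply: eq_bigr => o _; exact: mxE.
Qed.

Lemma line_ext k (x y : line_comp k) :
  (forall j : 'I_(k == b), (x : 'rV[C]_(k == b)) 0 j = (y : 'rV[C]_(k == b)) 0 j) -> x = y.
Proof. by move=> h; apply/rowP. Qed.

Fact line_act1 l (e : 0 + l = l) (x : line_comp l) : line_act e (modform1 R) x = x.
Proof.
apply: line_ext => j; rewrite line_actE; apply: etrans (mxE _ _ _ _) _.
by rewrite lead_modform1 mul1r (line_sum x j).
Qed.

Fact line_actA k l m kl lm n (e1 : k + l = kl) (e2 : kl + m = n)
    (e3 : l + m = lm) (e4 : k + lm = n) (f : modform R k) (g : modform R l)
    (x : line_comp m) :
  line_act e2 (mact e1 f g) x = line_act e4 f (line_act e3 g x).
Proof.
apply: line_ext => j; have nb := line_index j.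
rewrite [line_act e2 _ _]line_actE [line_act e4 _ _]line_actE.
apply: etrans (mxE _ _ _ _) _; apply: etrans (esym (mxE _ _ _ _)).
rewrite lead_mact -mulrA.
(* If the intermediate weight is not b, the right side is 0; the left side vanishes by [lead_off]
   when m = b, and because x has no entries otherwise. *)
have [lmb|lmb] := pselect (lm = b).
  have h : (0 < (lm == b))%N by rewrite lmb eqxx.
  rewrite (line_sum (line_act e3 g x) (Ordinal h)) line_actE; congr (_ * _).
  exact/esym/mxE.
have -> : \sum_i0 (line_act e3 g x : 'rV[C]_(lm == b)) 0 i0 = 0.
  by apply: big1 => s _; have := line_index s.
apply: etrans (esym (mulr0 (lead f))); apply: (etrans (mulrA _ _ _)).
have [mb|mb] := pselect (m = b).
  have fg0 : lead f * lead g = 0.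
    by apply: lead_off; [lia|apply/eqP => l0; apply: lmb; lia].
  by rewrite fg0 mul0r.
have -> : \sum_i0 (x : 'rV[C]_(m == b)) 0 i0 = 0.
  by apply: big1 => s _; have := line_index s.
exact: mulr0.
Qed.

Definition line : gradedMod R :=
  @GradedMod R line_comp line_act line_actDl line_actDr line_actZl line_actZr
    line_act1 line_actA.

Lemma line_graded : graded_line line b.
Proof.
split; last first.
  by move=> k kb x; apply: line_ext => j; have := line_index j; move/eqP: kb.
have h : (0 < (b == b))%N by rewrite eqxx.
exists (const_mx 1 : 'rV[C]_(b == b)).
  apply/eqP => h0; have : (const_mx 1 : 'rV[C]_(b == b)) 0 (Ordinal h) = (0 : 'rV[C]_(b == b)) 0 (Ordinal h).
    by congr (fun_of_matrix _ _ _); exact: h0.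
  by rewrite !mxE => /eqP; rewrite oner_eq0.
move=> y; exists ((y : 'rV[C]_(b == b)) 0 (Ordinal h)); apply: line_ext => j.
apply: etrans (esym (mxE _ _ _ _)); rewrite mxE mulr1.
by rewrite -(line_sum y j) -(line_sum y (Ordinal h)).
Qed.

Variable X : gammaMod R 1.
Hypothesis lead_offX : forall k l (f : modform R k) (G : mform l X),
  k + l = b -> l != b -> lead f * lead G = 0.

Definition line_proj_fun k (G : Hmod X k) : line k := const_mx (lead G) : 'rV[C]_(k == b).

Fact line_proj_linear k : linear (@line_proj_fun k).
Proof.
move=> c F G.
have e : line_proj_fun (c *: F + G) = const_mx (c * lead F + lead G) :> 'rV[C]_(k == b).
  by congr const_mx; exact: leadZD.
apply: (etrans e); apply: (etrans (const_mxDr _ _ _)).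
exact: (congr1 (fun z : 'rV[C]_(k == b) => z + const_mx (lead G))
  (const_mxZr (k == b) c (lead F))).
Qed.

HB.instance Definition _ k :=
  GRing.isLinear.Build C (Hmod X k) (line k) _ (@line_proj_fun k) (@line_proj_linear k).

Fact line_proj_act k l m (e : k + l = m) (f : modform R k) (G : Hmod X l) :
  line_proj_fun (gact e f G) = gact e f (line_proj_fun G).
Proof.
apply: line_ext => j; have mb := line_index j.
apply: etrans (mxE _ _ _ _) _; apply: etrans (esym (mxE _ _ _ _)).
apply: (etrans (lead_mact e f G)).
have [lb|lb] := pselect (l = b).
  have h : (0 < (l == b))%N by rewrite lb eqxx.
  rewrite (line_sum (line_proj_fun G) (Ordinal h)); congr (_ * _).
  exact/esym/mxE.
rewrite lead_offX; [|by rewrite e|exact/eqP].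
by rewrite big1 ?mulr0// => s _; have := line_index s.
Qed.

Definition line_proj : gradedMap (Hmod X) line :=
  @GradedMap R (Hmod X) line (fun k => @line_proj_fun k : {linear _ -> _}) line_proj_act.

Lemma line_proj_eq0 k (G : Hmod X k) : line_proj k G = 0 <-> k != b \/ lead G = 0.
Proof.
split => [h|h].
  have [kb|] := eqVneq k b; [right|by left].
  have i0 : (0 < (k == b))%N by rewrite kb eqxx.
  have : (line_proj_fun G : 'rV[C]_(k == b)) 0 (Ordinal i0) = (0 : 'rV[C]_(k == b)) 0 (Ordinal i0).
    by congr (fun_of_matrix _ _ _); exact: h.
  by rewrite !mxE.
apply: line_ext => j; apply: etrans (mxE _ _ _ _) _; apply: etrans (esym (mxE _ _ _ _)).
by case: h => // kb; have := line_index j; move/eqP: kb.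
Qed.

End Line.
End GradedTools.

(** * Normal form of the two-dimensional module *)

Section Extension.
Variable R : realType.
Local Notation C := R[i].
Implicit Types (t : uhp R).

Local Notation S := (@SL2Z_act R SL2Z_S).

Lemma ord2_cases (x y z : 'I_2) : x != y -> z = x \/ z = y.
Proof.
move=> xy; have o (i : 'I_2) : i = 0 \/ i = 1.
  by case: i => -[|[|//]] hi; [left|right]; apply/val_inj.
by move: xy; case: (o x) => ->; case: (o y) => ->; case: (o z) => ->; rewrite ?eqxx//; auto.
Qed.

Lemma sum_ord2 (F : 'I_2 -> C) (x y : 'I_2) : x != y -> \sum_w F w = F x + F y.
Proof.
move=> xy; rewrite (bigD1 x)//= (bigD1 y)//=; last by rewrite eq_sym.
rewrite big1 ?addr0// => z /andP[zx zy].
by case: (ord2_cases z xy) => e; move: zx zy; rewrite e eqxx.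
Qed.

Section Character.
Variables (chi : SL2Z -> C) (chiP : is_character chi).
Hypothesis chiT : chi SL2Z_T = e2pi (12%:R^-1).

Lemma character_neq0 g : chi g != 0.
Proof.
have h : chi g * chi g^-1%g = 1 by rewrite -(characterM chiP) mulgV (character1 chiP).
by apply: contra_eq_neq h => ->; rewrite mul0r eq_sym oner_eq0.
Qed.

(** From the relation [S^2 = (S T)^3]. *)
Lemma character_S : chi SL2Z_S = - 'i.
Proof.
have rel : (SL2Z_S * SL2Z_S = SL2Z_S * SL2Z_T * (SL2Z_S * SL2Z_T) * (SL2Z_S * SL2Z_T))%g.
  have [s1 s2 s3 s4] := SL2Z_SE; have [t1 t2 t3 t4] := SL2Z_TE.
  by apply: SL2Z_eqP; rewrite !SL2Z_mulE s1 s2 s3 s4 t1 t2 t3 t4.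
have := congr1 chi rel; rewrite !(characterM chiP).
have v3 : chi SL2Z_T * chi SL2Z_T * chi SL2Z_T = 'i.
  rewrite chiT -e2pi_quarter -!e2piD; congr e2pi.
  by rewrite rmorphM fmorphV rmorph1 rmorph_nat; field.
have x0 := character_neq0 SL2Z_S.
move: (chi SL2Z_S) x0 (chi SL2Z_T) v3 => x x0 v v3 h.
have h1 : x * x * 1 = x * x * (x * 'i).
  rewrite mulr1; transitivity (x * v * (x * v) * (x * v)); first exact: h.
  by transitivity (x * x * x * (v * v * v)); [ring|rewrite v3; ring].
have h2 : 1 = x * 'i by apply: (mulfI (mulf_neq0 x0 x0)).
have i2 := sqr_i R.
transitivity (x * - ('i ^+ 2)); first by rewrite i2 opprK mulr1.
by transitivity (- (x * 'i * 'i)); [ring|rewrite -h2 mul1r].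
Qed.

Section ShortExact.
Variables (a b : int) (V : gammaMod R 2).
Variables (i : gammaMap (charMod chiP chiT a) V) (j : gammaMap V (charMod chiP chiT b)).
Hypothesis ses : gamma_short_exact i j.
Hypothesis ab : modz a 12 != modz b 12.

(** T has distinct eigenvalues on chi^a and chi^b, so each of the equivariant maps i and j meets a
    single coordinate of V. The eigenbasis of V comes in no particular order, hence the indices x
    and y. *)
Lemma ses_normal_form : exists (x y : 'I_2) (al be : C),
  [/\ x != y, al != 0 & be != 0] /\
  [/\ forall z, i z 0 = if z == x then al else 0,
      forall z, j 0 z = if z == y then be else 0,
      gexp V x = gexp (charMod chiP chiT a) 0 & gexp V y = gexp (charMod chiP chiT b) 0] /\
  forall g, [/\ V g x x = chi g ^ a, V g y y = chi g ^ b & V g y x = 0].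
Proof.
have [inji _ surj] := ses.
have [x xi] : exists x, i x 0 != 0.
  apply/not_existsP => h.
  have : (1%:M : 'cV[C]_1) = 0.
    apply: inji; rewrite mulmx1 mulmx0; apply/matrixP => z o; rewrite ord1 mxE.
    by apply/eqP; have := h z; move/negP; rewrite negbK.
  by move/matrixP/(_ 0 0)/eqP; rewrite !mxE oner_eq0.
have [y yj] : exists y, j 0 y != 0.
  apply/not_existsP => h; have [v hv] := surj 1%:M.
  have : (1%:M : 'M[C]_1) 0 0 = 0.
    by rewrite -hv mxE big1// => z _; have := h z; move/negP; rewrite negbK => /eqP ->; rewrite mul0r.
  by rewrite mxE => /eqP; rewrite oner_eq0.
have ex := gammaMap_gexp xi; have ey := gammaMap_gexp yj.
have ne : gexp (charMod chiP chiT a) 0 <> gexp (charMod chiP chiT b) 0.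
  rewrite /= /charMod_gexp => h; move/eqP: ab; apply.
  have h12 : (12%:R^-1 : R) != 0 by rewrite invr_eq0 pnatr_eq0.
  by have /eqP := mulIf h12 h; rewrite eqr_int => /eqP.
have xy : x != y by apply/eqP => e; apply: ne; rewrite ex e ey.
have iE z : i z 0 = if z == x then i x 0 else 0.
  case: eqVneq => [-> //|zx].
  have [e|e] := ord2_cases z xy; first by rewrite e eqxx in zx.
  apply/eqP; apply/negPn/negP => h; apply: ne.
  by rewrite (gammaMap_gexp h) e ey.
have jE z : j 0 z = if z == y then j 0 y else 0.
  case: eqVneq => [-> //|zy].
  have [e|e] := ord2_cases z xy; last by rewrite e eqxx in zy.
  apply/eqP; apply/negPn/negP => h; apply: ne.
  by rewrite -(gammaMap_gexp h) e ex.
exists x; exists y; exists (i x 0); exists (j 0 y); split => //; split => // g.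
have yx : (y == x) = false by rewrite eq_sym (negbTE xy).
have hi z : V g z x * i x 0 = i z 0 * chi g ^ a.
  have := congr1 (fun M : 'cV[C]_2 => M z 0) (hmxP i g).
  rewrite [LHS]mxE big_ord1 [charMod _ _ _ _ _ _]mxE eqxx mulr1n => ->.
  by rewrite mxE (sum_ord2 _ xy) (iE y) yx mulr0 addr0.
have hj z : j 0 y * V g y z = chi g ^ b * j 0 z.
  have := congr1 (fun M : 'rV[C]_2 => M 0 z) (hmxP j g).
  rewrite [RHS]mxE big_ord1 [charMod _ _ _ _ _ _]mxE eqxx mulr1n => <-.
  by rewrite mxE (sum_ord2 _ xy) (jE x) (negbTE xy) mul0r add0r.
split.
- by apply: (mulIf xi); rewrite hi mulrC.
- by apply: (mulfI yj); rewrite hj mulrC.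
- by apply: (mulIf xi); rewrite hi (iE y) yx !mul0r.
Qed.

End ShortExact.
End Character.

Section Triangular.
Variables (V : gammaMod R 2) (x y : 'I_2) (al be : SL2Z -> C).
Hypotheses (xy : x != y) (Vxx : forall g, V g x x = al g) (Vyy : forall g, V g y y = be g)
  (Vyx : forall g, V g y x = 0).

Let yx : (y == x) = false. Proof. by rewrite eq_sym (negbTE xy). Qed.

Lemma triangular_mulx g (v : 'cV[C]_2) : (V g *m v) x 0 = al g * v x 0 + V g x y * v y 0.
Proof. by rewrite mxE (sum_ord2 _ xy) Vxx. Qed.

Lemma triangular_muly g (v : 'cV[C]_2) : (V g *m v) y 0 = be g * v y 0.
Proof. by rewrite mxE (sum_ord2 _ xy) Vyx Vyy mul0r add0r. Qed.

Definition pair_col (f1 f2 : C) : 'cV[C]_2 := \col_z if z == x then f1 else f2.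

Lemma pair_colx f1 f2 : pair_col f1 f2 x 0 = f1.
Proof. by rewrite mxE eqxx. Qed.

Lemma pair_coly f1 f2 : pair_col f1 f2 y 0 = f2.
Proof. by rewrite mxE yx. Qed.

Lemma col2P (u v : 'cV[C]_2) : u x 0 = v x 0 -> u y 0 = v y 0 -> u = v.
Proof.
move=> hx hy; apply/matrixP => z o; rewrite ord1.
by have [->|->] := ord2_cases z xy.
Qed.

Lemma pair_mform k f1 f2 a1 a2 : has_qexp (gexp V x) f1 a1 -> has_qexp (gexp V y) f2 a2 ->
  (forall t, f1 (S t) = val t ^ k * (al SL2Z_S * f1 t + V SL2Z_S x y * f2 t)) ->
  (forall t, f2 (S t) = val t ^ k * (be SL2Z_S * f2 t)) ->
  is_mform k V (fun t => pair_col (f1 t) (f2 t)).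
Proof.
move=> h1 h2 s1 s2; apply: is_mform_ST => [z|t].
  have [->|->] := ord2_cases z xy; [exists a1|exists a2].
    by have -> : (fun t => pair_col (f1 t) (f2 t) x 0) = f1 by apply/funext => t; exact: pair_colx.
  by have -> : (fun t => pair_col (f1 t) (f2 t) y 0) = f2 by apply/funext => t; exact: pair_coly.
apply: col2P.
  by rewrite pair_colx s1 [RHS]mxE triangular_mulx pair_colx pair_coly.
by rewrite pair_coly s2 [RHS]mxE triangular_muly pair_coly.
Qed.

(** V is already diagonal at T; were it diagonal at S as well, it would be so on the whole group,
    and the two coordinate lines would decompose V. *)
Lemma indecomposable_xy : gamma_indecomposable V -> V SL2Z_S x y != 0.
Proof.
move=> [_ indec]; apply/eqP => b0.
have one (i j : 'I_2) : V 1%g i j = (i == j)%:R by rewrite gmx1 mxE.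
have VM g h : V (g * h)%g x y = al g * V h x y + V g x y * be h.
  by rewrite gmxM mxE (sum_ord2 _ xy) Vxx Vyy.
have al0 g : al g != 0.
  have : V (g * g^-1)%g x x = 1 by rewrite mulgV one eqxx.
  rewrite gmxM mxE (sum_ord2 _ xy) Vyx mulr0 addr0 Vxx.
  by move=> h; apply: contra_eq_neq h => ->; rewrite mul0r eq_sym oner_eq0.
have V0 g : V g x y = 0.
  elim/SL2Z_ind : g => [//||g h hg hh|g hg].
  - by rewrite gmxT mxE (negbTE xy) mulr0n.
  - by rewrite VM hg hh mulr0 mul0r addr0.
  - have := VM g g^-1%g; rewrite mulgV one (negbTE xy) hg mul0r addr0 => /esym/eqP.
    by rewrite mulf_eq0 (negbTE (al0 g)) => /eqP.
pose ex := pair_col 1 0; pose ey := pair_col 0 1.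
have inv1 : gamma_invariant V <[ex]>.
  move=> g v /vlineP[k ->]; apply/vlineP; exists (k * al g).
  apply: col2P; rewrite ?triangular_mulx ?triangular_muly !mxE ?eqxx ?yx; ring.
have inv2 : gamma_invariant V <[ey]>.
  move=> g v /vlineP[k ->]; apply/vlineP; exists (k * be g).
  apply: col2P; rewrite ?triangular_mulx ?triangular_muly !mxE ?eqxx ?yx ?V0; ring.
have full : (<[ex]> + <[ey]>)%VS = fullv.
  apply/vspaceP => v; rewrite memvf.
  have -> : v = v x 0 *: ex + v y 0 *: ey.
    by apply: col2P; rewrite !mxE ?eqxx ?yx; ring.
  by apply: memv_add; apply: memvZ; exact: memv_line.
have cap : (<[ex]> :&: <[ey]>)%VS = 0%VS.
  apply/eqP; rewrite -subv0; apply/subvP => v; rewrite memv_cap => /andP[/vlineP[k ->] /vlineP[l h]].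
  have := congr1 (fun M : 'cV[C]_2 => M x 0) h.
  by rewrite !mxE eqxx mulr1 mulr0 => ->; rewrite scale0r mem0v.
have [h|h] := indec _ _ inv1 inv2 full cap.
  have := memv_line ex; rewrite h memv0 => /eqP/matrixP/(_ x 0)/eqP.
  by rewrite !mxE eqxx oner_eq0.
have := memv_line ey; rewrite h memv0 => /eqP/matrixP/(_ y 0)/eqP.
by rewrite !mxE yx oner_eq0.
Qed.

End Triangular.
End Extension.

(** * The induced sequences of spaces of modular forms *)

Section ExactSequence.
Variable R : realType.
Local Notation C := R[i].
Implicit Types (t : uhp R).
Local Notation S := (@SL2Z_act R SL2Z_S).

Lemma has_qexp_ext (m : R) (f g : uhp R -> C) q : (forall t, f t = g t) ->
  has_qexp m f q -> has_qexp m g q.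
Proof. by move=> /funext ->. Qed.

Lemma push_injective n p (X : gammaMod R n) (Y : gammaMod R p) (i : gammaMap X Y) :
  injective (fun x : 'cV[C]_n => i *m x) -> graded_injective (push i).
Proof.
move=> inj k F G h; apply: mform_eq => t; apply: inj.
exact: (congr1 (fun H : mform k Y => H t) h).
Qed.

Variables (chi : SL2Z -> C) (chiP : is_character chi).
Hypothesis chiT : chi SL2Z_T = e2pi (12%:R^-1).
Variables (a b : int) (V : gammaMod R 2).
Hypotheses (ha : 0 <= a <= 11) (hb : 0 <= b <= 11).
Variables (i : gammaMap (charMod chiP chiT a) V) (j : gammaMap V (charMod chiP chiT b)).
Hypothesis ses : gamma_short_exact i j.
Variables (x y : 'I_2) (al be : C).
Hypotheses (xy : x != y) (al0 : al != 0) (be0 : be != 0).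
Hypotheses (iE : forall z, i z 0 = if z == x then al else 0)
  (jE : forall z, j 0 z = if z == y then be else 0)
  (gx : gexp V x = gexp (charMod chiP chiT a) 0)
  (gy : gexp V y = gexp (charMod chiP chiT b) 0).
Hypotheses (Vxx : forall g, V g x x = chi g ^ a) (Vyy : forall g, V g y y = chi g ^ b)
  (Vyx : forall g, V g y x = 0).

Let chiS : chi SL2Z_S = - 'i := character_S chiP chiT.

Let yx : (y == x) = false. Proof. by rewrite eq_sym (negbTE xy). Qed.

Let expE (c : int) : 0 <= c <= 11 -> gexp (charMod chiP chiT c) 0 = c%:~R / 12 :> R.
Proof. by move=> hc; rewrite /= /charMod_gexp modz_small//; lia. Qed.

Let j_mul (v : 'cV[C]_2) : (j *m v) 0 0 = be * v y 0.
Proof. by rewrite mxE (sum_ord2 _ xy) !jE (negbTE xy) eqxx mul0r add0r. Qed.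

Lemma push_exact : graded_exact (push i) (push j).
Proof.
have [_ mid _] := ses.
move=> k F; split=> [h|[G <-]]; last first.
  apply: mform_eq => t; apply: etrans (_ : 0 = _) => //.
  by apply/mid; exists (G t).
have hy t : F t y 0 = 0.
  have := congr1 (fun H : mform k (charMod chiP chiT b) => H t 0 0) h.
  move=> e; have {}e : (j *m F t) 0 0 = 0 by rewrite e mxE.
  by move: e; rewrite j_mul => /eqP; rewrite mulf_eq0 (negbTE be0) => /eqP.
have hG : is_mform k (charMod chiP chiT a) (fun t => (al^-1 * F t x 0)%:M).
  apply: is_mform_ST => [z|t].
    rewrite ord1 -gx; have [_ _ /(_ x)[q hq]] := mformP F.
    exists (fun n => al^-1 * q n).
    apply: has_qexp_ext (has_qexpZ (c := al^-1) hq) => t.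
    by rewrite mxE eqxx mulr1n.
  rewrite mform_S; apply/matrixP => z o; rewrite !ord1 /=.
  rewrite -scalar_mxM !mxE eqxx !mulr1n.
  have -> : \sum_j0 V SL2Z_S x j0 * F t j0 0 = chi SL2Z_S ^ a * F t x 0.
    by rewrite (sum_ord2 _ xy) hy Vxx mulr0 addr0.
  ring.
exists (mkMForm hG); apply: mform_eq => t; apply: (col2P xy); rewrite /= mxE big_ord1 mxE iE.
  by rewrite eqxx mulr1n mulrA mulfV// mul1r.
by rewrite yx mul0r hy.
Qed.

Variables (s : R) (phi : uhp R -> C) (p : nat -> C) (kappa : C).
Hypotheses (hphi : has_qexp (s / 6) phi p) (p0 : p 0%N != 0) (kappa0 : kappa != 0)
  (phiS : forall t, phi (S t) = - phi t + kappa).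
Hypothesis chiab : (- 'i : C) ^ a = - (- 'i) ^ b.

Let beta := V SL2Z_S x y.
(** Scales phi so that the constant in its law under S absorbs the off-diagonal entry of V at S when
    the law of a lift is checked. *)
Let lam := be^-1 * beta / (- 'i) ^ b / kappa.

Let iexp0 (c : int) : (- 'i : C) ^ c != 0.
Proof. by rewrite expfz_neq0// oppr_eq0 eq_complex /= oner_eq0 andbF. Qed.

Let psi t := lam * phi t.

Let psiS t : psi (S t) = - psi t + be^-1 * beta / (- 'i) ^ b.
Proof. by rewrite /psi phiS /lam; field; rewrite kappa0 be0 iexp0. Qed.

Lemma char_form k (G : mform k (charMod chiP chiT b)) :
  [/\ has_qexp (b%:~R / 12) (fun t => G t 0 0) (sval (cid (mform_lead_ex G))),
      lead G = sval (cid (mform_lead_ex G)) 0%N &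
      forall t, G (S t) 0 0 = val t ^ k * ((- 'i) ^ b * G t 0 0)].
Proof.
split; [|exact: erefl|].
  rewrite -[b%:~R / 12](expE hb); exact: (proj2_sig (cid (mform_lead_ex G))).
by move=> t; rewrite mform_S /= chiS !mxE big_ord1 mxE eqxx mulr1n.
Qed.

(** j forces the second coordinate. The first may be changed by any r obeying the law of chi^a in
    weight k under S, since (-i)^a = - (-i)^b. *)
Lemma lift_mform k (G : mform k (charMod chiP chiT b)) (r : uhp R -> C) q :
  has_qexp (gexp V x) (fun t => psi t * G t 0 0 + r t) q ->
  (forall t, r (S t) = val t ^ k * (- (- 'i) ^ b * r t)) ->
  is_mform k V (fun t => pair_col x (psi t * G t 0 0 + r t) (be^-1 * G t 0 0)).
Proof.
move=> hq rS; have [hG _ GS] := char_form G.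
apply: (pair_mform (al := fun g => chi g ^ a) (be := fun g => chi g ^ b) xy Vxx Vyy Vyx hq).
- rewrite gy (expE hb); exact: (has_qexpZ (c := be^-1) hG).
- move=> t; rewrite chiS psiS GS rS -/beta chiab.
  by field; rewrite iexp0 be0.
- by move=> t; rewrite chiS GS; ring.
Qed.

Lemma push_lift k (F : mform k V) (G : mform k (charMod chiP chiT b)) :
  (forall t, F t y 0 = be^-1 * G t 0 0) -> push j k F = G.
Proof.
move=> h; apply: mform_eq => t; apply/matrixP => z o; rewrite !ord1.
by rewrite [LHS]j_mul h mulrA mulfV// mul1r.
Qed.

Lemma split_case : (s / 6 + b%:~R / 12 = a%:~R / 12 :> R \/ s / 6 + b%:~R / 12 = a%:~R / 12 + 1 :> R) ->
  graded_split_short_exact (push i) (push j).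
Proof.
move=> hexp; have [inji _ _] := ses.
have main k (G : mform k (charMod chiP chiT b)) :
    is_mform k V (fun t => (\matrix_(z < 2, o < 1) if z == x then psi t else be^-1) *m G t).
  have [hG _ GS] := char_form G.
  have [q hq _] := has_qexp_mul (has_qexpZ (c := lam) hphi) hG.
  (* Exponent a/12 + 1, which occurs for a = b - 10, only means that the coefficient at a/12 is
     0. *)
  have [q' hq'] : exists q, has_qexp (gexp V x) (fun t => psi t * G t 0 0 + 0) q.
    have -> : (fun t => psi t * G t 0 0 + 0) = (fun t => lam * phi t * G t 0 0).
      by apply/funext => t; rewrite addr0.
    rewrite gx (expE ha); case: hexp => e; rewrite e in hq; first by exists q.
    by have h := has_qexp_unshift hq; eexists; exact: h.
  have r0 t : (0 : C) = val t ^ k * (- (- 'i) ^ b * 0) by rewrite !mulr0.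
  have := lift_mform (r := fun=> 0) hq' r0.
  have -> // : (fun t => pair_col x (psi t * G t 0 0 + 0) (be^-1 * G t 0 0)) =
     (fun t => (\matrix_(z < 2, o < 1) if z == x then psi t else be^-1) *m G t).
  apply/funext => t; apply: (col2P xy); rewrite [RHS]mxE big_ord1 [in RHS]mxE.
    by rewrite pair_colx eqxx addr0.
  by rewrite (pair_coly xy) yx.
have sec (k : int) (G : mform k (charMod chiP chiT b)) : push j k (graded_lift main k G) = G.
  by apply: push_lift => t; rewrite /= mxE big_ord1 mxE yx.
split; [exact: push_injective|exact: push_exact|by move=> k G; exists (graded_lift main k G)|].
by exists (graded_lift main).
Qed.

Variables (E : uhp R -> C) (e : nat -> C) (eta : int -> uhp R -> C).
Hypothesis hE : has_qexp 0 E e.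
Hypothesis e0 : e 0%N = 1.
Hypothesis ES : forall t, E (S t) = val t ^+ 2 * E t + 12 * val t / c2pi R.
Hypothesis heta : forall c : int, exists2 h, has_qexp (c%:~R / 12) (eta c) h & h 0%N != 0.
Hypothesis etaS : forall c t, eta c (S t) = (- 'i * val t) ^ c * eta c t.
Hypothesis beta0 : beta != 0.
Hypotheses (s1 : s = -1) (ab : a = b + 10).

Let exp1 : s / 6 + b%:~R / 12 = a%:~R / 12 - 1 :> R.
Proof. by rewrite s1 ab intrD -[(10 : int)%:~R]/(10%:R : R); field. Qed.

Lemma lift_off k (G : mform k (charMod chiP chiT b)) : k != b \/ lead G = 0 ->
  exists F, push j k F = G.
Proof.
move=> hk; have [hG lG GS] := char_form G; set q := sval _ in hG lG.
have [u hu u0] := has_qexp_mul (has_qexpZ (c := lam) hphi) hG; rewrite exp1 in hu.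
have GS' t : G (S t) 0 0 = (- 'i) ^ b * val t ^ k * G t 0 0 by rewrite GS; ring.
have [D [d [hD d0 DS]]] := serre_derivative hE e0 ES hG GS'.
have [h hN2 h0] := heta (- 2).
have [v hv v0] := has_qexp_mul hD hN2.
have exp2 : b%:~R / 12 + (- 2 : int)%:~R / 12 = a%:~R / 12 - 1 :> R.
  by rewrite etaN2_exp ab intrD -[(10 : int)%:~R]/(10%:R : R); field.
rewrite exp2 in hv.
(* [u 0] and [v 0] are the coefficients of psi * G and of the correction at the polar exponent a/12
   - 1. The second carries the factor (b - k)/12; if the leading coefficient of G is 0, there is
   nothing to cancel. *)
have [c hc] : exists c, u 0%N + c * v 0%N = 0.
  case: hk => [kb|l0]; last by exists 0; rewrite u0 -lG l0 mulr0 mul0r addr0.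
  have w0 : (b%:~R / 12)%:C - k%:~R / 12 != 0 :> C.
    have -> : (b%:~R / 12)%:C - k%:~R / 12 = (b - k)%:~R / 12 :> C.
      by rewrite intrB rmorphM fmorphV rmorph_int rmorph_nat; field.
    by rewrite mulf_neq0 ?invr_eq0 ?pnatr_eq0// intr_eq0 subr_eq0 eq_sym.
  exists (- (lam * p 0%N) / (((b%:~R / 12)%:C - k%:~R / 12) * h 0%N)).
  have key (w r z h' l : C) : w != 0 -> h' != 0 ->
      l * z * r + - (l * z) / (w * h') * (w * r * h') = 0.
    by move=> w1 h1; field; rewrite w1 h1.
  by rewrite u0 v0 d0; exact: key.
have hr := has_qexpD hu (has_qexpZ (c := c) hv).
(* With the polar coefficient gone, the expansion starts at a/12, as required of a first
   coordinate. *)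
have hr1 := has_qexp_shift hr hc; rewrite subrK in hr1.
have := lift_mform (G := G) (r := fun t => c * (D t * eta (- 2) t)).
rewrite gx (expE ha) => H; have {}H := H _ hr1.
have rS t : c * (D (S t) * eta (- 2) (S t)) = val t ^ k * (- (- 'i) ^ b * (c * (D t * eta (- 2) t))).
  have t0 := uhp_neq0 t.
  rewrite DS (etaN2S etaS) expfzDr// -[val t ^ 2]/(val t ^+ 2); field; exact: t0.
exists (mkMForm (H rS)); apply: push_lift => t.
exact: (pair_coly xy).
Qed.

Lemma lead_push (F : mform b V) : lead (push j b F) = 0.
Proof.
set G := push j b F; have [hG lG GS] := char_form G; set q := sval _ in hG lG.
have GE t : G t 0 0 = be * F t y 0 by exact: j_mul.
have [_ _ /(_ x)[r hr]] := mformP F; rewrite gx (expE ha) in hr.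
(* Seen from exponent a/12 - 1, the form F starts with coefficient 0; the difference below thus
   inherits its leading coefficient from psi * G. *)
have hr' : has_qexp (a%:~R / 12 - 1) (fun t => F t x 0) (fun n => if n is n'.+1 then r n' else 0).
  by apply: has_qexp_unshift; rewrite subrK.
have [u hu u0] := has_qexp_mul (has_qexpZ (c := lam) hphi) hG; rewrite exp1 in hu.
have hD := has_qexpD hr' (has_qexpZ (c := -1) hu).
(* This power brings the weight from b to 2 and the exponent from a/12 - 1 to 0. *)
have [h heb h0] := heta (2 - b).
have [v hv v0] := has_qexp_mul hD heb.
have exp0 : a%:~R / 12 - 1 + (2 - b)%:~R / 12 = 0 :> R.
  by rewrite ab intrB intrD -[(10 : int)%:~R]/(10%:R : R) -[(2 : int)%:~R]/(2%:R : R); field.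
rewrite exp0 in hv; have := weight2_lead0 hv.
have inv : (- 'i : C) ^ b * (- 'i) ^ (2 - b) = -1.
  have i0 := iexp0 1; rewrite expr1z in i0.
  rewrite -expfzDr// addrC subrK -[_ ^ 2]/((- 'i) ^+ 2) sqrrN; exact: sqr_i.
have law t : (F (S t) x 0 + -1 * (lam * phi (S t) * G (S t) 0 0)) * eta (2 - b) (S t) =
   val t ^+ 2 * ((F t x 0 + -1 * (lam * phi t * G t 0 0)) * eta (2 - b) t).
  have t0 := uhp_neq0 t.
  have FS : F (S t) x 0 = val t ^ b * (- (- 'i) ^ b * F t x 0 + beta * F t y 0).
    by rewrite mform_S mxE (triangular_mulx (al := fun g => chi g ^ a) xy Vxx) chiS chiab.
  rewrite FS GS etaS (GE t) -/(psi (S t)) psiS -/(psi t) expfzMl.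
  have tt : val t ^ b * val t ^ (2 - b) = val t ^+ 2.
    by rewrite -expfzDr// addrC subrK.
  rewrite -tt.
  (* The two terms in [bt] cancel: the constant in the law of psi was made for that. Then A * B = -1
     turns the remaining sign into +1. *)
  have key (A B tb te Fx Fy ps bt e' c : C) : A != 0 -> c != 0 -> A * B = -1 ->
      (tb * (- A * Fx + bt * Fy) + -1 * ((- ps + c^-1 * bt / A) * (tb * (A * (c * Fy))))) * (B * te * e') =
      (tb * te) * ((Fx + -1 * (ps * (c * Fy))) * e').
    move=> A0 c0 AB.
    transitivity (- (A * B) * (tb * te) * ((Fx + -1 * (ps * (c * Fy))) * e')).
      by field; rewrite A0 c0.
    by rewrite AB opprK mul1r.
  exact: key.
have lam0 : lam != 0 by rewrite /lam !mulf_neq0 ?invr_eq0.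
move=> /(_ law); rewrite v0 /= add0r u0 => h1; rewrite lG.
have key (l1 l2 l3 l4 : C) : l1 != 0 -> l2 != 0 -> l3 != 0 -> l4 != 0 ->
    -1 * (l1 * l2 * l3) * l4 != 0.
  by move=> *; rewrite !mulf_neq0// oppr_eq0 oner_eq0.
by apply/eqP/negPn/negP => q0; move/eqP: h1; apply/negP; exact: key.
Qed.

Lemma nonsplit_case : exists (Cb : gradedMod R) (q : gradedMap (Hmod (charMod chiP chiT b)) Cb),
  [/\ graded_line Cb b, graded_injective (push i), graded_exact (push i) (push j),
      graded_exact (push j) q & graded_surjective q].
Proof.
have [inji _ _] := ses.
have [h hb0 h0] := heta b.
(* The 2b-th power of eta has weight b and character chi^b. Its nonzero leading coefficient gives
   surjectivity onto C_b. *)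
have hG0 : is_mform b (charMod chiP chiT b) (fun t => (eta b t)%:M).
  apply: is_mform_ST => [z|t].
    rewrite ord1 (expE hb); exists h.
    by apply: has_qexp_ext hb0 => t; rewrite mxE eqxx mulr1n.
  rewrite etaS [charMod _ _ _ _]/= chiS -scalar_mxM scale_scalar_mx.
  have key (X Y e' : C) : X * Y * e' = Y * (X * e') by ring.
  congr (_%:M); apply: etrans (key _ _ _).
  exact: (congr1 (fun z => z * eta b t) (expfzMl _ _ _)).
pose G0 : mform b (charMod chiP chiT b) := mkMForm hG0.
have hq : has_qexp (gexp (charMod chiP chiT b) 0) (fun t => G0 t 0 0) h.
  rewrite (expE hb); apply: has_qexp_ext hb0 => t.
  by apply: esym; apply: etrans (mxE _ _ _ _) _; rewrite eqxx mulr1n.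
have lG0 : lead G0 != 0 by rewrite (leadE hq).
have off k l (f : modform R k) (G : mform l (charMod chiP chiT b)) :
    k + l = b -> l != b -> lead f * lead G = 0.
  move=> kl lb; have [F hF] := lift_off (or_introl lb : l != b \/ lead G = 0).
  have := lead_push (gact kl f F); rewrite gmap_act hF.
  by move=> e1; rewrite -(lead_mact kl).
(* Multiplying g by [G0] raises its weight by b, which reduces the claim to [off]. *)
have off0 k l (f : modform R k) (g : modform R l) : k + l = 0 -> l != 0 -> lead f * lead g = 0.
  move=> kl l0; have e2 : k + (l + b) = b by rewrite addrA kl add0r.
  have lb : l + b != b by apply: contra_neq l0 => h'; apply: (addIr b); rewrite add0r.
  have := off _ _ f (mact (erefl (l + b)) g G0) e2 lb.
  by rewrite lead_mact mulrA => /eqP; rewrite mulf_eq0 (negbTE lG0) orbF => /eqP.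
exists (line b off0), (line_proj off0 off); split.
- exact: line_graded.
- exact: push_injective.
- exact: push_exact.
- move=> k G; split => [/line_proj_eq0 h1|[F <-]]; first exact: lift_off.
  apply/line_proj_eq0; have [kb|] := pselect (k = b); last by move/eqP; left.
  by right; move: F; rewrite kb => F; exact: lead_push.
move=> k z; have [kb|kb] := pselect (k = b); last first.
  exists 0; rewrite linear0; apply: line_ext => o; case: (kb); exact: line_index o.
move: z; rewrite kb => z; have hz : (0 < (b == b))%N by rewrite eqxx.
exists (((z : 'rV[C]_(b == b)) 0 (Ordinal hz) / lead G0) *: G0).
apply: line_ext => o; apply: (etrans (mxE _ _ _ _)); rewrite leadZ divfK//.
by rewrite -(line_sum z o) -(line_sum z (Ordinal hz)).
Qed.

End ExactSequence.

Theorem theorem4 (R : realType)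
  (chi : SL2Z -> R[i]) (chiP : is_character chi)
  (chiT : chi SL2Z_T = e2pi (12%:R^-1))
  (a b : int) (ha : 0 <= a <= 11) (hb : 0 <= b <= 11)
  (hab : (a - b = 2 %[mod 12])%Z \/ (a - b = - 2 %[mod 12])%Z)
  (V : gammaMod R 2) (Vindec : gamma_indecomposable V)
  (i : gammaMap (charMod chiP chiT a) V)
  (j : gammaMap V (charMod chiP chiT b))
  (ses : gamma_short_exact i j)
  (P : 'M[R[i]]_2) (Punit : P \in unitmx)
  (Pspan : exists2 c : R[i], c != 0 & col 0 P = c *: hmx i)
  (rho : SL2Z -> 'M[R[i]]_2) (rhoE : forall g, rho g = invmx P *m V g *m P)
  (rho_upper : forall g, rho g 1 0 = 0) :
  graded_split_short_exact (push i) (push j) \/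
  (((a = 10 /\ b = 0) \/ (a = 11 /\ b = 1)) /\
   exists (Cb : gradedMod R)
     (p : gradedMap (Hmod (charMod chiP chiT b)) Cb),
     [/\ graded_line Cb b,
         graded_injective (push i),
         graded_exact (push i) (push j),
         graded_exact (push j) p
       & graded_surjective p]).
Proof.
(* As a - b lies between -11 and 11, each congruence leaves two values, grouped here by the sign of
   the Eichler exponent. *)
have cases : (a = b + 2 \/ a = b - 10) \/ (a = b - 2 \/ a = b + 10) by lia.
have nab : modz a 12 != modz b 12 by apply/eqP; lia.
have [x [y [al [be [[xy al0 be0] [[iE jE gx gy] Vg]]]]]] := ses_normal_form ses nab.
have Vxx g : V g x x = chi g ^ a by case: (Vg g).
have Vyy g : V g y y = chi g ^ b by case: (Vg g).
have Vyx g : V g y x = 0 by case: (Vg g).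
have beta0 := indecomposable_xy (al := fun g => chi g ^ a) (be := fun g => chi g ^ b) xy Vxx Vyy Vyx Vindec.
have [E [e [eta [hE e0 ES heta etaS]]]] := eta_exists R.
have i0 : (- 'i : R[i]) != 0 by rewrite -(character_S chiP chiT); exact: character_neq0.
(* The square of -i is -1 and its fourth power is 1, so a shift of the exponent by 2 or 10 changes
   the sign: chi^a and chi^b are opposite at S in all four cases. *)
have i2 : (- 'i : R[i]) ^ (Posz 2) = -1 by rewrite -exprnP sqrrN; exact: sqr_i.
have i4 : (- 'i : R[i]) ^ (Posz 4) = 1 by rewrite -[Posz 4]/(Posz 2 + Posz 2) expfzDr// i2 mulrNN mulr1.
have i8 : (- 'i : R[i]) ^ (Posz 8) = 1 by rewrite -[Posz 8]/(Posz 4 + Posz 4) expfzDr// i4 mulr1.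
have i10 : (- 'i : R[i]) ^ (Posz 10) = -1 by rewrite -[Posz 10]/(Posz 8 + Posz 2) expfzDr// i8 i2 mul1r.
have iV (c : int) (d : nat) : (- 'i : R[i]) ^ (Posz d) = -1 -> (- 'i : R[i]) ^ (c - Posz d) = - (- 'i) ^ c.
  by move=> h; rewrite expfzDr// -invr_expz h invrN1 mulrN1.
have iD (c : int) (d : nat) : (- 'i : R[i]) ^ (Posz d) = -1 -> (- 'i : R[i]) ^ (c + Posz d) = - (- 'i) ^ c.
  by move=> h; rewrite expfzDr// h mulrN1.
have n2 : (2 : int)%:~R = 2 :> R by [].
have n10 : (10 : int)%:~R = 10 :> R by [].
case: cases => [ab|ab].
  have [phi [p [kappa [hphi p0 k0 phiS]]]] := eichler_exists hE e0 ES heta etaS (or_introl (erefl 1) : 1 = 1 \/ 1 = -1 :> R).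
  have chiab : (- 'i : R[i]) ^ a = - (- 'i) ^ b by case: ab => ->; [exact: iD|exact: iV].
  left; apply: (split_case ha hb ses xy al0 be0 iE jE gx gy Vxx Vyy Vyx hphi k0 phiS chiab).
  case: ab => ->; [left|right]; first by rewrite intrD n2; field.
  by rewrite intrB n10; field.
have [phi [p [kappa [hphi p0 k0 phiS]]]] := eichler_exists hE e0 ES heta etaS (or_intror (erefl (-1)) : -1 = 1 \/ -1 = -1 :> R).
have chiab : (- 'i : R[i]) ^ a = - (- 'i) ^ b by case: ab => ->; [exact: iV|exact: iD].
case: ab => ab.
  left; apply: (split_case ha hb ses xy al0 be0 iE jE gx gy Vxx Vyy Vyx hphi k0 phiS chiab).
  by left; rewrite ab intrB n2; field.
(* With a = b + 10, 0 <= b and a <= 11, only b = 0 and b = 1 remain. *)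
right; split; first by move: ha hb ab; clear; lia.
exact: (nonsplit_case ha hb ses xy al0 be0 iE jE gx gy Vxx Vyy Vyx hphi p0 k0 phiS chiab
  hE e0 ES heta etaS beta0 erefl ab).
Qed.
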